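(* Let $Q\subseteq \mathbb{R}^d$ be a cube, let $1\leq u\leq p\leq q <\infty$, $w\in A_{u}$ and assume $$\varepsilon:=\tfrac1{du} - \left(\tfrac1p - \tfrac1q\right)\geq 0.$$ Then for all $f \in W^{1,p}_{w^{1/p}}(Q)$ $$\left(\frac{1}{w(Q)}\int_{Q}|f-\langle f\rangle_{Q}|^q\,w\,dx\right)^{\frac1q} \lesssim_{p,q,d} \ell(Q) \cdot \left(\frac{1}{w(Q)}\int_{Q}|\nabla f|^p\,w\,dx\right)^{\frac1p}\cdot [w]_{A_p}^{\frac{1}{p}} [w]_{A_u}^{\frac{1}{p}-\frac1q} \cdot K,$$ where $$K=\begin{cases} \tfrac{1}{\varepsilon} & \text{if } \varepsilon>0,\\ [w]_{A_\infty}^{1/p'} & \text{if } p>1,\\ [w]_{A_\infty} & \text{if } p=1. \end{cases}$$ The three cases are not mutually exclusive: the estimate holds with the value of $K$ from each case whose condition is satisfied.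
   Context: Cubes have sides parallel to the coordinate axes; $\ell(Q)$ is the side length of $Q$. A weight is a measurable function with values in $(0,\infty)$; $w(Q):=\int_Q w$. $p'$ is the Hölder conjugate of $p$. $\langle f\rangle_Q:=\frac1{|Q|}\int_Q f$; $\langle f\rangle_{t,Q}:=\langle|f|^t\rangle_Q^{1/t}$ for $0<t<\infty$ and $\langle f\rangle_{\infty,Q}:=\|f\|_{L^\infty(Q)}$. For $p\in[1,\infty)$, $w\in A_p$ means that $w$ is a weight on $\mathbb{R}^d$ with $[w]_{A_p}:=\sup_Q\langle w\rangle_{1,Q}\langle w^{-1}\rangle_{\frac1{p-1},Q}<\infty$, the supremum over all cubes $Q\subseteq\mathbb{R}^d$ (with $\frac1{p-1}=\infty$ if $p=1$). Moreover $[w]_{A_\infty}:=\sup_{R}\frac1{w(R)}\int_R\sup_{S\subseteq R}\langle w\rangle_{1,S}\mathbf{1}_S(x)\,dx$, with $R$ ranging over all cubes in $\mathbb{R}^d$ and $S$ over cubes contained in $R$. With weights as multipliers, $\|f\|_{L^p_\sigma(Q)}:=\left(\int_Q|f|^p\sigma^p\,dx\right)^{1/p}$, and for a weight $\sigma$ with $\sigma^{-1}\in L^{p'}(Q)$, $W^{1,p}_\sigma(Q)$ is the space of all $f\in L^p_\sigma(Q)\subseteq L^1(Q)$ whose distributional derivatives $\partial_jf$, $1\le j\le d$, lie in $L^p_\sigma(Q)$. Here $\sigma=w^{1/p}$. $A\lesssim_{a,b,\dots}B$ means $A\le C\,B$ with a constant $C>0$ depending only on $a,b,\dots$. *)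

(* Defs.v *)
From HB Require Import structures.
From mathcomp Require Import all_boot all_order all_algebra.
From mathcomp Require Import all_classical all_reals all_analysis.

Set Implicit Arguments.
Unset Strict Implicit.
Unset Printing Implicit Defensive.

Import Order.TTheory GRing.Theory Num.Theory.
Import numFieldNormedType.Exports.

Local Open Scope classical_set_scope.
Local Open Scope ring_scope.

(* The Borel sigma-algebra of R^n = 'rV[R]_n, generated by the coordinate
   functions.  *)
Definition rV_display : Type -> measure_display.
Proof. exact. Qed.

Section borel_rV.
Context {R : realType} {n : nat}.

Definition rV_coord (i : 'I_n) (x : 'rV[R]_n) : measurableTypeR R := x ord0 i.

Let borel0 : g_sigma_preimage rV_coord set0.
Proof. exact: sigma_algebra0. Qed.

Let borelC A : g_sigma_preimage rV_coord A -> g_sigma_preimage rV_coord (~` A).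
Proof. exact: sigma_algebraC. Qed.

Let borelU (F : (set 'rV[R]_n)^nat) :
  (forall i, g_sigma_preimage rV_coord (F i)) ->
  g_sigma_preimage rV_coord (\bigcup_i (F i)).
Proof. exact: sigma_algebra_bigcup. Qed.

HB.instance Definition _ := @isMeasurable.Build (rV_display R)
  'rV[R]_n (g_sigma_preimage rV_coord) borel0 borelC borelU.

Lemma measurable_rV_coord i : measurable_fun [set: 'rV[R]_n] (rV_coord i).
Proof.
move=> _ Y mY; rewrite setTI; apply: sub_sigma_algebra => /=.
rewrite -bigcup_seq/=; exists i => /=; first by rewrite mem_index_enum.
by exists Y => //; rewrite setTI.
Qed.

Lemma measurable_fun_rV d (T : measurableType d) (f : T -> 'rV[R]_n) :
  (forall i, measurable_fun [set: T] (rV_coord i \o f)) ->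
  measurable_fun [set: T] f.
Proof.
move=> mf _ A mA; rewrite setTI.
suff : g_sigma_preimage (fun i => rV_coord i \o f) `<=` measurable.
  by apply; rewrite g_sigma_preimage_comp; exists A => //; rewrite setTI.
apply: smallest_sub; first exact: sigma_algebra_measurable.
rewrite -bigcup_seq; apply: bigcup_sub => i _.
by move=> B [C mC <-]; exact: mf.
Qed.

End borel_rV.

Section lebesgue_rVS.
Context {R : realType} {n : nat}.

Definition rV_cons (x : measurableTypeR R * 'rV[R]_n) : 'rV[R]_n.+1 :=
  \row_i (if unlift ord0 i is Some j then x.2 ord0 j else x.1).

Definition rV_uncons (x : 'rV[R]_n.+1) : measurableTypeR R * 'rV[R]_n :=
  (x ord0 ord0, \row_i x ord0 (lift ord0 i)).

Lemma rV_cons0 x : rV_cons x ord0 ord0 = x.1.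
Proof. by rewrite mxE unlift_none. Qed.

Lemma rV_consS x i : rV_cons x ord0 (lift ord0 i) = x.2 ord0 i.
Proof. by rewrite mxE liftK. Qed.

Lemma rV_consK : cancel rV_cons rV_uncons.
Proof.
move=> [a x]; rewrite /rV_uncons rV_cons0/=; congr (_, _).
by apply/rowP => i; rewrite mxE rV_consS.
Qed.

Lemma measurable_rV_cons : measurable_fun setT rV_cons.
Proof.
apply: measurable_fun_rV => i.
case: (unliftP ord0 i) => [j ->|->].
  rewrite (_ : _ \o _ = rV_coord j \o snd).
    exact: measurableT_comp (measurable_rV_coord j) measurable_snd.
  by apply/funext => x; rewrite /= /rV_coord rV_consS.
rewrite (_ : _ \o _ = fst); first exact: measurable_fst.
by apply/funext => x; rewrite /= /rV_coord rV_cons0.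
Qed.

Lemma measurable_rV_uncons : measurable_fun setT rV_uncons.
Proof.
apply: measurable_fun_pair; first exact: (measurable_rV_coord ord0).
apply: measurable_fun_rV => i.
rewrite (_ : _ \o _ = rV_coord (lift ord0 i)).
  exact: measurable_rV_coord.
by apply/funext => x; rewrite /= /rV_coord mxE.
Qed.

Variable m : {sigma_finite_measure set 'rV[R]_n -> \bar R}.

Definition lebesgue_rVS : set 'rV[R]_n.+1 -> \bar R :=
  pushforward (@lebesgue_measure R \x m)%E rV_cons.

Let lebesgue_rVS0 : lebesgue_rVS set0 = 0%E.
Proof. by rewrite /lebesgue_rVS /pushforward preimage_set0 measure0. Qed.

Let lebesgue_rVS_ge0 A : (0 <= lebesgue_rVS A)%E.
Proof. exact: (measure_ge0 (@lebesgue_measure R \x m)%E). Qed.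

Let lebesgue_rVS_sigma_additive : semi_sigma_additive lebesgue_rVS.
Proof.
move=> F mF tF mUF; rewrite /lebesgue_rVS /pushforward preimage_bigcup.
apply: (@measure_semi_sigma_additive _ _ _ (@lebesgue_measure R \x m)%E).
- by move=> k; rewrite -[X in measurable X]setTI; exact: measurable_rV_cons.
- apply/trivIsetP => /= i j _ _ ij; rewrite -preimage_setI.
  by move/trivIsetP : tF => /(_ _ _ _ _ ij) ->//; rewrite preimage_set0.
- rewrite -preimage_bigcup -[X in measurable X]setTI.
  exact: measurable_rV_cons.
Qed.

HB.instance Definition _ := isMeasure.Build _ _ _ lebesgue_rVS
  lebesgue_rVS0 lebesgue_rVS_ge0 lebesgue_rVS_sigma_additive.

Let lebesgue_rVS_sigma_finite : sigma_finite setT lebesgue_rVS.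
Proof.
have /sigma_finiteP[F [TF ndF Foo]] := sigma_finiteT (@lebesgue_measure R).
have /sigma_finiteP[G [TG ndG Goo]] := sigma_finiteT m.
exists (fun k => rV_uncons @^-1` (F k `*` G k)).
  rewrite -preimage_bigcup (_ : \bigcup_k _ = setT) ?preimage_setT//.
  apply/seteqP; split => // -[x y] _.
  have [i _ Fx] : (\bigcup_k F k) x by rewrite -TF.
  have [j _ Gy] : (\bigcup_k G k) y by rewrite -TG.
  exists (maxn i j) => //; split.
  - by move: x Fx; exact/subsetPset/ndF/leq_maxl.
  - by move: y Gy; exact/subsetPset/ndG/leq_maxr.
move=> k; have [mF Fk] := Foo k; have [mG Gk] := Goo k; split.
  rewrite -[X in measurable X]setTI.
  by apply: measurable_rV_uncons => //; exact: measurableX.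
rewrite /lebesgue_rVS /pushforward -comp_preimage.
rewrite (_ : _ \o _ = id) ?preimage_id; last exact/funext/rV_consK.
by rewrite product_measure1E// lte_mul_pinfty// ge0_fin_numE.
Qed.

HB.instance Definition _ := Measure_isSigmaFinite.Build _ _ _ lebesgue_rVS
  lebesgue_rVS_sigma_finite.

End lebesgue_rVS.

(* Lebesgue measure on the Borel sets of R^n, as an iterated product measure
   (a point mass for n = 0).  *)
Fixpoint borel_lebesgue (R : realType) (n : nat) :
    {sigma_finite_measure set 'rV[R]_n -> \bar R} :=
  match n with
  | 0 => [the {sigma_finite_measure set 'rV[R]_0 -> \bar R} of \d_(0 : 'rV[R]_0)]
  | n'.+1 => [the {sigma_finite_measure set 'rV[R]_n'.+1 -> \bar R} of
               lebesgue_rVS (borel_lebesgue R n')]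
  end.

(* The completion of [borel_lebesgue]: the ambient measurable type
   [caratheodory_type _] is 'rV[R]_d with the Lebesgue-measurable sets, so all
   measurability and integrals below are in the sense of Lebesgue.  *)
Definition leb (R : realType) (d : nat) :=
  @completed_measure_extension _ _ _ (borel_lebesgue R d).
Arguments leb : clear implicits.

HB.instance Definition _ R d := Measure.on (leb R d).

Section lebesgue_box.
Context {R : realType}.

Definition box d (a b : 'rV[R]_d) : set 'rV[R]_d :=
  [set x | forall i, a ord0 i < x ord0 i < b ord0 i].

Lemma measurable_box d (a b : 'rV[R]_d) : measurable (box a b).
Proof.
rewrite (_ : box a b =
    \big[setI/setT]_i (rV_coord i @^-1` `]a ord0 i, b ord0 i[%classic)).
  apply: bigsetI_measurable => i _.
  by rewrite -[X in measurable X]setTI; exact: measurable_rV_coord.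
rewrite -bigcap_seq; apply/seteqP; split => x /= H i.
  by move=> _; have := H i; rewrite /= in_itv.
by have := H i; rewrite /= in_itv/=; apply; rewrite mem_index_enum.
Qed.

Lemma borel_lebesgue_box d (a b : 'rV[R]_d) :
  (forall i, a ord0 i <= b ord0 i) ->
  borel_lebesgue R d (box a b) = (\prod_i (b ord0 i - a ord0 i))%:E.
Proof.
elim: d a b => [|d IH] a b ab.
  by rewrite big_ord0 /= diracE mem_set//=; case.
pose a' : 'rV[R]_d := \row_i a ord0 (lift ord0 i).
pose b' : 'rV[R]_d := \row_i b ord0 (lift ord0 i).
rewrite big_ord_recl -[LHS]/((@lebesgue_measure R \x borel_lebesgue R d)%E
  (rV_cons @^-1` box a b)).
rewrite (_ : rV_cons @^-1` _ = `]a ord0 ord0, b ord0 ord0[ `*` box a' b').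
  rewrite product_measure1E//; last exact: measurable_box.
  rewrite IH; last by move=> i; rewrite !mxE.
  rewrite EFinM; congr (_ * _)%E; last first.
    by congr EFin; apply: eq_bigr => i _; rewrite !mxE.
  transitivity (@lebesgue_measure R `]a ord0 ord0, b ord0 ord0[%classic) => //.
  rewrite lebesgue_measure_itv/= lte_fin; case: ltP => [//|h].
  by rewrite (_ : b ord0 ord0 = a ord0 ord0) ?subrr//; apply/le_anti; rewrite h ab.
apply/seteqP; split => [[x y] /= H|[x y] /= [H1 H2] i].
  split; first by have := H ord0; rewrite rV_cons0 in_itv.
  by move=> i; have := H (lift ord0 i); rewrite rV_consS !mxE.
case: (unliftP ord0 i) => [j ->|->].
  by have := H2 j; rewrite rV_consS !mxE.
by rewrite rV_cons0; rewrite in_itv in H1.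
Qed.

Lemma leb_box d (a b : 'rV[R]_d) : (forall i, a ord0 i <= b ord0 i) ->
  leb R d (box a b) = (\prod_i (b ord0 i - a ord0 i))%:E.
Proof.
move=> ab; rewrite -borel_lebesgue_box//.
by apply: measurable_mu_extE; exact: measurable_box.
Qed.

End lebesgue_box.

Section weighted_sobolev.
Context {R : realType} {d : nat}.

Local Notation mu := (leb R d).
Local Notation Rd := (caratheodory_type (borel_lebesgue R d)^*%mu).

Implicit Types (Q : set 'rV[R]_d) (f w sigma : 'rV[R]_d -> R).

(* The type annotations select the Lebesgue-measurable sets; without them the
   Borel structure on 'rV[R]_d would be inferred.  *)
Definition lmeasurable_fun Q f := measurable_fun (Q : set Rd) (f : Rd -> R).

(* The open cube with lower corner a and side length l; the choice of open cubes
   only matters up to null sets.  *)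
Definition cube (a : 'rV[R]_d) (l : R) : set 'rV[R]_d :=
  box a (a + const_mx l).

Definition cubes : set (set 'rV[R]_d) :=
  [set Q | exists a l, 0 < l /\ Q = cube a l].

Definition avg Q f : R := (fine (mu Q))^-1 * \int[mu]_(x in Q) f x.

(* <f>_{t,Q}; for t = +oo this is the essential supremum of |f| over Q (the
   value for t = -oo is irrelevant).  *)
Definition pavg (t : \bar R) Q f : \bar R :=
  if t is r%:E then
    ((mu Q)^-1 * \int[mu]_(x in Q) (`|f x| `^ r)%:E) `^ r^-1
  else 'N[mu]_(+oo)[(EFin \o f) \_ Q].

Definition weight w := lmeasurable_fun setT w /\ forall x, 0 < w x.

Definition wmeasure w Q : \bar R := \int[mu]_(x in Q) (w x)%:E.

(* In [\bar R] the inverse of 0 is +oo, so that 1/(p-1) is +oo for p = 1.  *)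
Definition Ap_const (p : R) w : \bar R :=
  ereal_sup [set (pavg 1 Q w * pavg ((p - 1)%:E^-1) Q (fun x => (w x)^-1)%R)%E
            | Q in cubes].

Definition Ap (p : R) : set ('rV[R]_d -> R) :=
  [set w | weight w /\ (Ap_const p w < +oo)%E].

Definition Ainfty_const w : \bar R :=
  ereal_sup [set ((wmeasure w Q)^-1 * \int[mu]_(x in Q)
      ereal_sup [set pavg 1 S w * (\1_S x : R)%:E
                | S in cubes `&` [set S | S `<=` Q]])%E
    | Q in cubes].

Definition partial (i : 'I_d) f : 'rV[R]_d -> R := 'D_(delta_mx ord0 i) f.

(* C^oo: every iterated partial derivative exists and is continuous.  *)
Definition smooth f := forall s : seq 'I_d,
  continuous (foldr partial f s) /\
  forall i x, derivable (foldr partial f s) x (delta_mx ord0 i).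

Definition test_fun Q f :=
  [/\ smooth f, compact (closure [set x | f x != 0])
    & closure [set x | f x != 0] `<=` Q].

Definition weak_partial Q (i : 'I_d) f (g : 'rV[R]_d -> R) :=
  forall phi, test_fun Q phi ->
    (\int[mu]_(x in Q) (f x * partial i phi x)%:E =
     - \int[mu]_(x in Q) (g x * phi x)%:E)%E.

Definition wLnorm (p : R) sigma Q f : \bar R :=
  (\int[mu]_(x in Q) (`|f x| `^ p * sigma x `^ p)%:E) `^ p^-1.

Definition wLp (p : R) sigma Q : set ('rV[R]_d -> R) :=
  [set f | lmeasurable_fun Q f /\ (wLnorm p sigma Q f < +oo)%E].

(* f belongs to W^{1,p}_sigma(Q), and g i is a representative of its i-th
   distributional derivative.  When sigma^-1 is in L^{p'}(Q), as is the case for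
   sigma = w^(1/p) with w in A_u and u <= p, Hoelder gives f, g i in L^1(Q), so
   that the integrals in [weak_partial] are absolutely convergent.  *)
Definition W1p (p : R) sigma Q f (g : 'I_d -> 'rV[R]_d -> R) :=
  wLp p sigma Q f /\
  forall i, wLp p sigma Q (g i) /\ weak_partial Q i f (g i).

Definition enorm (g : 'I_d -> 'rV[R]_d -> R) (x : 'rV[R]_d) : R :=
  Num.sqrt (\sum_i g i x ^+ 2).

Definition wmean (p : R) w Q f : \bar R :=
  ((wmeasure w Q)^-1 * \int[mu]_(x in Q) (`|f x| `^ p * w x)%:E) `^ p^-1.

End weighted_sobolev.

(* Main.v *)
(* Let phi(P) be the average over a dyadic subcube P of Q of a truncation of f
   living on the level set J of |f - <f>_Q|.  Testing the weak derivative against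
   smooth approximations of tent functions shows that phi changes between P and
   a child of P by at most C l(P) times the average over P of |grad f| 1_{f in J}.
   Telescoping down the dyadic tree of Q bounds, for the union E of the cubes of
   generation K where |phi - phi(Q)| > T,
     T w(E) <= C sum_P l(P) <|grad f| 1_{f in J}>_P w(E n P),
   and the averages are controlled by Hoelder and the A_p condition, l(P) by
   l(P)/l(Q) <= ([w]_{A_u} w(P)/w(Q))^{1/(du)}.  If eps > 0, the sum is geometric
   over generations.  In general the cubes are grouped by the dyadic size of w(P):
   the cubes of one size form chains, whose length is at most C [w]_{A_infty}, and
   the sum over sizes converges since 0 < 1/p - 1/q < 1/p.  Letting K tend to
   infinity gives a weak type estimate for each truncation, and as the
   truncations at the levels 16^k s have disjoint sets J, these estimates add up
   to the strong type estimate. *)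

Require Import Defs.
From mathcomp Require Import all_boot all_order all_algebra.
From mathcomp Require Import all_classical all_reals all_analysis.
From mathcomp Require Import measurable_realfun ess_sup_inf zify ring lra.
Set Implicit Arguments.
Unset Strict Implicit.
Unset Printing Implicit Defensive.
Import Order.TTheory GRing.Theory Num.Theory.
Import numFieldNormedType.Exports.
Local Open Scope classical_set_scope.
Local Open Scope ring_scope.

(** * Real-valued integrals *)

(** The weak derivative gives linear information on f only, while averages of a truncation T o f are
    wanted. The nonlinearity enters through averages: T is applied to the averages of f over the
    cells of ever finer grids, and for two neighbouring cells these values differ only if f lies in
    J on both cells, up to an exceptional set whose contribution tends to 0. With alpha = 1/p - 1/q
    one has alpha + eps = 1/(du). At generation n this splits l(P)/l(Q) into ([w]_{A_u}
    w(P)/w(Q))^alpha and rho^n with rho = 2^(-du eps). The first factor turns the w(E)^(1-1/p) of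
    Hölder into w(E)^(1-1/q), that is, into weak type q; the second yields 1/(1 - rho), of order
    1/eps, and nothing is left of it at eps = 0. The constant of the weight classes blows up as q
    tends to p. For p = q, however, eps = 1/(du) >= 1/(dp), and the estimate with 1/eps takes over.
    If [w]_{A_infty} = +oo, the right-hand side is infinite unless the gradient vanishes; then 0 *
    +oo = 0 calls for a separate argument. *)

Section real_integral.
Context {dT : measure_display} {T : measurableType dT} {R : realType}.
Variable mu : {measure set T -> \bar R}.
Implicit Types (D A B : set T) (f g h : T -> R).

Local Notation itg D f := (mu.-integrable D (EFin \o f)).

Lemma itg_mfun D f : itg D f -> measurable_fun D f.
Proof. by move=> /measurable_int/measurable_EFinP. Qed.

Lemma itgD D f g : measurable D -> itg D f -> itg D g -> itg D (fun x => f x + g x).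
Proof. by move=> mD ff gg; have := integrableD mD ff gg; apply: eq_integrable. Qed.

Lemma itgB D f g : measurable D -> itg D f -> itg D g -> itg D (fun x => f x - g x).
Proof. by move=> mD ff gg; have := integrableB mD ff gg; apply: eq_integrable. Qed.

Lemma itgZ D f (k : R) : measurable D -> itg D f -> itg D (fun x => k * f x).
Proof. by move=> mD ff; have := integrableZl mD k ff; apply: eq_integrable. Qed.

Lemma itg_norm D f : measurable D -> itg D f -> itg D (fun x => `|f x|).
Proof. by move=> mD ff; have := integrable_abse ff; apply: eq_integrable. Qed.

Lemma itg_le D f g : measurable D -> measurable_fun D f ->
  (forall x, D x -> `|f x| <= g x) -> itg D g -> itg D f.
Proof.
move=> mD mf fg; apply: le_integrable => //; first exact/measurable_EFinP.
by move=> x Dx /=; rewrite lee_fin (le_trans (fg _ Dx))// ler_norm.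
Qed.

Lemma itgS A B f : measurable A -> measurable B -> A `<=` B -> itg B f -> itg A f.
Proof. by move=> mA mB AB; exact: integrableS. Qed.

Lemma itg_cst D (k : R) : measurable D -> (mu D < +oo)%E -> itg D (fun=> k).
Proof.
move=> mD Doo; apply: measurable_bounded_integrable => //.
by exists `|k|; split => // M kM x _ /=; exact: ltW.
Qed.

Lemma itg_bounded D f (M : R) : measurable D -> (mu D < +oo)%E -> measurable_fun D f ->
  (forall x, D x -> `|f x| <= M) -> itg D f.
Proof. by move=> mD Doo mf fM; apply: (@itg_le D f (fun=> M)) => //; exact: itg_cst. Qed.

Lemma itg_mul_bounded D f g (M : R) : measurable D -> itg D f -> measurable_fun D g ->
  (forall x, D x -> `|g x| <= M) -> itg D (fun x => f x * g x).
Proof.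
move=> mD ff mg gM; apply: (@itg_le D _ (fun x => M * `|f x|)) => //.
- by apply: measurable_funM => //; exact: itg_mfun.
- by move=> x Dx; rewrite normrM mulrC ler_wpM2r// gM.
- by apply: itgZ => //; exact: itg_norm.
Qed.

Lemma itg_indic D f B : measurable D -> measurable B -> itg D f ->
  itg D (fun x => f x * \1_B x).
Proof.
move=> mD mB ff; apply: (@itg_mul_bounded _ _ _ 1) => //.
move=> x _; rewrite indicE; case: (_ \in _); rewrite ?normr1 ?normr0//.
Qed.

Lemma itg_bool D f (b : T -> bool) : measurable D -> itg D f -> measurable_fun D b ->
  itg D (fun x => f x * (b x)%:R).
Proof.
move=> mD ff mb; apply: (@itg_mul_bounded _ _ _ 1 mD ff).
  by apply: (@measurableT_comp _ _ _ _ _ _ (fun c : bool => c%:R : R)).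
by move=> x _; case: (b x); rewrite ?normr1 ?normr0.
Qed.

Lemma itg_sum (I : finType) D (F : I -> T -> R) : measurable D ->
  (forall i, itg D (F i)) -> itg D (fun x => \sum_i F i x).
Proof.
move=> mD FI; have := @integrable_sum _ _ _ mu D mD I (index_enum I) xpredT
  (fun i => EFin \o F i) (fun i _ => FI i).
by apply: eq_integrable => // x _; rewrite /= sumEFin.
Qed.

Lemma Rint_EFin D f : measurable D -> itg D f -> (\int[mu]_(x in D) (f x)%:E)%E = (\int[mu]_(x in D) f x)%:E.
Proof. by move=> mD ff; rewrite /Rintegral fineK// integrable_fin_num. Qed.

Lemma Rint_sum (I : finType) D (F : I -> T -> R) : measurable D ->
  (forall i, itg D (F i)) ->
  \int[mu]_(x in D) (\sum_i F i x) = \sum_i \int[mu]_(x in D) F i x.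
Proof.
move=> mD FI; apply: EFin_inj; rewrite -Rint_EFin//; last exact: itg_sum.
rewrite -sumEFin; under eq_integral do rewrite -sumEFin.
rewrite integral_sum//; apply: eq_bigr => i _; exact: Rint_EFin.
Qed.

Lemma Rint_mono D f g : measurable D -> itg D f -> itg D g ->
  (forall x, D x -> f x <= g x) -> \int[mu]_(x in D) f x <= \int[mu]_(x in D) g x.
Proof. exact: le_Rintegral. Qed.

Lemma Rint_subset A B f : measurable A -> measurable B -> A `<=` B -> itg B f ->
  (forall x, B x -> 0 <= f x) -> \int[mu]_(x in A) f x <= \int[mu]_(x in B) f x.
Proof.
move=> mA mB AB ff f0; rewrite -lee_fin -!Rint_EFin//; last exact: itgS ff.
by apply: ge0_subset_integral => //; first exact: measurable_int ff.
Qed.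

Lemma Rint_indic D f B : measurable D -> measurable B ->
  \int[mu]_(x in D) (f x * \1_B x) = \int[mu]_(x in D `&` B) f x.
Proof.
move=> mD mB; rewrite Rintegral_mkcondr; apply: eq_Rintegral => x _.
by rewrite patchE indicE; case: ifP => _; rewrite ?mulr1 ?mulr0.
Qed.

Section disjoint_family.
Variables (I : finType) (D : set T) (F : I -> set T).
Hypotheses (mD : measurable D) (mF : forall i, measurable (F i)).
Hypotheses (FD : forall i, F i `<=` D) (tF : forall i j x, F i x -> F j x -> i = j).

Let U := \big[setU/set0]_(i <- index_enum I) F i.

Let mU : measurable U. Proof. by apply: bigsetU_measurable. Qed.

Let UD : U `<=` D.
Proof. by rewrite /U -bigcup_seq; apply: bigcup_sub => i _; exact: FD. Qed.

Let tFI : trivIset [set` index_enum I] F.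
Proof. by move=> i j _ _ [x [Fi Fj]]; exact: tF Fi Fj. Qed.

Let RintU h : itg D h -> \int[mu]_(x in U) h x = \sum_i \int[mu]_(x in F i) h x.
Proof.
move=> hh; have hU : itg U h by exact: itgS hh.
apply: EFin_inj; rewrite -Rint_EFin// integral_bigsetU_EFin//.
- rewrite -sumEFin; apply: eq_bigr => i _; rewrite Rint_EFin//; exact: itgS hh.
- exact: index_enum_uniq.
- exact: measurable_int hU.
Qed.

Lemma Rint_disjoint_le h : itg D h -> (forall x, D x -> 0 <= h x) ->
  \sum_i \int[mu]_(x in F i) h x <= \int[mu]_(x in D) h x.
Proof. by move=> hh h0; rewrite -RintU//; apply: Rint_subset. Qed.

(** Equality of the total measures makes the uncovered part of D null. Open cells of a grid fill a
    cube only up to their faces, and this criterion spares any description of the faces. *)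
Lemma Rint_disjoint_eq h : itg D h -> (mu D < +oo)%E -> (\sum_i mu (F i) = mu D)%E ->
  \int[mu]_(x in D) h x = \sum_i \int[mu]_(x in F i) h x.
Proof.
move=> hh Doo sF; rewrite -RintU//.
have muU : (mu U = mu D)%E.
  have := @integral_bigsetU_EFin _ _ _ mu I F (fun=> 1) (index_enum I) mF
    (index_enum_uniq I) tFI.
  rewrite /= integral_cst// mul1e => ->; last by exact: measurable_cst.
  by rewrite -sF; apply: eq_bigr => i _; rewrite integral_cst// mul1e.
have mDU : measurable (D `\` U) by exact: measurableD.
have D0 : mu (D `\` U) = 0%E.
  rewrite measureD//; rewrite (_ : D `&` U = U); last exact/setIidPr.
  by rewrite [X in (_ - X)%E](_ : _ = mu D)// subee// ge0_fin_numE.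
rewrite /Rintegral (negligible_integral mDU mD hh D0); congr (fine (integral _ _ _)).
by rewrite setDD; apply/setIidPr.
Qed.

End disjoint_family.

End real_integral.

(** * Density of Lipschitz functions in L^1 *)

Import HBSimple.

Lemma max_lipschitz (R : realType) (c a b : R) : `|Num.max c a - Num.max c b| <= `|a - b|.
Proof.
by rewrite ler_norml; have := ler_norm (a - b); have := ler_norm (b - a); rewrite distrC;
  rewrite /Num.max; do 2 case: ltP => ?; move=> ? ?; apply/andP; split; lra.
Qed.

Lemma min_lipschitz (R : realType) (c a b : R) : `|Num.min c a - Num.min c b| <= `|a - b|.
Proof.
by rewrite ler_norml; have := ler_norm (a - b); have := ler_norm (b - a); rewrite distrC;
  rewrite /Num.min; do 2 case: ltP => ?; move=> ? ?; apply/andP; split; lra.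
Qed.

Section lebesgue_density.
Context {R : realType} {d : nat}.
Local Notation mu := (leb R d).
Local Notation Rd := (caratheodory_type (borel_lebesgue R d)^*%mu).
Local Notation itg D f := (mu.-integrable D (EFin \o f)).
Implicit Types (Q A : set Rd) (f g psi : Rd -> R).

Lemma leb_measurable (A : set 'rV[R]_d) : measurable A -> measurable (A : set Rd).
Proof. exact: caratheodory_measurable_mu_ext. Qed.

Lemma measurable_coord (i : 'I_d) : measurable_fun setT (fun x : Rd => x ord0 i : R).
Proof.
move=> _ Y mY; rewrite setTI; apply: leb_measurable.
by rewrite -[X in measurable X]setTI; exact: measurable_rV_coord.
Qed.

(** Distances are taken coordinatewise, the form in which [fine_cells] bounds the diameter of a
    cell. *)
Definition bounded_lipschitz psi :=
  [/\ measurable_fun setT psi, exists M, forall x, `|psi x| <= M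
    & exists2 L, 0 <= L & forall (x y : Rd) (e : R), 0 <= e ->
        (forall i : 'I_d, `|x ord0 i - y ord0 i| <= e) -> `|psi x - psi y| <= L * e].

Lemma bounded_lipschitz_cst (k : R) : bounded_lipschitz (fun=> k).
Proof.
split; first exact: measurable_cst.
  by exists `|k|.
by exists 0 => // x y e e0 _; rewrite subrr normr0 mul0r.
Qed.

Lemma bounded_lipschitzD psi1 psi2 : bounded_lipschitz psi1 -> bounded_lipschitz psi2 ->
  bounded_lipschitz (fun x => psi1 x + psi2 x).
Proof.
move=> [m1 [M1 b1] [L1 L10 l1]] [m2 [M2 b2] [L2 L20 l2]]; split.
- exact: measurable_funD.
- by exists (M1 + M2) => x; rewrite (le_trans (ler_normD _ _))// lerD.
- exists (L1 + L2); first exact: addr_ge0.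
  move=> x y e e0 xy; rewrite mulrDl opprD addrACA (le_trans (ler_normD _ _))//.
  by rewrite lerD ?l1 ?l2.
Qed.

Lemma bounded_lipschitzM psi1 psi2 : bounded_lipschitz psi1 -> bounded_lipschitz psi2 ->
  bounded_lipschitz (fun x => psi1 x * psi2 x).
Proof.
move=> [m1 [M1 b1] [L1 L10 l1]] [m2 [M2 b2] [L2 L20 l2]].
have M10 : 0 <= M1 by apply: le_trans (b1 0).
have M20 : 0 <= M2 by apply: le_trans (b2 0).
split.
- exact: measurable_funM.
- by exists (M1 * M2) => x; rewrite normrM ler_pM.
- exists (M1 * L2 + L1 * M2); first by rewrite addr_ge0// mulr_ge0.
  move=> x y e e0 xy.
  have -> : psi1 x * psi2 x - psi1 y * psi2 y =
    psi1 x * (psi2 x - psi2 y) + (psi1 x - psi1 y) * psi2 y by ring.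
  rewrite (le_trans (ler_normD _ _))// !normrM mulrDl lerD//.
    by rewrite -mulrA ler_pM// l2.
  by rewrite -mulrA [M2 * e]mulrC mulrA ler_pM// l1.
Qed.

Variables (Q : set Rd) (mQ : measurable Q) (Qoo : (mu Q < +oo)%E).

Lemma bounded_lipschitz_itg psi : bounded_lipschitz psi -> itg Q psi.
Proof.
move=> [mpsi [M bM] _]; apply: (@itg_bounded _ _ _ _ _ _ M) => //.
exact: measurable_funS mpsi.
Qed.

Definition L1_approx f := itg Q f /\ forall e, 0 < e ->
  exists psi, bounded_lipschitz psi /\ \int[mu]_(x in Q) `|f x - psi x| <= e.

Lemma L1_approx_lim f : itg Q f ->
  (forall e, 0 < e -> exists g, L1_approx g /\ \int[mu]_(x in Q) `|f x - g x| <= e) ->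
  L1_approx f.
Proof.
move=> ff H; split => // e e0; have e20 : 0 < e / 2 by lra.
have [g [[gi ga] fg]] := H _ e20; have [psi [bpsi gpsi]] := ga _ e20.
exists psi; split => //; have psii := bounded_lipschitz_itg bpsi.
have i1 : itg Q (fun x => `|f x - g x|) by apply: itg_norm => //; exact: itgB.
have i2 : itg Q (fun x => `|g x - psi x|) by apply: itg_norm => //; exact: itgB.
rewrite [leRHS]splitr.
rewrite (le_trans _ (lerD fg gpsi))// -RintegralD//.
apply: Rint_mono => //; first by apply: itg_norm => //; exact: itgB.
- exact: itgD.
- by move=> x Qx; have := ler_normD (f x - g x) (g x - psi x); congr (`|_| <= _); ring.
Qed.

Lemma L1_approxD f g : L1_approx f -> L1_approx g -> L1_approx (fun x => f x + g x).
Proof.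
move=> [fi fa] [gi ga]; split; first exact: itgD.
move=> e e0; have e20 : 0 < e / 2 by lra.
have [p1 [b1 h1]] := fa _ e20; have [p2 [b2 h2]] := ga _ e20.
have p1i := bounded_lipschitz_itg b1; have p2i := bounded_lipschitz_itg b2.
exists (fun x => p1 x + p2 x); split; first exact: bounded_lipschitzD.
rewrite [leRHS]splitr.
have i1 : itg Q (fun x => `|f x - p1 x|) by apply: itg_norm => //; exact: itgB.
have i2 : itg Q (fun x => `|g x - p2 x|) by apply: itg_norm => //; exact: itgB.
rewrite (le_trans _ (lerD h1 h2))// -RintegralD//.
apply: Rint_mono => //.
- by apply: itg_norm => //; apply: itgB => //; exact: itgD.
- exact: itgD.
- by move=> x Qx; rewrite opprD addrACA ler_normD.
Qed.

Lemma L1_approxZ f (k : R) : L1_approx f -> L1_approx (fun x => k * f x).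
Proof.
move=> [fi fa]; split; first exact: itgZ.
move=> e e0; have k0 : 0 < `|k| + 1 by rewrite ltr_wpDl.
have [p [b h]] := fa (e / (`|k| + 1)) (divr_gt0 e0 k0).
exists (fun x => k * p x); split.
  by apply: bounded_lipschitzM => //; exact: bounded_lipschitz_cst.
have pi := bounded_lipschitz_itg b.
have ip : itg Q (fun x => `|f x - p x|) by apply: itg_norm => //; exact: itgB.
under eq_Rintegral do rewrite -mulrBr normrM.
rewrite RintegralZl//; rewrite ler_pdivlMr// in h; rewrite (le_trans _ h)// mulrC.
by rewrite ler_wpM2l ?Rintegral_ge0// lerDl.
Qed.

Lemma L1_approx_sum (I : Type) (s : seq I) (F : I -> Rd -> R) :
  (forall i, L1_approx (F i)) -> L1_approx (fun x => \sum_(i <- s) F i x).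
Proof.
move=> FI; elim: s => [|i s IH].
  rewrite (_ : (fun _ => _) = fun=> 0); last by apply/funext => x; rewrite big_nil.
  split; first exact: itg_cst.
  move=> e e0; exists (fun=> 0); split; first exact: bounded_lipschitz_cst.
  by under eq_Rintegral do rewrite subrr normr0; rewrite Rintegral_cst// mul0r ltW.
rewrite (_ : (fun _ => _) = fun x => F i x + \sum_(i <- s) F i x).
  exact: L1_approxD.
by apply/funext => x; rewrite big_cons.
Qed.

(** The range [0, 1] of psi makes the errors of two approximations add up under products, hence
    under intersections. *)
Definition approx_set A := measurable A /\ forall e, 0 < e ->
  exists psi, [/\ bounded_lipschitz psi, (forall x, 0 <= psi x <= 1)
     & \int[mu]_(x in Q) `|\1_A x - psi x| <= e].

Let itg_indic1 A : measurable A -> itg Q (\1_A : Rd -> R).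
Proof.
move=> mA; apply: (@itg_bounded _ _ _ _ _ _ 1) => //.
by move=> x _; rewrite indicE; case: (_ \in _); rewrite ?normr1 ?normr0//.
Qed.

Lemma L1_approx_indic A : approx_set A -> L1_approx (\1_A).
Proof.
move=> [mA H]; split; first exact: itg_indic1.
by move=> e /H[psi [? ? ?]]; exists psi.
Qed.

Lemma approx_set_lim A (F : (set Rd)^nat) : (forall n, approx_set (F n)) -> measurable A ->
  (forall x, Q x -> \forall n \near \oo, \1_(F n) x = \1_A x :> R) -> approx_set A.
Proof.
move=> aF mA FA; split => // e e0.
have mF n : measurable (F n) by case: (aF n).
have := @dominated_convergence _ _ _ mu Q mQ
  (fun n x => (\1_(F n) x)%:E) (fun x => (\1_A x)%:E) (fun=> 1%E).
case.
- by move=> n; apply/measurable_EFinP/measurable_indic.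
- by apply/measurable_EFinP/measurable_indic.
- apply: aeW => x Qx; apply: cvg_near_cst; near=> n; congr EFin.
  by near: n; exact: FA.
- exact: itg_cst.
- apply: aeW => x n _; rewrite /= lee_fin indicE.
  by case: (_ \in _); rewrite ?normr1 ?normr0//.
move=> _ c _.
have e20 : 0 < e / 2 by lra.
have /fine_cvgP[_ /cvgrPdist_le/(_ _ e20)[N _ /(_ N)/=]] := c.
rewrite leqnn => /(_ isT); rewrite sub0r normrN => hN.
have [psi [bpsi p01 hp]] := (aF N).2 _ e20; exists psi; split => //.
have psii := bounded_lipschitz_itg bpsi.
have i1 : itg Q (fun x => `|\1_(F N) x - \1_A x|).
  by apply: itg_norm => //; apply: itgB => //; exact: itg_indic1.
have i2 : itg Q (fun x => `|\1_(F N) x - psi x|).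
  by apply: itg_norm => //; apply: itgB => //; exact: itg_indic1.
have h1 : \int[mu]_(x in Q) `|\1_(F N) x - \1_A x| <= e / 2.
  by apply: le_trans hN; rewrite ler_norm.
rewrite [leRHS]splitr.
rewrite (le_trans _ (lerD h1 hp))// -RintegralD//.
apply: Rint_mono => //.
- by apply: itg_norm => //; apply: itgB => //; exact: itg_indic1.
- exact: itgD.
- move=> x Qx; rewrite (distrC (\1_(F N) x)).
  by have := ler_normD (\1_A x - \1_(F N) x) (\1_(F N) x - psi x); congr (`|_| <= _); ring.
Unshelve. all: by end_near. Qed.

Lemma approx_setC A : approx_set A -> approx_set (~` A).
Proof.
move=> [mA H]; split; first exact: measurableC.
move=> e /H[psi [b p01 h]]; exists (fun x => 1 + (-1) * psi x); split.
- apply: bounded_lipschitzD; first exact: bounded_lipschitz_cst.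
  by apply: bounded_lipschitzM => //; exact: bounded_lipschitz_cst.
- by move=> x; have := p01 x; lra.
- rewrite (le_trans _ h)// le_eqVlt; apply/orP; left; apply/eqP; apply: eq_Rintegral => x _.
  rewrite -normrN; congr `|_|; rewrite !indicE in_setC.
  by case: (_ \in _) => /=; ring.
Qed.

Lemma approx_setI A B : approx_set A -> approx_set B -> approx_set (A `&` B).
Proof.
move=> [mA HA] [mB HB]; split; first exact: measurableI.
move=> e e0; have e20 : 0 < e / 2 by lra.
have [p [b1 p01 h1]] := HA _ e20; have [q [b2 q01 h2]] := HB _ e20.
have p1i := bounded_lipschitz_itg b1; have p2i := bounded_lipschitz_itg b2.
have b12 : bounded_lipschitz (fun x => p x * q x) by exact: bounded_lipschitzM.
exists (fun x => p x * q x); split => //.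
  by move=> x; have := p01 x; have := q01 x; nra.
rewrite [leRHS]splitr.
have i1 : itg Q (fun x => `|\1_A x - p x|).
  by apply: itg_norm => //; apply: itgB => //; exact: itg_indic1.
have i2 : itg Q (fun x => `|\1_B x - q x|).
  by apply: itg_norm => //; apply: itgB => //; exact: itg_indic1.
rewrite (le_trans _ (lerD h1 h2))// -RintegralD//.
apply: Rint_mono => //.
- apply: itg_norm => //; apply: itgB => //; last exact: bounded_lipschitz_itg.
  by apply: itg_indic1; exact: measurableI.
- exact: itgD.
- move=> x Qx; rewrite indicI/=.
  have -> : \1_A x * \1_B x - p x * q x =
    (\1_A x - p x) * \1_B x + p x * (\1_B x - q x) by ring.
  rewrite (le_trans (ler_normD _ _))// !normrM lerD//.
    rewrite ler_piMr// indicE; by case: (_ \in _); rewrite ?normr1 ?normr0//.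
  rewrite ler_piMl//; have := p01 x => /andP[p0 p1]; by rewrite ger0_norm.
Qed.

(** A countable union is the pointwise limit of its finite partial unions, so dominated convergence
    on Q, which has finite measure, gives closure under countable unions. *)
Lemma approx_set_sigma_algebra : sigma_algebra setT approx_set.
Proof.
have a0 : approx_set set0.
  split; first exact: measurable0.
  move=> e e0; exists (fun=> 0); split; first exact: bounded_lipschitz_cst.
    by move=> x; rewrite lexx ler01.
  under eq_Rintegral do rewrite indicE in_set0 subr0 normr0.
  by rewrite Rintegral_cst// mul0r ltW.
split => //.
  by move=> A aA; rewrite setTD; exact: approx_setC.
move=> F aF; pose G n := \big[setU/set0]_(k < n) F k.
apply: (@approx_set_lim _ G).
- move=> n; rewrite /G; elim/big_ind : _ => // A B aA aB.
  by rewrite -(setCK (A `|` B)) setCU; apply: approx_setC; apply: approx_setI;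
    exact: approx_setC.
- by apply: bigcupT_measurable => n; case: (aF n).
move=> x Qx; have [[n _ Fn]|nF] := pselect ((\bigcup_k F k) x).
  exists n.+1 => // m /= nm; rewrite !indicE; congr ((nat_of_bool _)%:R).
  rewrite (mem_set (_ : (\bigcup_k F k) x)); last by exists n.
  by apply/mem_set; rewrite /G -bigcup_mkord; exists n.
apply: nearW => n; rewrite !indicE; congr ((nat_of_bool _)%:R).
rewrite (memNset nF); apply: memNset; rewrite /G -bigcup_mkord => -[k _ Fk].
by apply: nF; exists k.
Qed.

Lemma approx_set_halfspace (i : 'I_d) (c : R) :
  approx_set [set x : Rd | c < x ord0 i].
Proof.
have mH : measurable [set x : Rd | c < x ord0 i].
  rewrite (_ : [set x | _] = (fun x : Rd => x ord0 i : R) @^-1` `]c, +oo[).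
    by rewrite -[X in measurable X]setTI; exact: measurable_coord.
  by apply/seteqP; split => x /=; rewrite in_itv/= andbT.
pose psi n (x : Rd) : R := Num.min 1 (n%:R * Num.max 0 (x ord0 i - c)).
have psi0 n x : 0 <= psi n x by rewrite le_min ler01/= mulr_ge0// le_max lexx.
have psi1 n x : psi n x <= 1 by rewrite ge_min lexx.
have bpsi n : bounded_lipschitz (psi n).
  split.
  - apply: (@measurable_minr _ _ _ _ (fun=> 1)); first exact: measurable_cst.
    apply: measurable_funM; first exact: measurable_cst.
    apply: (@measurable_maxr _ _ _ _ (fun=> 0)); first exact: measurable_cst.
    by apply: measurable_funB; [exact: measurable_coord|exact: measurable_cst].
  - by exists 1 => x; rewrite ger0_norm.
  - exists n%:R => // x y e e0 /(_ i) xy; rewrite (le_trans (min_lipschitz _ _ _))//.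
    rewrite -mulrBr normrM ger0_norm// ler_wpM2l// (le_trans (max_lipschitz _ _ _))//.
    by apply: le_trans xy; rewrite opprB addrA subrK.
split => // e e0.
have := @dominated_convergence _ _ _ mu Q mQ
  (fun n x => (psi n x)%:E) (fun x => (\1_[set x : Rd | c < x ord0 i] x)%:E) (fun=> 1%E).
case.
- by move=> n; apply/measurable_EFinP; case: (bpsi n) => m _ _; exact: measurable_funS m.
- by apply/measurable_EFinP/measurable_indic.
- apply: aeW => x Qx; apply: cvg_near_cst; have [cx|xc] := ltP c (x ord0 i).
    have xc0 : 0 < x ord0 i - c by rewrite subr_gt0.
    near=> n; congr EFin; rewrite indicE mem_set//= /psi max_r ?ltW//.
    apply: min_l; rewrite -ler_pdivrMr// mul1r.
    near: n; exact: nbhs_infty_ger.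
  apply: nearW => n; congr EFin; rewrite indicE memNset/=; last by apply/negP; rewrite -leNgt.
  by rewrite /psi max_l ?subr_le0// mulr0 min_r.
- exact: itg_cst.
- by apply: aeW => x n _; rewrite /= lee_fin ger0_norm.
move=> _ + _ => /fine_cvgP[_ /cvgrPdist_le/(_ _ e0)[N _ /(_ N)/=]].
rewrite leqnn => /(_ isT); rewrite sub0r normrN => hN.
exists (psi N); split => //; first by move=> x; rewrite psi0 psi1.
apply: le_trans hN; rewrite (le_trans (ler_norm _))//.
rewrite le_eqVlt; apply/orP; left; apply/eqP; rewrite ger0_norm; last first.
  exact: Rintegral_ge0.
by rewrite ger0_norm; [apply: eq_Rintegral => x _; rewrite distrC|exact: Rintegral_ge0].
Unshelve. all: by end_near. Qed.

Lemma approx_set_borel (A : set 'rV[R]_d) : measurable A -> approx_set A.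
Proof.
have [S0 SC SU] := approx_set_sigma_algebra.
apply: smallest_sub; first exact: approx_set_sigma_algebra.
rewrite -bigcup_seq; apply: bigcup_sub => i _ _ [Y mY <-]; rewrite setTI.
have {mY} : (RGenOInfty.G (R:=R)).-sigma.-measurable Y.
  by rewrite -RGenOInfty.measurableE.
move: Y.
apply: smallest_sub.
  split.
  - by rewrite preimage_set0.
  - by move=> Y aY; rewrite setTD preimage_setC -setTD; exact: SC.
  - by move=> F aF; rewrite preimage_bigcup; exact: SU.
move=> _ [c ->]; have := approx_set_halfspace i c; congr approx_set.
by apply/seteqP; split => x /=; rewrite in_itv/= andbT.
Qed.

(** Lebesgue measure is an infimum over Borel covers: A lies in a Borel set U with mu(U) <= mu(A) +
    e/2, and U is approximable. *)
Lemma approx_set_leb (A : set Rd) : measurable A -> A `<=` Q -> approx_set A.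
Proof.
move=> mA AQ; split => // e e0; have e20 : 0 < e / 2 by lra.
have Aoo : (mu A < +oo)%E by apply: le_lt_trans Qoo; apply: le_measure => //; rewrite inE.
have Afin : mu A \is a fin_num by rewrite ge0_fin_numE.
have [_ [F [mF AF] <-]] := lb_ereal_inf_adherent e20 Afin.
rewrite -/(mu A) => muF.
have mF' k : measurable (F k : set Rd) by exact: leb_measurable.
pose U : set Rd := \bigcup_k F k.
have mU : measurable U by exact: bigcupT_measurable.
have muU : (mu U <= mu A + (e / 2)%:E)%E.
  apply: le_trans (ltW muF); apply: le_trans (outer_measure_sigma_subadditive _ F) _.
  by apply: lee_nneseries => // k _; have /= <- := measurable_mu_extE (borel_lebesgue R d) (mF k).
have [_ HU] : approx_set U by apply: approx_set_borel; exact: bigcupT_measurable.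
have [psi [b p01 h]] := HU _ e20; exists psi; split => //.
have psii := bounded_lipschitz_itg b.
have i1 : itg Q (fun x => `|\1_U x - psi x|).
  by apply: itg_norm => //; apply: itgB => //; exact: itg_indic1.
have h2 : \int[mu]_(x in Q) `|\1_A x - \1_U x| <= e / 2.
  rewrite -lee_fin -Rint_EFin//; last first.
    by apply: itg_norm => //; apply: itgB => //; exact: itg_indic1.
  rewrite (eq_integral (fun x => (\1_(U `\` A) x)%:E)).
    rewrite integral_indic//; last exact: measurableD.
    apply: (@le_trans _ _ (mu (U `\` A))).
      by apply: le_measure; rewrite ?inE//; [apply: measurableI => //|]; exact: measurableD.
    rewrite measureD//; last first.
      by apply: le_lt_trans muU _; rewrite -ge0_fin_numE ?adde_ge0// ?lee_fin ?ltW// fin_numD Afin.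
    rewrite (_ : U `&` A = A); last exact/setIidPr.
    by rewrite lee_subel_addl// addeC.
  move=> x _; congr EFin; rewrite !indicE in_setD.
  have [xA|xA] := boolP (x \in A); last by rewrite andbT sub0r normrN ger0_norm.
  by rewrite andbF (mem_set (AF _ (set_mem xA))) subrr normr0.
rewrite [leRHS]splitr.
rewrite (le_trans _ (lerD h2 h))// -RintegralD//; last first.
  by apply: itg_norm => //; apply: itgB => //; exact: itg_indic1.
apply: Rint_mono => //.
- by apply: itg_norm => //; apply: itgB => //; exact: itg_indic1.
- apply: itgD => //; by apply: itg_norm => //; apply: itgB => //; exact: itg_indic1.
- by move=> x Qx; have := ler_normD (\1_A x - \1_U x) (\1_U x - psi x); congr (`|_| <= _); ring.
Qed.

Lemma bounded_lipschitz_dense f : itg Q f -> L1_approx f.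
Proof.
move=> ff; have [g [gi _ gf]] := approximation_sfun_integrable mQ ff.
apply: L1_approx_lim => // e e0.
move: gf => /fine_cvgP[_ /cvgrPdist_le/(_ _ e0)[N _ /(_ N)/=]].
rewrite leqnn => /(_ isT); rewrite sub0r normrN => hN.
have hN' : \int[mu]_(x in Q) `|f x - g N x| <= e by apply: le_trans hN; rewrite ler_norm.
(* Cutting off by Q puts the level sets inside Q, as [approx_set_leb] requires. *)
exists (fun x => g N x * \1_Q x); split; last first.
  apply: le_trans hN'; rewrite le_eqVlt; apply/orP; left; apply/eqP.
  by apply: eq_Rintegral => x xQ; rewrite indicE xQ mulr1.
rewrite (_ : (fun _ => _) = (fun x => \sum_(y <- finmap.enum_fset (fset_set (range (g N))))
    y * \1_(g N @^-1` [set y] `&` Q) x)).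
  apply: L1_approx_sum => y; apply: L1_approxZ; apply: L1_approx_indic; apply: approx_set_leb.
    by apply: measurableI => //; exact: measurable_funPTI.
  by move=> x [].
apply/funext => x; rewrite fimfunE fsbig_finite//= mulr_suml.
by apply: eq_bigr => y _; rewrite -mulrA indicI.
Qed.

End lebesgue_density.

(** * Averages over fine partitions *)

Section cells.
Context {R : realType} {d : nat}.
Local Notation mu := (leb R d).
Local Notation Rd := (caratheodory_type (borel_lebesgue R d)^*%mu).
Local Notation itg D f := (mu.-integrable D (EFin \o f)).
Variables (Q : set Rd) (mQ : measurable Q) (Qoo : (mu Q < +oo)%E).

(* [D i] is a neighbourhood of the cell [C i]; the sets [D i] may overlap, but
   with multiplicity at most 2. *)
Definition fine_cells (e : R) (I : finType) (C D : I -> set Rd) :=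
  [/\ forall i, [/\ measurable (C i), measurable (D i), C i `<=` D i & D i `<=` Q],
      forall i, 0 < fine (mu (C i)) /\ fine (mu (D i)) <= 2 * fine (mu (C i)),
      forall i (x y : Rd), D i x -> D i y -> forall k : 'I_d, `|x ord0 k - y ord0 k| <= e
    & forall h : Rd -> R, itg Q h -> (forall x, 0 <= h x) ->
        \sum_i \int[mu]_(x in D i) h x <= 2 * \int[mu]_(x in Q) h x].

Lemma avg_dist (C : set Rd) (f : Rd -> R) (c : R) : measurable C -> (mu C < +oo)%E ->
  0 < fine (mu C) -> itg C f ->
  `|c - avg C f| <= (fine (mu C))^-1 * \int[mu]_(x in C) `|c - f x|.
Proof.
move=> mC Coo C0 ff; have -> : c - avg C f = (fine (mu C))^-1 * \int[mu]_(x in C) (c - f x).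
  rewrite RintegralB//; last exact: itg_cst.
  by rewrite Rintegral_cst// mulrBr mulrCA mulVf ?mulr1// gt_eqF.
have Ci0 : 0 <= (fine (mu C))^-1 by rewrite invr_ge0 ltW.
rewrite normrM (ger0_norm Ci0) ler_wpM2l//.
by apply: le_normr_Rintegral => //; apply: itgB => //; exact: itg_cst.
Qed.

(** A Lipschitz function psi close to f varies by at most L e on D i, and averaging over the smaller
    set C i costs the factor mu(D i) / mu(C i) <= 2. The errors of the cells are then summed with
    multiplicity 2. *)
Lemma fine_cells_L1 (f : Rd -> R) (eta : R) : itg Q f -> 0 < eta ->
  exists2 e, 0 < e & forall I C D, @fine_cells e I C D ->
    \sum_i \int[mu]_(x in D i) `|f x - avg (C i) f| <= eta.
Proof.
(* The distance of f to psi enters three times per cell and is doubled by the overlap; 6 * eta / 12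
   is half of eta. *)
move=> ff eta0; have e12 : 0 < eta / 12 by lra.
have [_ /(_ _ e12)[psi [bpsi hpsi]]] := bounded_lipschitz_dense mQ Qoo ff.
have psii := bounded_lipschitz_itg mQ Qoo bpsi.
have [_ _ [L L0 lpsi]] := bpsi.
have mQ0 : 0 <= fine (mu Q) by exact: fine_ge0.
have e_gt0 : 0 < eta / (4 * (L + 1) * (fine (mu Q) + 1)).
  by rewrite divr_gt0// !mulr_gt0// ltr_wpDl.
(* Chosen so that L e * 2 mu(Q) <= eta / 2; the summands 1 keep the denominator positive. *)
exists (eta / (4 * (L + 1) * (fine (mu Q) + 1))) => //.
move: e_gt0; set e := eta / _ => e_gt0 I C D [CD muCD diam sumD].
have e0 : 0 <= e by exact: ltW.
have id : itg Q (fun x => `|f x - psi x|) by apply: itg_norm => //; exact: itgB.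
have main i : \int[mu]_(x in D i) `|f x - avg (C i) f| <=
    3 * \int[mu]_(x in D i) `|f x - psi x| + L * e * \int[mu]_(x in D i) 1.
  have [mC mD CDi DQ] := CD i; have [C0 CD2] := muCD i.
  have CQ : C i `<=` Q by exact: subset_trans DQ.
  have Doo : (mu (D i) < +oo)%E by apply: le_lt_trans Qoo; apply: le_measure; rewrite ?inE.
  have Coo : (mu (C i) < +oo)%E by apply: le_lt_trans Qoo; apply: le_measure; rewrite ?inE.
  have fD : itg (D i) f by exact: itgS ff.
  have pD : itg (D i) psi by exact: itgS psii.
  have fC : itg (C i) f by exact: itgS ff.
  have pC : itg (C i) psi by exact: itgS psii.
  have iD : itg (D i) (fun x => `|f x - psi x|) by exact: itgS id.
  have iC : itg (C i) (fun x => `|f x - psi x|) by exact: itgS id.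
  set c := avg (C i) f; set J := \int[mu]_(x in C i) `|f x - psi x|.
  have J0 : 0 <= J by exact: Rintegral_ge0.
  pose K := L * e + (fine (mu (C i)))^-1 * J.
  have ptw x : D i x -> `|f x - c| <= `|f x - psi x| + K.
    move=> Dx; have -> : f x - c = (f x - psi x) + (psi x - c) by ring.
    rewrite (le_trans (ler_normD _ _))// lerD2l (le_trans (avg_dist _ mC Coo C0 fC))//.
    have -> : K = (fine (mu (C i)))^-1 * (L * e * fine (mu (C i)) + J).
      by rewrite /K; field; rewrite gt_eqF.
    have Ci0 : 0 <= (fine (mu (C i)))^-1 by rewrite invr_ge0 ltW.
    rewrite ler_wpM2l//.
    rewrite -(Rintegral_cst _ mC) -RintegralD//; last exact: itg_cst.
    apply: Rint_mono => //.
    - by apply: itg_norm => //; apply: itgB => //; exact: itg_cst.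
    - by apply: itgD => //; exact: itg_cst.
    - move=> y Cy; have -> : psi x - f y = (psi x - psi y) - (f y - psi y) by ring.
      rewrite (le_trans (ler_normB _ _))// lerD2r lpsi// => k.
      by apply: (diam i) => //; exact: CDi.
  apply: (@le_trans _ _ (\int[mu]_(x in D i) (`|f x - psi x| + K))).
    apply: Rint_mono => //.
    - by apply: itg_norm => //; apply: itgB => //; exact: itg_cst.
    - by apply: itgD => //; exact: itg_cst.
  rewrite RintegralD//; last exact: itg_cst.
  rewrite !Rintegral_cst// mul1r /K mulrDl.
  have JD : J <= \int[mu]_(x in D i) `|f x - psi x| by apply: Rint_subset.
  have h : (fine (mu (C i)))^-1 * J * fine (mu (D i)) <= 2 * J.
    rewrite mulrAC ler_wpM2r// mulrC ler_pdivrMr//.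
  have : 2 * J <= 2 * \int[mu]_(x in D i) `|f x - psi x| by rewrite ler_pM2l.
  by move: h; clear; lra.
apply: (le_trans (ler_sum _ (fun i _ => main i))).
rewrite big_split/= -!mulr_sumr.
have h1 := sumD _ id (fun x => normr_ge0 _).
have h2 := sumD _ (itg_cst 1 mQ Qoo) (fun x => ler01).
have h3 : L * e * (2 * fine (mu Q)) <= eta / 2.
  rewrite /e mulrA mulrA; set q := fine (mu Q) in mQ0 *.
  have -> : L * eta / (4 * (L + 1) * (q + 1)) * 2 * q = eta / 2 * (L / (L + 1)) * (q / (q + 1)).
    by field; rewrite !gt_eqF// ltr_wpDl.
  have a1 : L / (L + 1) <= 1 by rewrite ler_pdivrMr ?mul1r ?lerDl ?ltr_wpDl.
  have a2 : q / (q + 1) <= 1 by rewrite ler_pdivrMr ?mul1r ?lerDl ?ltr_wpDl.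
  have a3 : 0 <= L / (L + 1) by rewrite divr_ge0// addr_ge0.
  have a4 : 0 <= q / (q + 1) by rewrite divr_ge0// addr_ge0.
  rewrite -mulrA ler_piMr//; first by rewrite divr_ge0// ltW.
  by rewrite mulr_ile1.
have h2' : L * e * \sum_i \int[mu]_(x in D i) 1 <= eta / 2.
  apply: le_trans h3; apply: ler_wpM2l; first exact: mulr_ge0.
  by apply: (le_trans h2); rewrite Rintegral_cst// mul1r.
have : 3 * \sum_i \int[mu]_(x in D i) `|f x - psi x| <= 3 * (2 * (eta / 12)).
  by rewrite ler_pM2l// (le_trans h1)// ler_pM2l.
by move: h2'; clear; lra.
Qed.

Lemma tail_truncation (h : Rd -> R) (tau : R) : itg Q h -> 0 < tau ->
  exists n : nat, \int[mu]_(x in Q) Num.max 0 (`|h x| - n%:R) <= tau.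
Proof.
move=> hi tau0; have hn := itg_norm mQ hi.
have mF n : measurable_fun Q (fun x => Num.max 0 (`|h x| - n%:R)).
  apply: (@measurable_maxr _ _ _ _ (fun=> 0)); first exact: measurable_cst.
  by apply: measurable_funB; [exact: itg_mfun hn|exact: measurable_cst].
have := @dominated_convergence _ _ _ mu Q mQ
  (fun n x => (Num.max 0 (`|h x| - n%:R))%:E) (cst 0%E) (EFin \o (fun x => `|h x|)).
case.
- by move=> n; exact/measurable_EFinP.
- exact: measurable_cst.
- apply: aeW => x Qx; apply: cvg_near_cst; near=> n; congr EFin.
  apply: max_l; rewrite subr_le0; near: n; exact: nbhs_infty_ger.
- exact: hn.
- apply: aeW => x n Qx; rewrite /= lee_fin ger0_norm ?le_max ?lexx// ge_max normr_ge0/=.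
  by rewrite lerBlDr lerDl.
move=> _ _; rewrite integral0 => /fine_cvgP[_ /cvgrPdist_le/(_ _ tau0)[N _ /(_ N)/=]].
rewrite leqnn => /(_ isT); rewrite sub0r normrN => hN; exists N.
by apply: le_trans hN; rewrite ler_norm.
Unshelve. all: by end_near. Qed.

(** Chebyshev's inequality needs a bounded h, so |h| is bounded by n plus its tail above n: the tail
    has small integral, and n times the indicator is at most n / eta times the deviation from the
    cell average. *)
Lemma fine_cells_exceptional (f h : Rd -> R) (eta tau : R) : itg Q f -> itg Q h ->
  0 < eta -> 0 < tau ->
  exists2 e, 0 < e & forall I C D, @fine_cells e I C D ->
    \sum_i \int[mu]_(x in D i) (`|h x| * ((eta < `|f x - avg (C i) f|)%R : bool)%:R) <= tau.
Proof.
move=> fi hi eta0 tau0; have tau4 : 0 < tau / 4 by lra.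
(* The overlap doubles the tail, hence tau / 4; the other half of tau is for the deviation after
   multiplication by n / eta. *)
have [n hn] := tail_truncation hi tau4.
have n1 : 0 < n%:R + 1 :> R by rewrite ltr_wpDl.
have eta'0 : 0 < tau / 2 * eta / (n%:R + 1) by rewrite divr_gt0// !mulr_gt0//; lra.
have [e e0 He] := fine_cells_L1 fi eta'0.
exists e => // I C D CDe; have := He _ _ _ CDe; have [CD muCD _ sumD] := CDe => hf.
have ti : itg Q (fun x => Num.max 0 (`|h x| - n%:R)).
  apply: (@itg_le _ _ _ _ _ _ (fun x => `|h x|) mQ); last exact: itg_norm.
    apply: (@measurable_maxr _ _ _ _ (fun=> 0)); first exact: measurable_cst.
    by apply: measurable_funB; [exact: itg_mfun (itg_norm mQ hi)|exact: measurable_cst].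
  move=> x Qx; rewrite ger0_norm ?le_max ?lexx// ge_max normr_ge0/=.
  by rewrite lerBlDr lerDl.
apply: (@le_trans _ _ (\sum_i (\int[mu]_(x in D i) Num.max 0 (`|h x| - n%:R) +
    n%:R / eta * \int[mu]_(x in D i) `|f x - avg (C i) f|))).
  apply: ler_sum => i _; have [mC mD CDi DQ] := CD i.
  have Doo : (mu (D i) < +oo)%E by apply: le_lt_trans Qoo; apply: le_measure; rewrite ?inE.
  have fD : itg (D i) (fun x => `|f x - avg (C i) f|).
    by apply: itg_norm => //; apply: itgB; [|exact: itgS fi|exact: itg_cst].
  have hD : itg (D i) (fun x => `|h x|) by apply: itg_norm => //; exact: itgS hi.
  have tD : itg (D i) (fun x => Num.max 0 (`|h x| - n%:R)) by exact: itgS ti.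
  rewrite -RintegralZl// -RintegralD//; last exact: itgZ.
  apply: Rint_mono => //.
  - by apply: (itg_bool mD hD); apply: measurable_fun_ltr; [exact: measurable_cst|exact: itg_mfun fD].
  - by apply: itgD => //; exact: itgZ.
  - move=> x Dx; have M0 : 0 <= Num.max 0 (`|h x| - n%:R) by rewrite le_max lexx.
    have M1 : `|h x| - n%:R <= Num.max 0 (`|h x| - n%:R) by rewrite le_max lexx orbT.
    case: ltP => [lt_eta|_]; rewrite ?mulr1 ?mulr0; last first.
      by rewrite addr_ge0// mulr_ge0// divr_ge0// ltW.
    have : n%:R <= n%:R / eta * `|f x - avg (C i) f|.
      by rewrite mulrAC ler_pdivlMr// ler_wpM2l// ltW.
    by move: M1; clear; lra.
rewrite big_split/= -mulr_sumr.
have h1 := sumD _ ti (fun x => _).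
have {}h1 := h1 (fun x => ltac:(by rewrite le_max lexx)).
have h2 : n%:R / eta * \sum_i \int[mu]_(x in D i) `|f x - avg (C i) f| <=
    n%:R / eta * (tau / 2 * eta / (n%:R + 1)).
  by rewrite ler_wpM2l// divr_ge0// ltW.
have h3 : n%:R / eta * (tau / 2 * eta / (n%:R + 1)) <= tau / 2.
  have -> : n%:R / eta * (tau / 2 * eta / (n%:R + 1)) = tau / 2 * (n%:R / (n%:R + 1)).
    by field; rewrite !gt_eqF.
  have t20 : 0 <= tau / 2 by rewrite divr_ge0// ltW.
  by rewrite ler_piMr// ler_pdivrMr// mul1r lerDl.
by move: h1 h2 h3 hn; clear; lra.
Qed.

End cells.

(** * Smooth bump functions *)

Section smooth_real.
Context {R : realType}.
Implicit Types (f g : R -> R) (n : nat).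

(** Derivatives are existential witnesses rather than iterated derivatives, so that closure under
    sums, products and affine substitutions is a plain induction on the order. *)
Fixpoint ntimes_derivable n f : Prop :=
  if n is m.+1 then exists2 g, (forall x : R, is_derive x (1 : R) f (g x)) & ntimes_derivable m g
  else True.

Definition smooth1 f := forall n, ntimes_derivable n f.

Lemma ntimes_derivableW n f : ntimes_derivable n.+1 f -> ntimes_derivable n f.
Proof. by elim: n f => // n IH f [g fg] /IH gn; exists g. Qed.

Lemma ntimes_derivableD n f g : ntimes_derivable n f -> ntimes_derivable n g ->
  ntimes_derivable n (fun x => f x + g x).
Proof.
elim: n f g => // n IH f g [f' ff' nf] [g' gg' ng].
by exists (fun x => f' x + g' x); [move=> x; exact: is_deriveD|exact: IH].
Qed.

Lemma ntimes_derivableM n f g : ntimes_derivable n f -> ntimes_derivable n g ->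
  ntimes_derivable n (fun x => f x * g x).
Proof.
elim: n f g => // n IH f g fn gn.
have [f' ff' nf] := fn; have [g' gg' ng] := gn.
exists (fun x => f x * g' x + g x * f' x); first by move=> x; exact: is_deriveM.
by apply: ntimes_derivableD; apply: IH => //; exact: ntimes_derivableW.
Qed.

Lemma ntimes_derivable_cst n (k : R) : ntimes_derivable n (fun=> k).
Proof.
elim: n k => // n IH k; exists (fun=> 0); last exact: IH.
by move=> x; exact: is_derive_cst.
Qed.

Lemma is_derive_affine f (c b x df : R) : is_derive (c * x + b) (1 : R) f df ->
  is_derive x (1 : R) (fun y => f (c * y + b)) (df * c).
Proof.
move=> fd; have h : is_derive x (1 : R) (fun y => c * y + b) c.
  have := is_deriveD (is_deriveZ c (is_derive_id x (1 : R))) (is_derive_cst b x (1 : R)).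
  by rewrite addr0 /GRing.scale/= mulr1.
exact: (@is_derive1_comp _ f (fun y => c * y + b)).
Qed.

Lemma ntimes_derivable_affine n f (c b : R) : ntimes_derivable n f ->
  ntimes_derivable n (fun x => f (c * x + b)).
Proof.
elim: n f => // n IH f [f' ff' nf]; exists (fun x => f' (c * x + b) * c).
  by move=> x; exact: is_derive_affine.
by apply: ntimes_derivableM; [exact: IH|exact: ntimes_derivable_cst].
Qed.

(** The difference quotient is O(|h|). This settles the derivative of [flat_poly] at the gluing
    point 0. *)
Lemma is_derive_quadratic_bound f (x M : R) :
  (forall h, `|h| <= 1 -> `|f (h + x) - f x| <= M * `|h| ^+ 2) -> is_derive x (1 : R) f 0.
Proof.
move=> fM.
have M0 : 0 <= M by have := fM 1; rewrite normr1 expr1n mulr1 => /(_ (lexx _)); exact: le_trans.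
have c : (fun h => h^-1 *: (f (h *: 1 + x) - f x)) @ (0 : R)^' --> (0 : R).
  apply/cvgrPdist_le => e e0; near=> h.
  have h0 : h != 0 by near: h; exact: nbhs_dnbhs_neq.
  have h1 : `|h| <= 1.
    near: h; apply: dnbhs0_le; exact: ltr01.
  have h2 : `|h| <= e / (M + 1).
    near: h; apply: dnbhs0_le; by rewrite divr_gt0// ltr_wpDl.
  rewrite sub0r normrN /GRing.scale/= mulr1 normrM normfV.
  have hp : 0 < `|h| by rewrite normr_gt0.
  rewrite mulrC ler_pdivrMr// (le_trans (fM _ h1))// expr2 mulrA ler_pM2r//.
  rewrite ler_pdivlMr ?ltr_wpDl// in h2.
  apply: le_trans h2; rewrite mulrC ler_wpM2l// lerDl//.
by split; [apply/cvg_ex; exists 0|exact: cvg_lim].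
Unshelve. all: by end_near. Qed.

(** The functions p(1/x) e^(-1/x), extended by 0, are closed under differentiation: with t = 1/x,
    the derivative replaces p(t) by t^2 (p - p')(t). For p = 1 this is the classical flat
    function. *)
Definition flat_poly (p : {poly R}) (x : R) : R :=
  if 0 < x then p.[x^-1] * expR (- x^-1) else 0.

Lemma poly_bound (p : {poly R}) (t : R) : 1 <= t ->
  `|p.[t]| <= (\sum_(i < size p) `|p`_i|) * t ^+ (size p).
Proof.
move=> t1; rewrite horner_coef (le_trans (ler_norm_sum _ _ _))// mulr_suml.
apply: ler_sum => i _; rewrite normrM ler_wpM2l// ger0_norm; last first.
  by rewrite exprn_ge0// (le_trans _ t1).
by rewrite ler_weXn2l// ltnW.
Qed.

Lemma flat_poly_derive (p : {poly R}) (x : R) :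
  is_derive x (1 : R) (flat_poly p) (flat_poly ('X^2 * (p - p^`())) x).
Proof.
have [x0|x0|->] := ltgtP x 0.
- rewrite [X in is_derive _ _ _ X](_ : _ = 0); last by rewrite /flat_poly ltNge (ltW x0).
  apply: near_eq_is_derive (is_derive_cst (0 : R) x (1 : R)).
  near=> y; rewrite /flat_poly ltNge ltW//=.
  by near: y; exact: lt_nbhsl.
- have xn0 : x != 0 by rewrite gt_eqF.
  have hV : is_derive x (1 : R) (fun y : R => y^-1) (- x ^- 2).
    have := @is_deriveV R id x 1 1 xn0 (is_derive_id _ _).
    by rewrite /GRing.scale/= mulr1.
  have hp := @is_derive1_comp R (horner p) (fun y : R => y^-1) x _ _ (is_derive_poly p _) hV.
  have hN : is_derive x (1 : R) (fun y : R => - y^-1) (x ^- 2).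
    by have := is_deriveN hV; rewrite opprK.
  have he := @is_derive1_comp R expR (fun y : R => - y^-1) x _ _ (is_derive_expR _) hN.
  have hd := is_deriveM hp he.
  rewrite [X in is_derive _ _ _ X](_ : _ = p.[x^-1] *: (expR (- x^-1) * x ^- 2) +
      expR (- x^-1) *: (p^`().[x^-1] * - x ^- 2)); last first.
    by rewrite /flat_poly x0 !hornerE/= /GRing.scale/= exprVn; ring.
  apply: near_eq_is_derive hd.
  near=> y; rewrite /flat_poly ifT//.
  by near: y; exact: lt_nbhsr.
- rewrite [X in is_derive _ _ _ X](_ : _ = 0); last by rewrite /flat_poly ltxx.
  pose S := \sum_(i < size p) `|p`_i|; pose n := size p.
  (* With t = 1/h >= 1, |p(t)| <= S t^n and e^t >= t^(n+2) / (n+2)!, so the value at h is at most S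
     (n+2)! h^2. *)
  apply: (@is_derive_quadratic_bound _ _ (S * (n.+2)`!%:R)) => h h1.
  rewrite addr0 {2}/flat_poly ltxx subr0 /flat_poly.
  have S0 : 0 <= S by exact: sumr_ge0.
  case: ltP => h0; last by rewrite normr0 !mulr_ge0// exprn_ge0.
  rewrite (ger0_norm (ltW h0)) in h1 *.
  have t1 : 1 <= h^-1 by rewrite invf_ge1.
  have t0 : 0 < h^-1 by rewrite invr_gt0.
  rewrite normrM (ger0_norm (expR_ge0 _)) -mulrA.
  apply: (@le_trans _ _ ((S * h^-1 ^+ n) * ((n.+2)`!%:R / h^-1 ^+ n.+2))).
    apply: ler_pM => //; first exact: poly_bound.
    have := @expR_ge1Dxn R (h^-1) n.+1 (ltW t0).
    have f0 : 0 < (n.+2)`!%:R :> R by rewrite ltr0n fact_gt0.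
    have tn0 : 0 < h^-1 ^+ n.+2 by rewrite exprn_gt0.
    rewrite expRN => H.
    rewrite -[leRHS]invrK lef_pV2 ?posrE ?invr_gt0 ?divr_gt0// ?expR_gt0//.
    by rewrite invf_div (le_trans _ H)// lerDr.
  rewrite -mulrA ler_wpM2l// mulrCA ler_wpM2l//.
  by rewrite !exprVn invrK -addn2 exprD mulrA mulVf ?mul1r// expf_neq0// gt_eqF.
Unshelve. all: by end_near. Qed.

Lemma ntimes_derivable_flat n p : ntimes_derivable n (flat_poly p).
Proof.
elim: n p => // n IH p; exists (flat_poly ('X^2 * (p - p^`()))) => // x.
exact: flat_poly_derive.
Qed.

Definition flat : R -> R := flat_poly 1.

Lemma smooth1_flat : smooth1 flat.
Proof. by move=> n; exact: ntimes_derivable_flat. Qed.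

Lemma flat_le0 x : x <= 0 -> flat x = 0.
Proof. by move=> x0; rewrite /flat /flat_poly ltNge x0. Qed.

Lemma flat01 x : 0 <= flat x <= 1.
Proof.
rewrite /flat /flat_poly hornerC mul1r; case: ltP; rewrite ?lexx ?ler01// => x0.
by rewrite expR_ge0/= -[leRHS]expR0 ler_expR oppr_le0 invr_ge0 ltW.
Qed.

Lemma smooth1_continuous f : smooth1 f -> continuous f.
Proof.
move=> /(_ 1%N)[g fg _] x; apply: differentiable_continuous; apply/derivable1_diffP.
by case: (fg x).
Qed.

(** A smooth substitute for the indicator of ]a, b[: it vanishes up to distance 1/(n+1) inside the
    end points, which leaves a compact support in ]a, b[, and it tends to the indicator because
    [flat] tends to 1 at infinity. *)
Definition bump (a b : R) n (x : R) : R :=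
  flat (n.+1%:R * x + (- n.+1%:R * a - 1)) * flat (- n.+1%:R * x + (n.+1%:R * b - 1)).

Lemma smooth1_bump a b n : smooth1 (bump a b n).
Proof.
by move=> m; apply: ntimes_derivableM; apply: ntimes_derivable_affine; exact: smooth1_flat.
Qed.

Lemma bump01 a b n x : 0 <= bump a b n x <= 1.
Proof.
have /andP[h1 h2] := flat01 (n.+1%:R * x + (- n.+1%:R * a - 1)).
have /andP[h3 h4] := flat01 (- n.+1%:R * x + (n.+1%:R * b - 1)).
by rewrite /bump mulr_ge0//= mulr_ile1.
Qed.

Lemma bump_out a b n x : x <= a + n.+1%:R^-1 \/ b - n.+1%:R^-1 <= x -> bump a b n x = 0.
Proof.
have n0 : 0 < n.+1%:R :> R by [].
case=> h; rewrite /bump.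
  rewrite flat_le0 ?mul0r//.
  have : n.+1%:R * x <= n.+1%:R * (a + n.+1%:R^-1) by rewrite ler_pM2l.
  by rewrite mulrDr mulfV ?gt_eqF//; lra.
rewrite [X in _ * X]flat_le0 ?mulr0//.
have : n.+1%:R * (b - n.+1%:R^-1) <= n.+1%:R * x by rewrite ler_pM2l.
by rewrite mulrBr mulfV ?gt_eqF//; lra.
Qed.

Lemma bump_cvg a b x : bump a b n x @[n --> \oo] --> (((a < x < b)%R : bool)%:R : R).
Proof.
have flat_cvg c k : 0 < c -> flat (n.+1%:R * c + k) @[n --> \oo] --> (1 : R).
  move=> c0; apply/cvgrPdist_le => e e0.
  near=> n.
  have h : 1 + `|k| + e^-1 <= n.+1%:R * c.
    rewrite -ler_pdivrMr//; apply: (@le_trans _ _ n%:R); last by rewrite ler_nat.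
    near: n; exact: nbhs_infty_ger.
  have k1 := ler_norm (- k); rewrite normrN in k1.
  have e1 : 0 < e^-1 by rewrite invr_gt0.
  have t0 : e^-1 <= n.+1%:R * c + k by lra.
  have t1 : 0 < n.+1%:R * c + k by lra.
  rewrite /flat /flat_poly hornerC mul1r t1.
  have := expR_ge1Dx (- (n.+1%:R * c + k)^-1).
  have : (n.+1%:R * c + k)^-1 <= e by rewrite -[leRHS]invrK lef_pV2 ?posrE.
  have : expR (- (n.+1%:R * c + k)^-1) <= 1 by rewrite -[leRHS]expR0 ler_expR oppr_le0 invr_ge0 ltW.
  by rewrite ler_norml => ? ? ?; apply/andP; split; lra.
have [ax|xa] := ltP a x; last first.
  apply: cvg_near_cst; apply: nearW => n; rewrite bump_out//=; left.
  by rewrite (le_trans xa)// lerDl.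
have [xb|bx] := ltP x b; last first.
  apply: cvg_near_cst; apply: nearW => n; rewrite bump_out//=; right.
  by rewrite (le_trans _ bx)// gerBl.
rewrite /= -[X in _ --> X]mulr1; apply: cvgM.
  have := flat_cvg (x - a) (-1); rewrite subr_gt0 => /(_ ax).
  apply: cvg_trans; apply: near_eq_cvg; apply: nearW => n; congr flat; ring.
have := flat_cvg (b - x) (-1); rewrite subr_gt0 => /(_ xb).
apply: cvg_trans; apply: near_eq_cvg; apply: nearW => n; congr flat; ring.
Unshelve. all: by end_near. Qed.

Lemma primitive_exists f (a : R) : continuous f -> (forall x, x <= a -> f x = 0) ->
  exists A : R -> R, forall x : R, is_derive x (1 : R) A (f x).
Proof.
move=> fc f0.
(* Starting at a - 1 makes F vanish to the left of a. The points x <= a - 1, out of reach of the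
   fundamental theorem on [a - 1, x + 1], are settled by F being locally zero there. *)
pose F (x : R) := \int[@lebesgue_measure R]_(t in `[a - 1, x]) f t.
have fi (x : R) : (@lebesgue_measure R).-integrable `[a - 1, x] (EFin \o f).
  by apply: continuous_compact_integrable; [exact: segment_compact|exact: continuous_subspaceT].
exists F => x; have [ax|xa] := ltP (a - 1) x.
  have [] := @continuous_FTC1_closed R f (a - 1) x (x + 1) _ (fi _) ax (fc x).
    by rewrite ltrDl.
  by move=> h1 h2; split; [exact: h1|rewrite -derive1E; exact: h2].
have Fz (y : R) : y < a -> F y = 0.
  move=> ya; rewrite /F (@eq_Rintegral _ _ _ _ _ (fun=> 0)) ?Rintegral_cst ?mul0r//.
  by move=> t; rewrite inE/= in_itv/= => /andP[_ ty]; rewrite f0// (le_trans ty)// ltW.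
rewrite f0; last by rewrite (le_trans xa)// gerBl.
apply: near_eq_is_derive (is_derive_cst (0 : R) x (1 : R)).
near=> y; rewrite Fz//; near: y; apply: lt_nbhsl.
by rewrite (le_lt_trans xa)// ltrBlDr ltrDl.
Unshelve. all: by end_near. Qed.

Lemma MVT_all (A f : R -> R) (x y : R) : (forall z : R, is_derive z (1 : R) A (f z)) ->
  x < y -> exists2 c, x < c < y & A y - A x = f c * (y - x).
Proof.
move=> Af xy.
have Axy : {within `[x, y], continuous A}.
  by apply: derivable_within_continuous => z _; case: (Af z).
have [c cxy ->] := MVT xy (fun z _ => Af z) Axy.
by exists c; rewrite // in_itv/= in cxy.
Qed.

(* [A t - A (t - h)], for [A] a primitive of a bump, approximates the tent
   function whose slope is 1 on ]a, a + h[ and -1 on ]a + h, a + 2h[. *)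
Lemma smooth_tent (a h : R) n : 0 < h -> exists tent : R -> R,
  [/\ smooth1 tent,
      forall x : R, is_derive x (1 : R) tent (bump a (a + h) n x - bump a (a + h) n (x - h)),
      forall x, 0 <= tent x <= h
    & forall x, x <= a + n.+1%:R^-1 \/ a + h + h - n.+1%:R^-1 <= x -> tent x = 0].
Proof.
move=> h0; have n0 : 0 < n.+1%:R^-1 :> R by rewrite invr_gt0.
have [|A Ad] := @primitive_exists (bump a (a + h) n) a (smooth1_continuous (@smooth1_bump _ _ _)).
  by move=> x xa; rewrite bump_out//; left; rewrite (le_trans xa)// lerDl ltW.
have Adh (x : R) : is_derive x (1 : R) (fun y => A (1 * y + (- h))) (bump a (a + h) n (x - h) * 1).
  by apply: is_derive_affine; rewrite mul1r.
have td (x : R) : is_derive x (1 : R) (fun y => A y - A (1 * y + (- h)))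
    (bump a (a + h) n x - bump a (a + h) n (x - h)).
  by rewrite -[X in _ - X]mulr1; exact: is_deriveB.
exists (fun y => A y - A (1 * y + (- h))); split => //.
- case=> // m; exists (fun x => bump a (a + h) n x + (-1) * bump a (a + h) n (1 * x + (- h))).
    by move=> x; rewrite mulN1r mul1r.
  apply: ntimes_derivableD; first exact: smooth1_bump.
  apply: ntimes_derivableM; first exact: ntimes_derivable_cst.
  by apply: ntimes_derivable_affine; exact: smooth1_bump.
- move=> x; rewrite mul1r; have [|c _ ->] := @MVT_all A _ (x - h) x Ad.
    by rewrite gtrBl.
  have /andP[b0 b1] := bump01 a (a + h) n c.
  have -> : x - (x - h) = h by ring.
  by rewrite mulr_ge0//= ?ler_piMl// ltW.
- move=> x xo; rewrite mul1r; have [|c /andP[c1 c2] ->] := @MVT_all A _ (x - h) x Ad.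
    by rewrite gtrBl.
  rewrite bump_out ?mul0r//; case: xo => xo.
    by left; rewrite (le_trans (ltW c2)).
  by right; rewrite (le_trans _ (ltW c1))// lerBrDr addrAC.
Qed.

End smooth_real.

(** * Averages over neighbouring cubes *)

Lemma Rint_dominated_cvg dT (T : measurableType dT) (R : realType)
    (mu : {measure set T -> \bar R}) (D : set T) (F : (T -> R)^nat) (f g : T -> R) :
  measurable D -> (forall n, measurable_fun D (F n)) -> measurable_fun D f ->
  mu.-integrable D (EFin \o g) -> (forall n x, D x -> `|F n x| <= g x) ->
  (forall x, D x -> F n x @[n --> \oo] --> f x) ->
  \int[mu]_(x in D) F n x @[n --> \oo] --> \int[mu]_(x in D) f x.
Proof.
move=> mD mF mf gi Fg Ff.
have := @dominated_convergence _ _ _ mu D mD (fun n x => (F n x)%:E) (EFin \o f) (EFin \o g).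
case.
- by move=> n; exact/measurable_EFinP.
- exact/measurable_EFinP.
- by apply: aeW => x Dx; apply: cvg_EFin; [exact: nearW|exact: Ff].
- exact: gi.
- by apply: aeW => x n Dx /=; rewrite lee_fin Fg.
by move=> fi _; rewrite -(fineK (integrable_fin_num mD fi)) => /fine_cvg.
Qed.

(** * Test functions as products of functions of one variable *)

Section product_functions.
Context {R : realType} {d : nat}.
Implicit Types (psi : 'I_d -> R -> R).

Definition prod_fun psi (x : 'rV[R]_d) : R := \prod_j psi j (x ord0 j).

Lemma partial_prod_fun psi (psi' : R -> R) i :
  (forall x : R, is_derive x (1 : R) (psi i) (psi' x)) ->
  (forall x, derivable (prod_fun psi) x (delta_mx ord0 i)) /\
  partial i (prod_fun psi) = prod_fun (fun j => if j == i then psi' else psi j).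
Proof.
move=> hpsi; suff H x : is_derive x (delta_mx ord0 i) (prod_fun psi)
    (prod_fun (fun j => if j == i then psi' else psi j) x).
  by split => [x|]; [case: (H x)|apply/funext => x; case: (H x)].
pose c := \prod_(j | j != i) psi j (x ord0 j).
have hc : is_derive (x ord0 i) (1 : R) (c \*: psi i) (c *: psi' (x ord0 i)).
  exact: is_deriveZ.
have shift h : prod_fun psi (h *: delta_mx ord0 i + x) = c *: psi i (h *: (1 : R) + x ord0 i).
  rewrite /prod_fun (bigD1 i)//= mulrC; congr (_ * _).
    by apply: eq_bigr => j ji; rewrite !mxE eqxx (negbTE ji) mulr0 add0r.
  by rewrite !mxE !eqxx.
have shift0 : prod_fun psi x = c *: psi i (x ord0 i).
  by rewrite /prod_fun (bigD1 i)//= mulrC.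
have eqq : (fun h : R => h^-1 *: (prod_fun psi (h *: delta_mx ord0 i + x) - prod_fun psi x)) =
    (fun h : R => h^-1 *: ((c \*: psi i) (h *: (1 : R) + x ord0 i) - (c \*: psi i) (x ord0 i))).
  by apply/funext => h; rewrite shift shift0.
have val : prod_fun (fun j => if j == i then psi' else psi j) x = c *: psi' (x ord0 i).
  rewrite /prod_fun (bigD1 i)//= eqxx mulrC; congr (_ * _).
  by apply: eq_bigr => j /negbTE ->.
case: hc => h1 h2; split.
  by rewrite /derivable eqq.
by rewrite /derive eqq val -h2.
Qed.

Lemma continuous_prod_fun psi : (forall j, continuous (psi j)) -> continuous (prod_fun psi).
Proof.
move=> cpsi x; rewrite /prod_fun /continuous_at.
elim: (index_enum _) => [|j s IH].
  rewrite big_nil (_ : (fun _ => _) = cst (1 : R)); first exact: (@cst_continuous _ R 1 x).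
  by apply/funext => y; rewrite big_nil.
rewrite (_ : (fun _ => _) = (fun y : 'rV[R]_d => psi j (y ord0 j) *
    \prod_(j <- s) psi j (y ord0 j))); last first.
  by apply/funext => y; rewrite big_cons.
rewrite big_cons; apply: cvgM; [exact: (nbhs_filter x)| |exact: IH].
apply: (@continuous_comp _ _ _ (fun y : 'rV[R]_d => y ord0 j) (psi j)).
  exact: coord_continuous.
exact: cpsi.
Qed.

(** A partial derivative changes a single factor, so iterated derivatives stay within products of
    smooth functions of one variable. *)
Lemma smooth_prod_fun psi : (forall j, smooth1 (psi j)) -> smooth (prod_fun psi).
Proof.
move=> spsi s; suff [psi' spsi' ->] : exists2 psi', (forall j, smooth1 (psi' j)) &
    foldr partial (prod_fun psi) s = prod_fun psi'.
  split; first by apply: continuous_prod_fun => j; exact: smooth1_continuous.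
  move=> i x; have [g gi _] := spsi' i 1%N.
  by have [] := partial_prod_fun gi.
elim: s => [|i s [psi' spsi' IH]]; first by exists psi.
have [g gi _] := spsi' i 1%N.
exists (fun j => if j == i then g else psi' j); last first.
  by rewrite /= IH; have [_ ->] := partial_prod_fun gi.
(* The witness g' for order n is g by uniqueness of derivatives, so g is n times derivable for every
   n. *)
move=> j; case: eqP => // _ n; have [g' gi' ng'] := spsi' i n.+1.
rewrite (_ : g = g')//; apply/funext => x.
by have [_ <-] := gi x; have [_ <-] := gi' x.
Qed.

Lemma compact_support_prod_fun psi (lo hi : 'I_d -> R) (D : set 'rV[R]_d) :
  (forall j t, t <= lo j \/ hi j <= t -> psi j t = 0) ->
  (forall x : 'rV[R]_d, (forall j, lo j <= x ord0 j <= hi j) -> D x) ->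
  compact (closure [set x | prod_fun psi x != 0]) /\
  closure [set x | prod_fun psi x != 0] `<=` D.
Proof.
move=> out inD.
pose K := [set x : 'rV[R]_d | forall j, [set t | lo j <= t <= hi j] (x ord0 j)].
have cK : compact K.
  apply: (@rV_compact R d (fun j => [set t | lo j <= t <= hi j])) => j.
  rewrite (_ : [set t | _] = `[lo j, hi j]%classic); first exact: segment_compact.
  by apply/seteqP; split => t /=; rewrite in_itv.
have clK : closed K by apply: compact_closed => //; exact: norm_hausdorff.
have sK : closure [set x | prod_fun psi x != 0] `<=` K.
  rewrite [X in _ `<=` X](closure_id K).1//; apply: closureS => x /= /prodf_neq0 h j /=.
  have := h j isT; apply: contraNT; rewrite negb_and -!ltNge => /orP[]/ltW ?.
    by rewrite out//; left.
  by rewrite out//; right.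
split; first by apply: subclosed_compact cK sK; exact: closed_closure.
by move=> x /sK /=; exact: inD.
Qed.

End product_functions.

Section neighbouring_cubes.
Context {R : realType} {d : nat}.
Local Notation mu := (leb R d).
Local Notation Rd := (caratheodory_type (borel_lebesgue R d)^*%mu).
Local Notation itg D f := (mu.-integrable D (EFin \o f)).

(** The open box made of the cube at [a], its neighbour in direction i, and the face between
    them. *)
Definition cube_pair (a : 'rV[R]_d) (h : R) (i : 'I_d) : set 'rV[R]_d :=
  box a (a + const_mx h + h *: delta_mx ord0 i).

(** The test function is a tent in direction i and a bump in the other directions. Its derivative in
    direction i tends to the indicator of the first cube minus that of the second, while the
    function itself stays below h times the indicator of the pair; the weak derivative compares the
    two. *)
Lemma neighbour_difference (Q : set Rd) (f g : Rd -> R) (i : 'I_d) (a : 'rV[R]_d) (h : R) :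
  measurable Q -> 0 < h -> itg Q f -> itg Q g -> cube_pair a h i `<=` Q ->
  weak_partial Q i f g ->
  `|\int[mu]_(x in cube (a + h *: delta_mx ord0 i) h) f x - \int[mu]_(x in cube a h) f x|
    <= h * \int[mu]_(x in cube_pair a h i) `|g x|.
Proof.
move=> mQ h0 fi gi DQ fg.
set C := cube a h; set C' := cube (a + h *: delta_mx ord0 i) h; set D := cube_pair a h i.
have mC : measurable (C : set Rd) by apply: leb_measurable; exact: measurable_box.
have mC' : measurable (C' : set Rd) by apply: leb_measurable; exact: measurable_box.
have mD : measurable (D : set Rd) by apply: leb_measurable; exact: measurable_box.
have CD : C `<=` D.
  move=> x Cx j; have := Cx j; rewrite !mxE eqxx => /andP[-> /= h1]; apply: (lt_le_trans h1).
  by rewrite lerDl mulr_ge0// ltW.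
have CD' : C' `<=` D.
  move=> x Cx j; have := Cx j; rewrite !mxE eqxx /= => /andP[h1 h2]; apply/andP; split.
    by apply: le_lt_trans h1; rewrite lerDl mulr_ge0// ltW.
  by apply: (lt_le_trans h2); rewrite addrAC.
pose bj n j := bump (a ord0 j) (a ord0 j + h) n.
pose tent n := sval (cid (@smooth_tent R (a ord0 i) h n h0)).
have tentP n : [/\ smooth1 (tent n),
      forall x : R, is_derive x (1 : R) (tent n) (bj n i x - bj n i (x - h)),
      forall x, 0 <= tent n x <= h
    & forall x, x <= a ord0 i + n.+1%:R^-1 \/ a ord0 i + h + h - n.+1%:R^-1 <= x -> tent n x = 0].
  by rewrite /tent; case: (cid _).
pose psi n j := if j == i then tent n else bj n j.
have spsi n j : smooth1 (psi n j).
  by rewrite /psi; case: ifP => _; [case: (tentP n)|exact: smooth1_bump].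
pose dpsi n j x := if j == i then bj n i x - bj n i (x - h) else bj n j x.
have partialE n : partial i (prod_fun (psi n)) = prod_fun (dpsi n).
  have := @partial_prod_fun R d (psi n) (fun x => bj n i x - bj n i (x - h)) i.
  rewrite {1}/psi eqxx => -[]; first by case: (tentP n).
  move=> _ ->; congr prod_fun; apply/funext => j; apply/funext => t; rewrite /dpsi /psi.
  by case: eqP.
have test n : test_fun Q (prod_fun (psi n)).
  have n0 : 0 < n.+1%:R^-1 :> R by rewrite invr_gt0.
  have := @compact_support_prod_fun R d (psi n) (fun j => a ord0 j + n.+1%:R^-1)
    (fun j => a ord0 j + h + h * (j == i)%:R - n.+1%:R^-1) Q.
  case; last by move=> ? ?; split => //; exact: smooth_prod_fun.
    move=> j t; rewrite /psi; case: eqP => [->|_].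
      by rewrite mulr1; case: (tentP n) => _ _ _; exact.
    by rewrite mulr0 addr0; exact: bump_out.
  move=> x hx; apply: DQ => j; have /andP[h1 h2] := hx j.
  rewrite !mxE eqxx/= (lt_le_trans _ h1) ?ltrDl//=.
  by rewrite (le_lt_trans h2)// gtrBl.
have psi_bound n (x : Rd) : `|prod_fun (psi n) x| <= h * \1_D x.
  have [xD|xD] := pselect (D x).
    rewrite indicE mem_set// /prod_fun normr_prod (bigD1 i)//=.
    apply: ler_pM => //; first by apply: prodr_ge0 => j _.
      rewrite /psi eqxx; case: (tentP n) => _ _ /(_ (x ord0 i))/andP[t0 t1] _.
      by rewrite ger0_norm.
    rewrite -[leRHS](@big1 _ 1 *%R _ (index_enum 'I_d) (fun j => j != i) (fun=> 1))//.
    apply: ler_prod => j ji; rewrite normr_ge0/= /psi (negbTE ji).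
    by have /andP[b1 b2] := bump01 (a ord0 j) (a ord0 j + h) n (x ord0 j); rewrite ger0_norm.
  have [j hj] : exists j, psi n j (x ord0 j) = 0.
    apply: contrapT => hj; apply: xD => j.
    have n0 : 0 < n.+1%:R^-1 :> R by rewrite invr_gt0.
    apply: contrapT => /negP; rewrite negb_and -!leNgt !mxE eqxx => hh; apply: hj; exists j.
    move: hh; rewrite /psi; case: eqP => [->|_]; rewrite /= ?mulr1 ?mulr0 ?addr0 => /orP[] hh.
    - case: (tentP n) => _ _ _; apply; left; by rewrite (le_trans hh)// lerDl ltW.
    - case: (tentP n) => _ _ _; apply; right; by rewrite (le_trans _ hh)// gerBl ltW.
    - by apply: bump_out; left; rewrite (le_trans hh)// lerDl ltW.
    - by apply: bump_out; right; rewrite (le_trans _ hh)// gerBl ltW.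
  by rewrite /prod_fun (bigD1 j)//= hj mul0r normr0 indicE memNset// mulr0.
have mprod (u : 'I_d -> R -> R) : (forall j, continuous (u j)) ->
    measurable_fun Q (prod_fun u : Rd -> R).
  move=> cu; apply: measurable_prod => j _.
  apply: measurable_funTS; apply: measurableT_comp; last exact: measurable_coord.
  exact: continuous_measurable_fun.
have cdpsi n j : continuous (dpsi n j).
  have cb k := smooth1_continuous (@smooth1_bump R (a ord0 k) (a ord0 k + h) n).
  case: (eqVneq j i) => [ji|ji].
    rewrite (_ : dpsi n j = fun x => bj n i x - bj n i (x - h)).
      move=> x; apply: cvgB; first exact: cb.
      apply: (@continuous_comp _ _ _ (fun y : R => y - h) (bj n i)); last exact: cb.
      by apply: cvgB; [exact: cvg_id|exact: cvg_cst].
    by apply/funext => x; rewrite /dpsi ji eqxx.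
  rewrite (_ : dpsi n j = bj n j); first exact: cb.
  by apply/funext => x; rewrite /dpsi (negbTE ji).
have dpsi1 n j x : `|dpsi n j x| <= 1.
  have B y := bump01 (a ord0 j) (a ord0 j + h) n y.
  rewrite /dpsi; case: eqP => [ji|_].
    have /andP[b1 b2] := B x; have /andP[b3 b4] := B (x - h).
    by rewrite ji in b1 b2 b3 b4; rewrite ler_norml; apply/andP; split; rewrite /bj; lra.
  by have /andP[b1 b2] := B x; rewrite ger0_norm.
have dpsib n (x : Rd) : `|prod_fun (dpsi n) x| <= 1.
  rewrite /prod_fun normr_prod -[leRHS](@big1 _ 1 *%R _ (index_enum 'I_d) xpredT (fun=> 1))//.
  by apply: ler_prod => j _; rewrite normr_ge0 dpsi1.
have ae n : \int[mu]_(x in Q) (f x * prod_fun (dpsi n) x) =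
    - \int[mu]_(x in Q) (g x * prod_fun (psi n) x).
  by have := fg _ (test n); rewrite partialE /Rintegral => ->; rewrite fineN.
have cv : \int[mu]_(x in Q) (f x * prod_fun (dpsi n) x) @[n --> \oo] -->
    \int[mu]_(x in Q) (f x * (\1_C x - \1_C' x)).
  apply: (@Rint_dominated_cvg _ _ _ _ _ _ _ (fun x => `|f x|) mQ).
  - move=> n; apply: measurable_funM; first exact: itg_mfun fi.
    exact: mprod.
  - apply: measurable_funM; first exact: itg_mfun fi.
    by apply: measurable_funB; exact: measurable_indic.
  - exact: itg_norm.
  - by move=> n x _; rewrite normrM ler_piMr.
  - move=> x _; apply: cvgM; first exact: cvg_cst.
    (* Bumps vanish at the end points, so the factors converge to the indicators of open intervals
       at every point, without an exceptional set. *)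
    pose lim j := if j == i then ((a ord0 i < x ord0 i < a ord0 i + h)%R : bool)%:R -
      ((a ord0 i < x ord0 i - h < a ord0 i + h)%R : bool)%:R
      else ((a ord0 j < x ord0 j < a ord0 j + h)%R : bool)%:R : R.
    have -> : \1_C x - \1_C' x = \prod_j lim j.
      rewrite (bigD1 i)//= {1}/lim eqxx mulrBl.
      have out (b : bool) (S : set Rd) : (S x <-> b /\ forall j, j != i ->
          a ord0 j < x ord0 j < a ord0 j + h) -> \1_S x = b%:R * \prod_(j | j != i) lim j :> R.
        move=> Sx; rewrite indicE; have [xS|xS] := pselect (S x).
          have [-> H] := Sx.1 xS; rewrite mem_set// mul1r big1// => j ji.
          by rewrite /lim (negbTE ji) H.
        rewrite memNset//; case: b Sx => Sx; last by rewrite mul0r.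
        rewrite mul1r; have [j ji hj] : exists2 j, j != i & ~~ (a ord0 j < x ord0 j < a ord0 j + h).
          apply: contrapT => H; apply: xS; apply/Sx; split => // j ji.
          by apply: contrapT => /negP hj; apply: H; exists j.
        by rewrite (bigD1 j)//= {1}/lim (negbTE ji) (negbTE hj) mul0r.
      congr (_ - _); apply: out; split.
      - by move=> Cx; split => [|j ji]; [have := Cx i|have := Cx j]; rewrite !mxE.
      - move=> [xi xj] j; rewrite !mxE; have [->//|ji] := eqVneq j i; exact: xj.
      - move=> Cx; split => [|j ji].
          have := Cx i; rewrite !mxE !eqxx mulr1 => /andP[h1 h2].
          by rewrite ltrBrDr h1 ltrBlDr/= (lt_le_trans h2)// addrAC.
        by have := Cx j; rewrite !mxE eqxx (negbTE ji) mulr0 addr0.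
      - move=> [xi xj] j; rewrite !mxE eqxx; have [->|ji] := eqVneq j i.
          by rewrite mulr1 -ltrBrDr; move: xi; rewrite ltrBlDr addrAC.
        by rewrite mulr0 addr0 xj.
    rewrite /prod_fun; elim: (index_enum _) => [|j s IH].
      by under eq_fun do rewrite big_nil; rewrite big_nil; exact: cvg_cst.
    under eq_fun do rewrite big_cons; rewrite big_cons; apply: cvgM => //.
    rewrite /dpsi /lim; case: eqP => [->|_]; last exact: bump_cvg.
    by apply: cvgB; exact: bump_cvg.
have bound n : `|\int[mu]_(x in Q) (f x * prod_fun (dpsi n) x)| <=
    h * \int[mu]_(x in D) `|g x|.
  have gpi : itg Q (fun x => g x * prod_fun (psi n) x).
    apply: (@itg_mul_bounded _ _ _ _ _ _ _ h mQ gi).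
      by apply: mprod => j; exact: smooth1_continuous.
    move=> x _; rewrite (le_trans (psi_bound n x))//; have h0' := ltW h0.
    by rewrite indicE; case: (_ \in _); rewrite ?mulr1 ?mulr0.
  have giD : itg D g by exact: itgS gi.
  rewrite ae normrN (le_trans (le_normr_Rintegral mQ gpi))//.
  rewrite -RintegralZl//; last exact: itg_norm.
  have -> : \int[mu]_(x in D) (h * `|g x|) = \int[mu]_(x in Q) (h * `|g x| * \1_D x).
    by rewrite Rint_indic//; congr Rintegral; apply/esym/setIidPr.
  apply: Rint_mono => //; first exact: itg_norm.
    by apply: itg_indic => //; apply: itgZ => //; exact: itg_norm.
  by move=> x _; rewrite normrM mulrC mulrAC ler_wpM2r.
have {cv} : `|\int[mu]_(x in Q) (f x * (\1_C x - \1_C' x))| <= h * \int[mu]_(x in D) `|g x|.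
  have cn : `|\int[mu]_(x in Q) (f x * prod_fun (dpsi n) x)| @[n --> \oo] -->
      `|\int[mu]_(x in Q) (f x * (\1_C x - \1_C' x))| by apply: cvg_norm.
  rewrite -(cvg_lim _ cn)//.
  by apply: limr_le; [apply: cvgP cn|exact: nearW].
rewrite (_ : \int[mu]_(x in Q) _ = \int[mu]_(x in C) f x - \int[mu]_(x in C') f x).
  by rewrite distrC.
under eq_Rintegral do rewrite mulrBr.
rewrite RintegralB//; [|exact: itg_indic|exact: itg_indic].
by rewrite !Rint_indic//; congr (_ - _); congr Rintegral; apply/setIidPr;
  exact: subset_trans DQ.
Qed.

End neighbouring_cubes.

(** * Truncated Poincare inequality on a cube *)

Section grids.
Context {R : realType} {d : nat}.
Local Notation mu := (leb R d).
Local Notation Rd := (caratheodory_type (borel_lebesgue R d)^*%mu).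
Local Notation itg D f := (mu.-integrable D (EFin \o f)).
Implicit Types (a : 'rV[R]_d) (h l : R).

Lemma cube_measurable a l : measurable (cube a l : set Rd).
Proof. by apply: leb_measurable; exact: measurable_box. Qed.

Lemma leb_cube a l : 0 <= l -> mu (cube a l) = (l ^+ d)%:E.
Proof.
move=> l0; rewrite leb_box; last by move=> i; rewrite !mxE lerDl.
congr EFin; under eq_bigr do rewrite !mxE addrAC subrr add0r.
by rewrite prodr_const card_ord.
Qed.

Lemma leb_cubeoo a l : 0 <= l -> (mu (cube a l) < +oo)%E.
Proof. by move=> l0; rewrite leb_cube// ltry. Qed.

Definition cell a h (m : 'I_d -> nat) : set 'rV[R]_d :=
  cube (\row_k (a ord0 k + h * (m k)%:R)) h.

Lemma cellP a h m x : cell a h m x <->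
  forall k, a ord0 k + h * (m k)%:R < x ord0 k < a ord0 k + h * (m k).+1%:R.
Proof.
by split => H k; have := H k; rewrite !mxE -natr1 mulrDr mulr1 addrA.
Qed.

Lemma cell_inj a h m m' x : 0 < h -> cell a h m x -> cell a h m' x -> m =1 m'.
Proof.
move=> h0 /cellP H /cellP H' k; have /andP[h1 h2] := H k; have /andP[h3 h4] := H' k.
have le (u v : nat) : a ord0 k + h * u%:R < a ord0 k + h * v.+1%:R -> (u <= v)%N.
  by rewrite ltrD2l ltr_pM2l// ltr_nat ltnS.
by apply/eqP; rewrite eqn_leq (le _ _ (lt_trans h1 h4)) (le _ _ (lt_trans h3 h2)).
Qed.

Lemma cell_sub a h (n : nat) m : 0 < h -> (forall k, (m k < n)%N) ->
  cell a h m `<=` cube a (h * n%:R).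
Proof.
move=> h0 mn x /cellP H k; have /andP[h1 h2] := H k; rewrite !mxE; apply/andP; split.
  by apply: le_lt_trans h1; rewrite lerDl mulr_ge0// ltW.
by apply: (lt_le_trans h2); rewrite lerD2l ler_pM2l// ler_nat.
Qed.

Lemma grid_integral a h (n : nat) (f : Rd -> R) : 0 < h -> itg (cube a (h * n%:R)) f ->
  \int[mu]_(x in cube a (h * n%:R)) f x =
  \sum_(j : {ffun 'I_d -> 'I_n}) \int[mu]_(x in cell a h (fun k => j k)) f x.
Proof.
move=> h0 fi; apply: Rint_disjoint_eq => //.
- exact: cube_measurable.
- by move=> j; exact: cube_measurable.
- by move=> j; apply: cell_sub.
- move=> j j' x jx j'x; apply/ffunP => k; apply: val_inj; exact: (cell_inj h0 jx j'x).
- by apply: leb_cubeoo; rewrite mulr_ge0// ltW.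
- rewrite (eq_bigr (fun=> (h ^+ d)%:E)); last by move=> j _; exact: leb_cube (ltW h0).
  have hn0 : 0 <= h * n%:R by rewrite mulr_ge0// ltW.
  rewrite [RHS](leb_cube a hn0) sumEFin; congr EFin.
  by rewrite big_const card_ffun !card_ord iter_addr_0 exprMn -natrX mulr_natr.
Qed.

Lemma leb_cube_pair a i h : 0 < h -> mu (cube_pair a h i) = (2 * h ^+ d)%:E.
Proof.
move=> h0; have hh : h + h = 2 * h by rewrite mulr_natl mulr2n.
rewrite /cube_pair leb_box; last first.
  by move=> k; rewrite !mxE -addrA lerDl addr_ge0 ?mulr_ge0// ltW.
congr EFin; rewrite (bigD1 i)//= !mxE !eqxx mulr1.
rewrite (eq_bigr (fun=> h)); last first.
  by move=> k ki; rewrite !mxE eqxx (negbTE ki) mulr0 addr0 addrAC subrr add0r.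
rewrite prodr_const cardC1 card_ord -addrA addrAC subrr add0r hh -mulrA -exprS.
(* The ordinal i excludes d = 0, so the power with exponent (d - 1) + 1 is the one with exponent
   d. *)
by case: d i => [[]|].
Qed.

Lemma cube_pair_integral a h i (f : Rd -> R) : 0 < h -> itg (cube_pair a h i) f ->
  \int[mu]_(x in cube_pair a h i) f x =
  \int[mu]_(x in cube a h) f x + \int[mu]_(x in cube (a + h *: delta_mx ord0 i) h) f x.
Proof.
move=> h0 fi.
pose F (b : bool) : set Rd := if b then cube a h else cube (a + h *: delta_mx ord0 i) h.
have mD := leb_cube_pair a i h0.
rewrite (@Rint_disjoint_eq _ _ _ mu bool _ F)//.
- by rewrite big_bool.
- by apply: leb_measurable; exact: measurable_box.
- by case; exact: cube_measurable.
- case => x Cx j; have := Cx j; rewrite !mxE eqxx /=.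
    by move=> /andP[-> /= h1]; apply: (lt_le_trans h1); rewrite lerDl mulr_ge0// ltW.
  move=> /andP[h1 h2]; apply/andP; split.
    by apply: le_lt_trans h1; rewrite lerDl mulr_ge0// ltW.
  by apply: (lt_le_trans h2); rewrite addrAC.
- have dis x : cube a h x -> cube (a + h *: delta_mx ord0 i) h x -> False.
    move=> Cx Cx'; have := Cx i; have := Cx' i; rewrite !mxE !eqxx mulr1 => /andP[h1 _] /andP[_ h2].
    by have := lt_trans h1 h2; rewrite ltxx.
  by case=> -[] x // h1 h2; exfalso; apply: dis; [exact: h1|exact: h2|exact: h2|exact: h1].
- by rewrite [X in (X < _)%E]mD ltry.
- rewrite big_bool/= [RHS]mD mulr_natl mulr2n EFinD.
  by congr (_ + _)%E; exact: leb_cube (ltW h0).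
Qed.

End grids.

Lemma interval_dist (R : realType) (c h b x y : R) : b <= h ->
  c < x < c + h + b -> c < y < c + h + b -> `|x - y| <= 2 * h.
Proof. by move=> ? /andP[? ?] /andP[? ?]; rewrite ler_norml; apply/andP; split; lra. Qed.

Lemma dist_chain (R : realType) (A1 A2 B1 B2 x y z : R) : `|A1 - B1| <= x ->
  `|A2 - B2| <= y -> `|B2 - B1| <= z -> `|A2 - A1| <= y + (z + x).
Proof.
move=> h1 h2 h3; have -> : A2 - A1 = (A2 - B2) + ((B2 - B1) - (A1 - B1)) by ring.
by apply: (le_trans (ler_normD _ _)); apply: lerD => //; apply: (le_trans (ler_normB _ _)); exact: lerD.
Qed.

Lemma half_grid_bound (R : realType) (l : R) (j : nat) : 0 <= l -> (j < 2)%N ->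
  l / 2 * j%:R + l / 2 <= l.
Proof. by case: j => [|[|//]] l0 _; rewrite ?mulr0 ?mulr1; lra. Qed.

Lemma grid_index_bound (j s M : nat) (b : bool) : (j < M)%N -> (s < M)%N ->
  (j + s * b + (1 + b) <= M + M * b)%N.
Proof. by case: b; lia. Qed.

Section truncated_poincare.
Context {R : realType} {d : nat}.
Local Notation mu := (leb R d).
Local Notation Rd := (caratheodory_type (borel_lebesgue R d)^*%mu).
Local Notation itg D f := (mu.-integrable D (EFin \o f)).

Variables (Q : set Rd) (f : Rd -> R) (g : 'I_d -> Rd -> R).
Hypotheses (mQ : measurable Q) (fi : itg Q f) (gi : forall i, itg Q (g i)).
Hypothesis fg : forall i, weak_partial Q i f (g i).

(* [T] is a truncation: it is constant away from the values at distance at most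
   [eta] from [J]. *)
Variables (T : R -> R) (J : set R) (eta : R).
Hypotheses (T_lip : forall x y, `|T x - T y| <= `|x - y|) (mJ : measurable J) (eta0 : 0 < eta).
Hypothesis T_cst : forall x y z, T y <> T z -> `|x - y| <= eta -> `|x - z| <= eta -> J x.

Variables (a : 'rV[R]_d) (l : R).
Hypotheses (l0 : 0 < l) (PQ : cube a l `<=` Q).
Let P : set Rd := cube a l.

Let mP : measurable P. Proof. exact: cube_measurable. Qed.
Let Poo : (mu P < +oo)%E. Proof. by apply: leb_cubeoo; exact: ltW. Qed.
Let fP : itg P f. Proof. exact: itgS fi. Qed.
Let gP i : itg P (g i). Proof. exact: itgS (gi i). Qed.
Let gnP i : itg P (fun x => `|g i x|). Proof. exact: itg_norm. Qed.

Lemma measurable_truncation : measurable_fun setT T.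
Proof.
apply: continuous_measurable_fun => x; apply/cvgrPdist_le => e e0; near=> y.
by rewrite (le_trans (T_lip _ _))//; near: y; exact: cvgr_dist_le.
Unshelve. all: by end_near. Qed.

Lemma itg_truncation (D : set Rd) : measurable D -> (mu D < +oo)%E -> itg D f ->
  itg D (fun x => T (f x)).
Proof.
move=> mD Doo fD.
apply: (@itg_le _ _ _ _ _ _ (fun x => `|f x| + `|T 0|) mD).
- by apply: measurableT_comp; [exact: measurable_truncation|exact: itg_mfun fD].
- move=> x _; have -> : T (f x) = (T (f x) - T 0) + T 0 by ring.
  by rewrite (le_trans (ler_normD _ _))// lerD2r (le_trans (T_lip _ _))// subr0.
- by apply: itgD => //; [exact: itg_norm|exact: itg_cst].
Qed.

Let gJ i x := `|g i x| * \1_J (f x).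

Lemma itg_gJ i (D : set Rd) : measurable D -> D `<=` Q -> itg D (gJ i).
Proof.
move=> mD DQ; apply: (@itg_mul_bounded _ _ _ _ _ _ _ 1 mD).
- by apply: itg_norm => //; exact: itgS (gi i).
- apply: measurableT_comp; first exact: measurable_indic.
  by apply: measurable_funS DQ _ => //; exact: itg_mfun fi.
- by move=> x _; rewrite indicE; case: (_ \in _); rewrite ?normr1 ?normr0.
Qed.

(** If the two truncated averages agree there is nothing to prove. Otherwise every x of the pair
    either has f(x) further than eta from one of the averages, or lies in the level set by [T_cst];
    so the three integrands together dominate |g i|. *)
Lemma truncated_neighbours (c : 'rV[R]_d) (h : R) i : 0 < h -> cube_pair c h i `<=` P ->
  `|T (avg (cube (c + h *: delta_mx ord0 i) h) f) - T (avg (cube c h) f)| <=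
  h / h ^+ d * (\int[mu]_(x in cube_pair c h i) gJ i x +
     (\int[mu]_(x in cube_pair c h i)
        (`|g i x| * ((eta < `|f x - avg (cube c h) f|)%R : bool)%:R) +
      \int[mu]_(x in cube_pair c h i)
        (`|g i x| * ((eta < `|f x - avg (cube (c + h *: delta_mx ord0 i) h) f|)%R : bool)%:R))).
Proof.
move=> h0 DP; set C := cube c h; set C' := cube _ h; set D := cube_pair c h i.
have mD : measurable (D : set Rd) by apply: leb_measurable; exact: measurable_box.
have Doo : (mu D < +oo)%E by rewrite leb_cube_pair ?ltry.
have gD : itg D (fun x => `|g i x|) by apply: itgS (gnP i).
have fD : itg D f by apply: itgS fP.
have JD : itg D (gJ i) by apply: itg_gJ => //; exact: subset_trans PQ.
have bD (k : R) : itg D (fun x => `|g i x| * ((eta < `|f x - k|)%R : bool)%:R).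
  apply: (itg_bool mD gD); apply: measurable_fun_ltr; first exact: measurable_cst.
  by apply: (itg_mfun (mu := mu)); apply: itg_norm => //; apply: itgB => //; exact: itg_cst.
have J0 x : 0 <= gJ i x by rewrite /gJ mulr_ge0// indicE.
have nn : 0 <= h / h ^+ d by rewrite divr_ge0 ?exprn_ge0 ?(ltW h0).
have [eqF|neF] := pselect (T (avg C' f) = T (avg C f)).
  by rewrite eqF subrr normr0 mulr_ge0// !addr_ge0//; apply: Rintegral_ge0 => x _;
    rewrite ?J0// mulr_ge0.
apply: (le_trans (T_lip _ _)).
have muC : fine (mu C) = h ^+ d by rewrite leb_cube// ltW.
have muC' : fine (mu C') = h ^+ d by rewrite leb_cube// ltW.
have -> : avg C' f - avg C f = (h ^+ d)^-1 *
    (\int[mu]_(x in C') f x - \int[mu]_(x in C) f x).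
  by rewrite /avg muC muC' mulrBr.
have hi0 : 0 <= (h ^+ d)^-1 by rewrite invr_ge0 exprn_ge0// ltW.
rewrite normrM (ger0_norm hi0) [h / _]mulrC -mulrA; apply: ler_wpM2l => //.
have DQ : D `<=` Q by exact: subset_trans PQ.
apply: (le_trans (neighbour_difference mQ h0 fi (gi i) DQ (@fg i))).
apply: ler_wpM2l; first exact: ltW.
rewrite -RintegralD// -RintegralD//; last exact: itgD.
apply: Rint_mono => //; first by apply: itgD => //; exact: itgD.
move=> x Dx; rewrite /gJ -!mulrDr ler_peMr//.
have JJ : 0 <= \1_J (f x) :> R by rewrite indicE.
have [lt1|le1] := boolP (eta < `|f x - avg C f|); first by rewrite addrCA lerDl addr_ge0.
have [lt2|le2] := boolP (eta < `|f x - avg C' f|); first by rewrite addrA lerDr addr_ge0.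
rewrite indicE mem_set ?lerDl ?addr_ge0//.
by apply: (T_cst neF); rewrite leNgt.
Qed.

(** As T is 1-Lipschitz, replacing T o f on a cell by T of the average of f costs at most the
    deviation of f from that average. *)
Lemma avg_truncation_grid (c : 'rV[R]_d) (h : R) (n : nat) : 0 < h -> (0 < n)%N ->
  cube c (h * n%:R) `<=` P ->
  `|avg (cube c (h * n%:R)) (T \o f) - ((h * n%:R) ^+ d)^-1 *
     (h ^+ d * \sum_(j : {ffun 'I_d -> 'I_n}) T (avg (cell c h (fun k => j k)) f))| <=
  ((h * n%:R) ^+ d)^-1 * \sum_(j : {ffun 'I_d -> 'I_n})
     \int[mu]_(x in cell c h (fun k => j k)) `|f x - avg (cell c h (fun k => j k)) f|.
Proof.
move=> h0 n0 cP; have n0' : 0 < n%:R :> R by rewrite ltr0n.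
have hn0 : 0 <= h * n%:R by rewrite mulr_ge0// ltW.
have mc : measurable (cube c (h * n%:R) : set Rd) by exact: cube_measurable.
have coo : (mu (cube c (h * n%:R)) < +oo)%E by exact: leb_cubeoo.
have Tc : itg (cube c (h * n%:R)) (T \o f) by apply: itg_truncation => //; exact: itgS fP.
have hi0 : 0 <= ((h * n%:R) ^+ d)^-1 by rewrite invr_ge0 exprn_ge0.
rewrite /avg [X in fine X](leb_cube c hn0)/= -mulrBr normrM (ger0_norm hi0).
apply: ler_wpM2l => //; rewrite grid_integral//.
rewrite mulr_sumr -sumrB; apply: (le_trans (ler_norm_sum _ _ _)); apply: ler_sum => j _.
set C := cell c h _.
have CC : C `<=` cube c (h * n%:R) by apply: (cell_sub h0) => k; exact: ltn_ord.
have mC : measurable (C : set Rd) by exact: cube_measurable.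
have Coo : (mu C < +oo)%E by apply: leb_cubeoo; exact: ltW.
have TC : itg C (fun x => T (f x)) by exact: itgS Tc.
have fC : itg C f by apply: itgS fP => //; exact: subset_trans cP.
set k := _^-1 * \int[mu]_(x in C) f x.
have -> : h ^+ d * T k = \int[mu]_(x in C) T k.
  rewrite (Rintegral_cst mu mC) mulrC; congr (_ * _).
  by rewrite [X in fine X](leb_cube _ (ltW h0)).
rewrite -RintegralB//; last exact: itg_cst.
have iTC : itg C (fun x => T (f x) - T k) by apply: itgB => //; exact: itg_cst.
apply: (le_trans (le_normr_Rintegral mC iTC)); apply: Rint_mono => //; first exact: itg_norm.
by apply: itg_norm => //; apply: itgB => //; exact: itg_cst.
Qed.

(** A fine grid on the cube is moved cell by cell onto its sibling. Each step compares neighbouring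
    cells by [truncated_neighbours], M steps of length h make up the distance H, and the errors from
    averaging and from exceptional sets vanish as the grid is refined. *)
Lemma sibling_poincare (b : 'rV[R]_d) (H : R) i : 0 < H -> cube_pair b H i `<=` P ->
  `|avg (cube (b + H *: delta_mx ord0 i) H) (T \o f) - avg (cube b H) (T \o f)|
  <= 2 * H / H ^+ d * \int[mu]_(x in P) gJ i x.
Proof.
move=> H0 DP; apply/ler_addgt0Pr => e e0.
have Hd0 : 0 < H ^+ d by rewrite exprn_gt0.
(* The errors add up to e: 2 H / H^d * tau from the M steps and tau / H^d for each of the two
   cubes. *)
pose tau := e / (2 * H / H ^+ d + 2 / H ^+ d).
have tau0 : 0 < tau by rewrite divr_gt0// addr_gt0// divr_gt0// mulr_gt0.
have [e1 e10 He1] := fine_cells_L1 mP Poo fP tau0.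
have [e2 e20 He2] := fine_cells_exceptional mP Poo fP (gP i) eta0 tau0.
have [N HN] : exists N : nat, 2 * H / N.+1%:R <= Num.min e1 e2.
  have m0 : 0 < Num.min e1 e2 by rewrite lt_min e10.
  exists (Num.bound (2 * H / Num.min e1 e2)).
  have x0 : 0 <= 2 * H / Num.min e1 e2 by rewrite divr_ge0// ltW// mulr_gt0.
  rewrite ler_pdivrMr// [Num.min e1 e2 * _]mulrC -ler_pdivrMr// (le_trans (ltW (archi_boundP x0)))//.
  by rewrite ler_nat.
pose M := N.+1; pose h := H / M%:R.
have M0 : 0 < M%:R :> R by [].
have h0 : 0 < h by rewrite divr_gt0.
have hd0 : 0 < h ^+ d by rewrite exprn_gt0.
have hM : h * M%:R = H by rewrite /h mulfVK// gt_eqF.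
pose I := {ffun 'I_d -> 'I_M}.
(* The grid moved by s cells in direction i: s = 0 fills the cube at b, s = M its sibling. *)
pose corner (s : nat) (j : I) : 'rV[R]_d := \row_k (b ord0 k + h * (j k + s * (k == i))%:R).
pose C s j := cube (corner s j) h.
pose D s j := cube_pair (corner s j) h i.
have corner_succ s j : corner s.+1 j = corner s j + h *: delta_mx ord0 i.
  apply/rowP => k; rewrite !mxE eqxx/= -addrA -mulrDr mulSn.
  by congr (_ + h * _); rewrite -natrD addnA addnAC.
have mC s j : measurable (C s j : set Rd) by exact: cube_measurable.
have mD s j : measurable (D s j : set Rd) by apply: leb_measurable; exact: measurable_box.
have CD s j : C s j `<=` D s j.
  move=> x Cx k; have := Cx k; rewrite !mxE eqxx => /andP[-> /= h1]; apply: (lt_le_trans h1).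
  by rewrite lerDl mulr_ge0// ltW.
have CD' s j : C s.+1 j `<=` D s j.
  rewrite /C corner_succ => x Cx k; have := Cx k; rewrite !mxE eqxx /= => /andP[h1 h2].
  apply/andP; split; first by apply: le_lt_trans h1; rewrite lerDl mulr_ge0// ltW.
  by apply: (lt_le_trans h2); rewrite addrAC.
have DPs s j : (s < M)%N -> D s j `<=` P.
  move=> sM; apply: subset_trans DP => x Dx k; have := Dx k; rewrite !mxE eqxx/= => /andP[h1 h2].
  rewrite (le_lt_trans _ h1)/= ?lerDl ?mulr_ge0// ?ltW//.
  apply: (lt_le_trans h2); rewrite -!addrA lerD2l -hM -mulrA -mulrDr.
  rewrite -[X in _ + (X + _)]mulr1 -!mulrDr ler_pM2l//.
  rewrite -[1]/(1%:R) -natrM -!natrD ler_nat.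
  exact: grid_index_bound (ltn_ord _) sM.
have CP s j : (s <= M)%N -> C s j `<=` P.
  case: s => [|s] sM; first exact: subset_trans (CD _ _) (DPs _ _ _).
  exact: subset_trans (CD' _ _) (DPs _ _ _).
have muC s j : fine (mu (C s j)) = h ^+ d by rewrite leb_cube// ltW.
have Coo s j : (mu (C s j) < +oo)%E by apply: leb_cubeoo; exact: ltW.
have Doo s j : (s < M)%N -> (mu (D s j) < +oo)%E.
  move=> sM; apply: le_lt_trans Poo; apply: le_measure; rewrite ?inE//; exact: DPs.
have tC s (j j' : I) x : C s j x -> C s j' x -> j = j'.
  move=> jx j'x; apply/ffunP => k; apply: val_inj.
  have := @cell_inj R d b h (fun k => j k + s * (k == i))%N (fun k => j' k + s * (k == i))%N x h0 jx j'x k.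
  by move/eqP; rewrite eqn_add2r => /eqP.
(* For fixed s the cells at s are disjoint, and so are those at s + 1: this is the multiplicity 2 of
   the pairs. *)
have sumD s (u : Rd -> R) : (s < M)%N -> itg P u -> (forall x, 0 <= u x) ->
    \sum_j \int[mu]_(x in D s j) u x <= 2 * \int[mu]_(x in P) u x.
  move=> sM ui u0.
  have uD j : itg (D s j) u by apply: (itgS _ mP _ ui); [exact: mD|exact: DPs].
  rewrite (eq_bigr (fun j => \int[mu]_(x in C s j) u x + \int[mu]_(x in C s.+1 j) u x)); last first.
    by move=> j _; rewrite /C corner_succ; exact: cube_pair_integral h0 (uD j).
  rewrite big_split/= mulr_natl mulr2n lerD//; apply: Rint_disjoint_le => //;
    by [move=> j; exact: CP (ltnW sM)|move=> j; exact: CP sM|exact: tC].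
have diam s j (x y : Rd) : D s j x -> D s j y -> forall k : 'I_d,
    `|x ord0 k - y ord0 k| <= 2 * H / M%:R.
  move=> Dx Dy k; have := Dx k; have := Dy k; rewrite !mxE eqxx/= -mulrA -/h.
  have kk : h * (k == i)%:R <= h by case: (k == i); rewrite ?mulr1// mulr0 ltW.
  by move=> yD xD; exact: interval_dist kk xD yD.
have fD s (sM : (s < M)%N) e' : 2 * H / M%:R <= e' -> fine_cells P e' (C s) (D s).
  move=> he; split.
  - by move=> j; split; [exact: mC|exact: mD|exact: CD|exact: DPs].
  - move=> j; rewrite muC; split => //.
    by rewrite /D leb_cube_pair.
  - by move=> j x y Dx Dy k; rewrite (le_trans _ he)//; exact: diam Dx Dy _.
  - by move=> u ui u0; exact: sumD.
have fD' s (sM : (s < M)%N) e' : 2 * H / M%:R <= e' -> fine_cells P e' (C s.+1) (D s).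
  move=> he; have [h1 h2 h3 h4] := fD s sM e' he; split => //.
  - by move=> j; split; [exact: mC|exact: mD|exact: CD'|exact: DPs].
  - by move=> j; have := h2 j; rewrite !muC.
have [HN1 HN2] : 2 * H / M%:R <= e1 /\ 2 * H / M%:R <= e2.
  by move: HN; rewrite le_min => /andP[].
pose F s j := T (avg (C s j) f).
pose S s := \sum_j F s j.
have main s : (s < M)%N -> `|S s.+1 - S s| <=
    h / h ^+ d * (2 * \int[mu]_(x in P) gJ i x + 2 * tau).
  move=> sM; rewrite /S -sumrB (le_trans (ler_norm_sum _ _ _))//.
  pose b1 j x : R := ((eta < `|f x - avg (C s j) f|)%R : bool)%:R.
  pose b2 j x : R := ((eta < `|f x - avg (C s.+1 j) f|)%R : bool)%:R.
  apply: (@le_trans _ _ (\sum_j h / h ^+ d * (\int[mu]_(x in D s j) gJ i x +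
     (\int[mu]_(x in D s j) (`|g i x| * b1 j x) + \int[mu]_(x in D s j) (`|g i x| * b2 j x))))).
    apply: ler_sum => j _; rewrite /F /b1 /b2 /C corner_succ.
    exact: truncated_neighbours h0 (DPs s j sM).
  have nn : 0 <= h / h ^+ d by rewrite divr_ge0// ltW.
  rewrite -mulr_sumr !big_split/=; apply: ler_wpM2l => //.
  apply: lerD.
    apply: (sumD _ _ sM); first by apply: (itg_gJ _ mP PQ).
    by move=> x; rewrite /gJ mulr_ge0// indicE.
  rewrite mulr_natl mulr2n lerD//.
    by apply: He2; exact: fD.
  by apply: He2; exact: fD'.
have S_M : `|S M - S 0%N| <= H / h ^+ d * (2 * \int[mu]_(x in P) gJ i x + 2 * tau).
  rewrite -(telescope_sumr S (leq0n M)) (le_trans (ler_norm_sum _ _ _))//.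
  apply: (@le_trans _ _ (\sum_(0 <= s < M) h / h ^+ d * (2 * \int[mu]_(x in P) gJ i x + 2 * tau))).
    by rewrite big_nat [leRHS]big_nat; apply: ler_sum => s /andP[_ sM]; exact: main.
  rewrite sumr_const_nat subn0 -mulr_natr -hM le_eqVlt; apply/orP; left; apply/eqP; ring.
have Hi0 : 0 <= (H ^+ d)^-1 by rewrite invr_ge0 ltW.
have avgF s (c : 'rV[R]_d) : (forall j, corner s j = \row_k (c ord0 k + h * (j k)%:R)) ->
    cube c H `<=` P -> \sum_j \int[mu]_(x in C s j) `|f x - avg (C s j) f| <= tau ->
    `|avg (cube c H) (T \o f) - (H ^+ d)^-1 * (h ^+ d * S s)| <= (H ^+ d)^-1 * tau.
  move=> cE cP le_tau; have := @avg_truncation_grid c h M h0 isT; rewrite hM => /(_ cP).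
  have CE j : C s j = cell c h (fun k => j k) by rewrite /C cE.
  rewrite (_ : S s = \sum_(j : I) T (avg (cell c h (fun k => j k)) f)); last first.
    by apply: eq_bigr => j _; rewrite /F CE.
  move=> H1; apply: (le_trans H1); apply: (ler_wpM2l Hi0); apply: le_trans le_tau.
  by apply: ler_sum => j _; rewrite CE.
have cellsC s s' (s'M : (s' < M)%N) : (forall j, C s j `<=` D s' j) ->
   \sum_j \int[mu]_(x in D s' j) `|f x - avg (C s j) f| <= tau ->
   \sum_j \int[mu]_(x in C s j) `|f x - avg (C s j) f| <= tau.
  move=> CDs; apply: le_trans; apply: ler_sum => j _; apply: Rint_subset => //.
  apply: itg_norm => //; apply: itgB => //; last by apply: itg_cst => //; exact: Doo.
  by apply: itgS fP => //; exact: DPs.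
have h1 := @avgF 0%N b.
have {}h1 : `|avg (cube b H) (T \o f) - (H ^+ d)^-1 * (h ^+ d * S 0%N)| <= (H ^+ d)^-1 * tau.
  apply: h1.
  - by move=> j; apply/rowP => k; rewrite !mxE mul0n addn0.
  - apply: subset_trans DP => x Cx k; have := Cx k; rewrite !mxE eqxx => /andP[-> /= h1].
    by apply: (lt_le_trans h1); rewrite lerDl mulr_ge0// ltW.
  - by apply: (@cellsC 0%N 0%N) => //; apply: He1; exact: fD.
have h2 : `|avg (cube (b + H *: delta_mx ord0 i) H) (T \o f) -
    (H ^+ d)^-1 * (h ^+ d * S M)| <= (H ^+ d)^-1 * tau.
  apply: avgF.
  - move=> j; apply/rowP => k; rewrite !mxE eqxx/= -hM -addrA -mulrA -mulrDr.
    by congr (_ + h * _); rewrite -natrM -natrD addnC.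
  - apply: subset_trans DP => x Cx k; have := Cx k; rewrite !mxE eqxx /= => /andP[u1 u2].
    apply/andP; split; first by apply: le_lt_trans u1; rewrite lerDl mulr_ge0// ltW.
    by apply: (lt_le_trans u2); rewrite addrAC.
  - by apply: (@cellsC N.+1 N) => //; apply: He1; exact: fD'.
have h3 : `|(H ^+ d)^-1 * (h ^+ d * S M) - (H ^+ d)^-1 * (h ^+ d * S 0%N)| <=
    H / H ^+ d * (2 * \int[mu]_(x in P) gJ i x + 2 * tau).
  rewrite -mulrBr normrM (ger0_norm Hi0) [H / _]mulrC -mulrA; apply: (ler_wpM2l Hi0).
  rewrite -mulrBr normrM (ger0_norm (ltW hd0)).
  apply: (@le_trans _ _ (h ^+ d * (H / h ^+ d * (2 * \int[mu]_(x in P) gJ i x + 2 * tau)))).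
    by rewrite ler_pM2l.
  by rewrite mulrA mulrCA mulfV ?gt_eqF// mulr1.
have -> : e = 2 * H / H ^+ d * tau + 2 / H ^+ d * tau.
  by rewrite -mulrDl /tau mulrC mulfVK// gt_eqF// addr_gt0// divr_gt0// mulr_gt0.
apply: le_trans (dist_chain h1 h2 h3) _.
by rewrite le_eqVlt; apply/orP; left; apply/eqP; ring.
Qed.

Let B i := 2 * (l / 2) / (l / 2) ^+ d * \int[mu]_(x in P) gJ i x.
Let phi (j : 'I_d -> nat) := avg (cell a (l / 2) j) (T \o f).

Let H0 : 0 < l / 2. Proof. by rewrite divr_gt0. Qed.

Let B0 i : 0 <= B i.
Proof.
have H00 := ltW H0; rewrite /B; apply: mulr_ge0.
  by apply: divr_ge0; [exact: mulr_ge0|exact: exprn_ge0].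
by apply: Rintegral_ge0 => x _; rewrite /gJ mulr_ge0// indicE.
Qed.

Let phi_sibling (j j' : 'I_d -> nat) i : (forall k, (j k < 2)%N) -> j i = 0%N -> j' i = 1%N ->
  (forall k, k != i -> j' k = j k) -> `|phi j' - phi j| <= B i.
Proof.
move=> j2 ji j'i jj'; pose b : 'rV[R]_d := \row_k (a ord0 k + l / 2 * (j k)%:R).
rewrite /phi (_ : cell _ _ j' = cube (b + l / 2 *: delta_mx ord0 i) (l / 2)).
  apply: sibling_poincare => // x Dx k; have := Dx k; rewrite !mxE eqxx/= => /andP[h1 h2].
  have p0 : 0 <= l / 2 * (j k)%:R by apply: mulr_ge0; first exact: ltW.
  apply/andP; split; first by apply: le_lt_trans h1; rewrite lerDl.
  apply: (lt_le_trans h2).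
  have [->|ki] := eqVneq k i; first by rewrite ji /= mulr0 addr0 mulr1 -addrA -splitr.
  by rewrite mulr0 addr0 -!addrA lerD2l; apply: half_grid_bound (ltW l0) (j2 k).
congr cube; apply/rowP => k; rewrite !mxE eqxx/=.
have [->|ki] := eqVneq k i; first by rewrite ji j'i mulr0 addr0.
by rewrite jj'// mulr0 addr0.
Qed.

(** Any two children are joined by changing the coordinates of the index one at a time, each change
    being a step between siblings; [mix n] has its first n coordinates from j' and the others from
    j. *)
Let phi_pair (j j' : {ffun 'I_d -> 'I_2}) : `|phi (fun k => j' k) - phi (fun k => j k)| <= \sum_i B i.
Proof.
pose mix (n : nat) (k : 'I_d) : nat := if (k < n)%N then j' k else j k.
have mix2 n k : (mix n k < 2)%N by rewrite /mix; case: ifP.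
have step (i : 'I_d) : `|phi (mix i.+1) - phi (mix i)| <= B i.
  have mixk k : k != i -> mix i.+1 k = mix i k.
    by move=> ki; rewrite /mix ltnS leq_eqVlt (inj_eq val_inj) (negbTE ki).
  have mi : mix i i = j i by rewrite /mix ltnn.
  have mi1 : mix i.+1 i = j' i by rewrite /mix ltnSn.
  case: (ltngtP (j i) (j' i)) => jj.
  - have [ji j'i] : j i = 0%N :> nat /\ j' i = 1%N :> nat.
      by move: jj (ltn_ord (j i)) (ltn_ord (j' i)); clear; case: (nat_of_ord (j i)); case: (nat_of_ord (j' i)) => [|[]]; lia.
    by apply: phi_sibling => //; rewrite ?mi ?mi1.
  - have [ji j'i] : j i = 1%N :> nat /\ j' i = 0%N :> nat.
      by move: jj (ltn_ord (j i)) (ltn_ord (j' i)); clear; case: (nat_of_ord (j i)) => [|[]]; case: (nat_of_ord (j' i)); lia.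
    rewrite distrC; apply: phi_sibling => //; rewrite ?mi ?mi1//.
    by move=> k ki; rewrite mixk.
  - have -> : mix i.+1 = mix i; last by rewrite subrr normr0.
    apply/funext => k; have [->|ki] := eqVneq k i; last exact: mixk.
    by rewrite mi mi1.
have -> : (fun k => nat_of_ord (j' k)) = mix d by apply/funext => k; rewrite /mix ltn_ord.
have -> : (fun k => nat_of_ord (j k)) = mix 0%N by [].
rewrite -(telescope_sumr (fun n => phi (mix n)) (leq0n d)) big_mkord.
by apply: (le_trans (ler_norm_sum _ _ _)); apply: ler_sum => i _.
Qed.

(** The average over the parent is the mean of the 2^d averages over the children, so its distance
    to one child is at most the mean of the distances between children. The constant is 2 (l/2) /
    (l/2)^d. *)
Lemma child_poincare (j : {ffun 'I_d -> 'I_2}) :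
  `|avg (cell a (l / 2) (fun k => j k)) (T \o f) - avg (cube a l) (T \o f)| <=
  2 ^+ d * l / l ^+ d * \int[mu]_(x in P) \sum_i gJ i x.
Proof.
have gJP i : itg P (gJ i) by exact: itg_gJ.
have ld0 : 0 < l ^+ d by rewrite exprn_gt0.
have -> : 2 ^+ d * l / l ^+ d * \int[mu]_(x in P) \sum_i gJ i x = \sum_i B i.
  rewrite Rint_sum// /B -mulr_sumr; congr (_ * _).
  by rewrite expr_div_n invf_div [2 * (l / 2)]mulrC divfK ?pnatr_eq0// mulrCA mulrA.
have TP : itg P (T \o f) by exact: itg_truncation.
have lE : l / 2 * 2 = l by rewrite mulfVK ?pnatr_eq0.
have PE : avg (cube a l) (T \o f) = (2 ^+ d)^-1 * \sum_(j' : {ffun 'I_d -> 'I_2}) phi (fun k => j' k).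
  rewrite /avg (leb_cube a (ltW l0))/=.
  have := @grid_integral R d a (l / 2) 2 (T \o f) H0; rewrite lE => /(_ TP) ->.
  rewrite !mulr_sumr; apply: eq_bigr => j' _; rewrite /phi /avg.
  rewrite [X in fine X](leb_cube _ (ltW H0))/= mulrA; congr (_ * _).
  by rewrite expr_div_n invf_div mulrA mulVf ?mul1r// expf_neq0// pnatr_eq0.
have card2 : (2 ^+ d)^-1 * \sum_(j' : {ffun 'I_d -> 'I_2}) 1 = 1 :> R.
  rewrite sumr_const card_ffun !card_ord -[_ *+ _]mulr_natr mul1r natrX.
  by rewrite mulVf// expf_neq0// pnatr_eq0.
have i2 : 0 <= (2 ^+ d)^-1 :> R by rewrite invr_ge0 exprn_ge0.
rewrite PE -/(phi _) -[phi _]mulr1 -{1}card2 mulrCA -mulrBr mulr_sumr -sumrB.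
rewrite normrM (ger0_norm i2).
have -> : \sum_i B i = (2 ^+ d)^-1 * \sum_(j' : {ffun 'I_d -> 'I_2}) \sum_i B i.
  rewrite -[LHS]mulr1 -[X in _ * X = _]card2 mulrCA mulr_sumr; congr (_ * _).
  by apply: eq_bigr => j' _; rewrite mulr1.
apply: (ler_wpM2l i2); apply: (le_trans (ler_norm_sum _ _ _)); apply: ler_sum => j' _.
by rewrite mulr1; exact: phi_pair.
Qed.

End truncated_poincare.

(** * Sums over a weighted tree *)

Section finite_hoelder.
Context {R : realType}.
Implicit Types (a b x y : R).

Lemma powR_le_base (r a b : R) : 0 <= r -> 0 <= a -> a <= b -> a `^ r <= b `^ r.
Proof.
move=> r0 a0 ab; apply: ge0_ler_powR; rewrite ?nnegrE//; exact: le_trans ab.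
Qed.

Lemma powRK (r a : R) : r != 0 -> 0 <= a -> (a `^ r) `^ r^-1 = a.
Proof. by move=> r0 a0; rewrite -powRrM mulfV// powRr1. Qed.

Lemma powRVK (r a : R) : r != 0 -> 0 <= a -> (a `^ r^-1) `^ r = a.
Proof. by move=> r0 a0; rewrite -powRrM mulVf// powRr1. Qed.

Lemma hoelder_add (t a1 a2 b1 b2 : R) : 0 < t <= 1 -> 0 <= a1 -> 0 <= a2 -> 0 <= b1 -> 0 <= b2 ->
  a1 `^ t * b1 `^ (1 - t) + a2 `^ t * b2 `^ (1 - t) <=
  (a1 + a2) `^ t * (b1 + b2) `^ (1 - t).
Proof.
move=> /andP[t0]; rewrite le_eqVlt => /orP[/eqP->|t1] a10 a20 b10 b20.
  by rewrite subrr !powRr0 !mulr1 !powRr1// addr_ge0.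
have s0 : 0 < 1 - t by rewrite subr_gt0.
have := @hoelder2 R (a1 `^ t) (a2 `^ t) (b1 `^ (1 - t)) (b2 `^ (1 - t)) t^-1 (1 - t)^-1.
rewrite !powR_ge0 !invr_gt0 t0 s0 !invrK addrCA subrr addr0 => /(_ isT isT isT isT isT isT erefl).
by rewrite !powRK ?gt_eqF.
Qed.

Lemma hoelder_sum (I : Type) (s : seq I) (P : pred I) (t : R) (a b : I -> R) : 0 < t <= 1 ->
  (forall i, 0 <= a i) -> (forall i, 0 <= b i) ->
  \sum_(i <- s | P i) a i `^ t * b i `^ (1 - t) <=
  (\sum_(i <- s | P i) a i) `^ t * (\sum_(i <- s | P i) b i) `^ (1 - t).
Proof.
move=> t01 a0 b0; elim: s => [|i s IH].
  by rewrite !big_nil mulr_ge0// powR_ge0.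
rewrite !big_cons; case: ifP => // Pi.
apply: (le_trans (lerD (lexx _) IH)).
by apply: hoelder_add => //; apply: sumr_ge0.
Qed.

(** Convexity of the p-th power at the midpoint of 2u and v. The factor 1/2 in front of v^p,
    whatever p >= 1, is what later allows absorption. *)
Lemma powR_midpoint (p u v : R) : 1 <= p -> 0 <= u -> 0 <= v ->
  (u + v / 2) `^ p <= 2 `^ (p - 1) * u `^ p + 2^-1 * v `^ p.
Proof.
move=> p1 u0 v0; have p0 : 0 < p by exact: lt_le_trans p1.
have pn0 : p != 0 by rewrite gt_eqF.
have ti : 0 < p^-1 <= 1 by rewrite invr_gt0 p0 invf_le1.
have u20 : 0 <= 2 * u by rewrite mulr_ge0.
have := hoelder_add ti (powR_ge0 (2 * u) p) (powR_ge0 v p) ler01 ler01.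
rewrite !powRK// !powR1 !mulr1 => H.
have {}H : (2 * u + v) `^ p <= ((2 * u) `^ p + v `^ p) * 2 `^ (p - 1).
  have := powR_le_base (ltW p0) (addr_ge0 u20 v0) H.
  rewrite powRM ?powR_ge0// powRVK ?addr_ge0 ?powR_ge0// -powRrM.
  by rewrite mulrBl mul1r mulVf.
have -> : u + v / 2 = 2^-1 * (2 * u + v) by field.
rewrite powRM ?addr_ge0// -[X in X `^ p * _]powR_inv1// -powRrM.
apply: (@le_trans _ _ (2 `^ (-1 * p) * (((2 * u) `^ p + v `^ p) * 2 `^ (p - 1)))).
  by apply: ler_wpM2l => //; exact: powR_ge0.
rewrite (powRM _ _ u0)//.
have e1 : 2 `^ (-1 * p) * 2 `^ (p - 1) = 2^-1 :> R.
  rewrite -powRD; last by rewrite pnatr_eq0 implybT.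
  by rewrite mulN1r addrA addNr add0r powR_inv1.
have e2 : 2^-1 * 2 `^ p = 2 `^ (p - 1) :> R.
  by rewrite -e1 -mulrA [2 `^ (p - 1) * _]mulrC mulrA -powRD ?mulN1r ?addNr ?powRr0 ?mul1r// pnatr_eq0 implybT.
by rewrite mulrCA e1 mulrC mulrDr mulrA e2.
Qed.

Lemma two_halves_absurd (om a1 a2 a3 : R) : om / 2 < a1 -> om / 2 < a2 -> 0 <= a3 ->
  a1 + (a2 + a3) <= om -> false.
Proof. by move=> *; lra. Qed.

Lemma absorb_half (k A B C Y r : R) : Y <= k * r + 2^-1 * C ->
  A <= k * B + 2^-1 * (A - C) -> Y + A <= k * (r + B) + 2^-1 * (Y + A - Y).
Proof. by move=> *; lra. Qed.

Lemma absorb_half_end (k A B z : R) : 0 <= z -> A <= k * B + 2^-1 * (A - z) ->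
  2^-1 * A <= k * B.
Proof. by move=> *; lra. Qed.

Lemma geometric_sum_le (rho : R) (M : nat) : 0 <= rho -> rho < 1 ->
  \sum_(n < M) rho ^+ n <= (1 - rho)^-1.
Proof.
move=> r0 r1; have r10 : 0 < 1 - rho by rewrite subr_gt0.
have -> : \sum_(n < M) rho ^+ n = (1 - rho ^+ M) / (1 - rho).
  apply: (canRL (mulfK _)); first by rewrite gt_eqF.
  elim: M => [|M IH]; first by rewrite big_ord0 mul0r expr0 subrr.
  by rewrite big_ord_recr/= mulrDl IH exprSr; ring.
by rewrite ler_pdivrMr// mulVf ?gt_eqF// gerBl exprn_ge0.
Qed.

Lemma powR_exp2 (a : R) (n : nat) : (2 ^+ n) `^ a = (2 `^ a) ^+ n.
Proof. by rewrite -powR_mulrn// powRAC powR_mulrn// powR_ge0. Qed.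

Lemma powR_exp2V (a : R) (n : nat) : (2 ^- n) `^ a = (2 `^ (- a)) ^+ n.
Proof.
by rewrite -powR_inv1 ?exprn_ge0// -powRrM mulN1r powR_exp2.
Qed.

Lemma dyadic_scale (r : R) : exists n : nat, r <= 2 ^+ n.
Proof.
exists (Num.bound `|r|); apply: (le_trans (ler_norm r)).
have /ltW/le_trans := archi_boundP (normr_ge0 r); apply.
by rewrite -natrX ler_nat ltnW// ltn_expl.
Qed.

Lemma dyadic_scale_above (x c : R) : 0 < c -> c < x -> exists n : nat,
  2 ^+ n * c < x /\ x <= 2 ^+ n.+1 * c.
Proof.
move=> c0 cx; have ex : exists n : nat, x <= 2 ^+ n.+1 * c.
  have [n hn] := dyadic_scale (x / c); exists n; rewrite -ler_pdivrMr// (le_trans hn)//.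
  by rewrite ler_weXn2l// ler1n.
case: (ex_minnP ex) => n hn nmin; exists n; split => //; rewrite ltNge; apply/negP => h.
by case: n hn nmin h => [|n] hn nmin h; [move: h; rewrite expr0 mul1r leNgt cx|
  have := nmin _ h; rewrite ltnn].
Qed.

Lemma dyadic_scale_below (x c : R) : 0 < x -> x <= c -> exists n : nat,
  c / 2 ^+ n / 2 < x /\ x <= c / 2 ^+ n.
Proof.
move=> x0 xc; have c0 : 0 < c by exact: lt_le_trans xc.
have p2 n : 0 < 2 ^+ n :> R by rewrite exprn_gt0.
have ex : exists n : nat, c / 2 ^+ n / 2 < x.
  have [n hn] := dyadic_scale (c / x); exists n.
  rewrite -mulrA -invfM -exprSr ltr_pdivrMr// mulrC -ltr_pdivrMr// (le_lt_trans hn)//.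
  by rewrite ltr_eXn2l// ltr1n.
case: (ex_minnP ex) => n hn nmin; exists n; split => //; rewrite leNgt; apply/negP => h.
case: n hn nmin h => [|n] hn nmin h; first by move: h; rewrite expr0 divr1 ltNge xc.
suff : (n.+1 <= n)%N by rewrite ltnn.
by apply: nmin; rewrite -mulrA -invfM -exprSr.
Qed.

Lemma four_bound (N a b c : R) : a <= 2 -> 0 <= 2 * N * b * c ->
  2 * (N * (a * b) * c) <= 4 * N * c * b.
Proof. by move=> *; nra. Qed.

End finite_hoelder.

(** * Finite trees of paths, with sums over nodes and leaves *)

Section trees.
Context {R : realType} (X : finType).
Implicit Types (s v : seq X) (h : seq X -> R) (n : nat).

(* A node is the path leading from it up to the root, so that the children of
   [s] are the [x :: s]. *)
Fixpoint nodes n s : seq (seq X) :=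
  if n is m.+1 then s :: flatten [seq nodes m (x :: s) | x <- enum X] else [::].

Fixpoint leaves n s : seq (seq X) :=
  if n is m.+1 then flatten [seq leaves m (x :: s) | x <- enum X] else [:: s].

(** The list v gives the children chosen while descending from s, the first choice at its head: h is
    summed along one descending path. *)
Fixpoint path_sum h v s : R := h s + (if v is x :: v' then path_sum h v' (x :: s) else 0).

Lemma sum_nodes0 s (P : pred (seq X)) h : \sum_(t <- nodes 0 s | P t) h t = 0.
Proof. by rewrite big_nil. Qed.

Lemma sum_nodesS n s (P : pred (seq X)) h :
  \sum_(t <- nodes n.+1 s | P t) h t =
  (if P s then h s else 0) + \sum_x \sum_(t <- nodes n (x :: s) | P t) h t.
Proof.
rewrite /= big_cons big_flatten/= big_map big_enum/=.
by case: ifP => // _; rewrite add0r.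
Qed.

Lemma sum_leaves0 s h : \sum_(t <- leaves 0 s) h t = h s.
Proof. by rewrite big_seq1. Qed.

Lemma sum_leavesS n s h :
  \sum_(t <- leaves n.+1 s) h t = \sum_x \sum_(t <- leaves n (x :: s)) h t.
Proof. by rewrite /= big_flatten/= big_map big_enum. Qed.

Lemma size_leaves n s t : t \in leaves n s -> size t = (size s + n)%N.
Proof.
elim: n s => [|n IH] s /=; first by rewrite inE addn0 => /eqP->.
by move=> /flatten_mapP[x _ /IH ->]; rewrite addSnnS.
Qed.

Lemma size_nodes n s u : u \in nodes n s -> (size u < size s + n)%N.
Proof.
elim: n s => [|n IH] s //=; rewrite inE => /orP[/eqP->|]; first by rewrite addnS ltnS leq_addr.
by move=> /flatten_mapP[x _ /IH]; rewrite addSnnS.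
Qed.

(** Additivity stops at generation K because the measure of a union of leaves is only split down to
    these leaves. *)
Definition additive_below K h := forall s, (size s < K)%N -> h s = \sum_x h (x :: s).

Lemma sum_leaves_additive K h n s : additive_below K h -> (size s + n <= K)%N ->
  \sum_(t <- leaves n s) h t = h s.
Proof.
move=> hadd; elim: n s => [|n IH] s sn; first by rewrite sum_leaves0.
rewrite sum_leavesS hadd; last by apply: leq_trans sn; rewrite -addSnnS leq_addr.
by apply: eq_bigr => x _; apply: IH; rewrite addSnnS.
Qed.

Lemma sum_nodes_levels n s h :
  \sum_(t <- nodes n s) h t = \sum_(k < n) \sum_(t <- leaves k s) h t.
Proof.
elim: n s => [|n IH] s; first by rewrite big_nil big_ord0.
rewrite sum_nodesS big_ord_recl sum_leaves0; congr (_ + _).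
rewrite (eq_bigr _ (fun x _ => IH (x :: s))) exchange_big/=.
by apply: eq_bigr => k _; rewrite sum_leavesS.
Qed.

(** Passing from s to its children changes phi by at most b(s), and the values of e at the children
    add up to e(s); so every node contributes one term b e. *)
Lemma telescoping_sum K (phi b e : seq X -> R) (c : R) n s :
  (forall t x, (size t < K)%N -> `|phi (x :: t) - phi t| <= b t) ->
  additive_below K e -> (forall t, 0 <= e t) -> (size s + n <= K)%N ->
  \sum_(t <- leaves n s) `|phi t - c| * e t <=
  `|phi s - c| * e s + \sum_(t <- nodes n s) b t * e t.
Proof.
move=> phib eadd e0; elim: n s => [|n IH] s sn.
  by rewrite sum_leaves0 sum_nodes0 addr0.
have sK : (size s < K)%N by apply: leq_trans sn; rewrite -addSnnS leq_addr.
rewrite sum_leavesS sum_nodesS.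
apply: (@le_trans _ _ (\sum_x ((`|phi s - c| + b s) * e (x :: s) +
    \sum_(t <- nodes n (x :: s)) b t * e t))).
  apply: ler_sum => x _; apply: (le_trans (IH _ _)); first by rewrite /= addSnnS.
  rewrite lerD2r; apply: ler_wpM2r => //.
  have -> : phi (x :: s) - c = (phi s - c) + (phi (x :: s) - phi s) by ring.
  by rewrite (le_trans (ler_normD _ _))// lerD2l phib.
by rewrite big_split/= -mulr_sumr -eadd// mulrDl addrA.
Qed.

End trees.

(* [w], [gam] and [gn] stand for the integrals over dyadic cubes of the weight w,
   of |g|^p w and of |g|, [V] for the volume, and [e] for the w-measure of the
   trace of a fixed union of cubes of generation K. *)
Section weighted_tree.
Context {R : realType} (X : finType).
Variables (K : nat) (p N D : R) (w gam gn V e : seq X -> R).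
Hypotheses (p1 : 1 <= p) (N0 : 0 <= N) (D2 : 2 <= D).
Hypotheses (w_gt0 : forall s, 0 < w s) (w_add : forall s, w s = \sum_x w (x :: s)).
Hypotheses (gam_ge0 : forall s, 0 <= gam s) (gam_add : forall s, gam s = \sum_x gam (x :: s)).
Hypotheses (gn_ge0 : forall s, 0 <= gn s) (gn_add : forall s, gn s = \sum_x gn (x :: s)).
Hypotheses (V_gt0 : forall s, 0 < V s) (V_child : forall x s, V (x :: s) = V s / D).
Hypotheses (e_ge0 : forall s, 0 <= e s) (e_le_w : forall s, e s <= w s).
Hypotheses (e_add : additive_below K e) (e_root_gt0 : 0 < e [::]).
Hypothesis Ap_ineq : forall s (A : pred X), \sum_(x | A x) gn (x :: s) <=
  N * V s * w s `^ (- p^-1) * (\sum_(x | A x) gam (x :: s)) `^ p^-1.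

Let t := p^-1.
Let p0 : 0 < p. Proof. exact: lt_le_trans p1. Qed.
Let pn0 : p != 0. Proof. by rewrite gt_eqF. Qed.
Let t01 : 0 < t <= 1. Proof. by rewrite /t invr_gt0 p0 invf_le1. Qed.
Let t0 : 0 < t. Proof. by case/andP: t01. Qed.
Let s0 : 0 <= 1 - t. Proof. by rewrite subr_ge0; case/andP: t01. Qed.

Let y s := gn s / V s.
Let e0 := e [::].
Let gam0 := gam [::].

Lemma tree_avg_le s : y s <= N * w s `^ (- t) * gam s `^ t.
Proof.
rewrite /y ler_pdivrMr// gn_add gam_add (le_trans (Ap_ineq s xpredT))//.
by rewrite le_eqVlt; apply/orP; left; apply/eqP; ring.
Qed.

Lemma w_child_le x s : w (x :: s) <= w s.
Proof. by rewrite [leRHS]w_add (bigD1 x)//= lerDl sumr_ge0// => ? _; exact: ltW. Qed.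

Lemma e_child_le x s : (size s < K)%N -> e (x :: s) <= e s.
Proof. by move=> sK; rewrite [leRHS]e_add// (bigD1 x)//= lerDl sumr_ge0. Qed.

Lemma e_le_root s : (size s <= K)%N -> e s <= e0.
Proof.
elim: s => [|x s IH]//= sK; apply: le_trans (IH (ltnW sK)).
exact: e_child_le.
Qed.

(** Since e <= w and alpha <= t, the power w^(alpha - t) left by [tree_avg_le] is at most e^(alpha -
    t). What remains is e0^alpha times gam^t e^(1-t), which Hölder's inequality sums over the
    generation. *)
Lemma level_bound (alpha : R) (k : nat) : 0 <= alpha -> alpha <= t -> (k <= K)%N ->
  \sum_(s <- leaves k [::]) w s `^ alpha * y s * e s <=
  N * gam0 `^ t * e0 `^ (alpha + (1 - t)).
Proof.
move=> al0 alt kK.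
have gadd : additive_below K gam by move=> s _; exact: gam_add.
have main s : s \in leaves k [::] -> w s `^ alpha * y s * e s <=
    N * e0 `^ alpha * (gam s `^ t * e s `^ (1 - t)).
  move=> /size_leaves/=; rewrite add0n => sk.
  have sK : (size s <= K)%N by rewrite sk.
  have [->|es0] := eqVneq (e s) 0; first by rewrite mulr0 !mulr_ge0 ?powR_ge0.
  have es_gt0 : 0 < e s by rewrite lt0r es0 e_ge0.
  apply: (@le_trans _ _ (w s `^ alpha * (N * w s `^ (- t) * gam s `^ t) * e s)).
    by apply: ler_wpM2r => //; apply: ler_wpM2l; [exact: powR_ge0|exact: tree_avg_le].
  have -> : w s `^ alpha * (N * w s `^ (- t) * gam s `^ t) * e s =
      N * gam s `^ t * (w s `^ (alpha - t) * e s).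
    rewrite powRD; last by rewrite (gt_eqF (w_gt0 s)) implybT.
    by ring.
  have -> : N * e0 `^ alpha * (gam s `^ t * e s `^ (1 - t)) =
      N * gam s `^ t * (e0 `^ alpha * e s `^ (1 - t)) by ring.
  apply: ler_wpM2l; first by rewrite mulr_ge0// powR_ge0.
  apply: (@le_trans _ _ (e s `^ (alpha - t) * e s)).
    apply: ler_wpM2r => //; rewrite -opprB !powRN lef_pV2 ?posrE ?powR_gt0//.
    by apply: powR_le_base => //; rewrite subr_ge0.
  apply: (@le_trans _ _ (e s `^ alpha * e s `^ (1 - t))).
    rewrite -[X in _ * X]powRr1// -!powRD ?(negbTE es0) ?implybT//.
    by rewrite addrAC addrA.
  by apply: ler_wpM2r; [exact: powR_ge0|apply: powR_le_base => //; exact: e_le_root].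
rewrite big_seq; apply: (le_trans (ler_sum _ main)); rewrite -big_seq -mulr_sumr.
apply: (@le_trans _ _ (N * e0 `^ alpha * (gam0 `^ t * e0 `^ (1 - t)))).
  apply: ler_wpM2l; first by rewrite mulr_ge0// powR_ge0.
  apply: (le_trans (hoelder_sum (leaves k [::]) xpredT t01 gam_ge0 e_ge0)).
  by rewrite (sum_leaves_additive gadd)// (sum_leaves_additive e_add).
rewrite powRD; last by rewrite (gt_eqF e_root_gt0) implybT.
by rewrite le_eqVlt; apply/orP; left; apply/eqP; ring.
Qed.

(* A node has at most one child in its own weight class, so the class consists
   of chains.  [ring_avg] and [ring_gam] collect the children that leave the class:
   these parts are disjoint, and [y_rec] absorbs the rest, halving its p-th power. *)
Section weight_class.
Variables (om : R) (om0 : 0 < om).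

Definition weight_class s := [&& (size s < K)%N, om / 2 < w s & w s <= om].
Let F := weight_class.

(** Two children heavier than om/2 would together weigh more than om. *)
Let F_child_uniq s x x' : F s -> F (x :: s) -> F (x' :: s) -> x = x'.
Proof.
move=> /and3P[_ _ h] /and3P[_ h1 _] /and3P[_ h2 _]; apply/eqP; apply: contraT => xx'.
move: h; rewrite w_add (bigD1 x)//= (bigD1 x')/=; last by rewrite eq_sym.
by apply: two_halves_absurd => //; apply: sumr_ge0 => i _; exact: ltW.
Qed.

Let F_child_sum s (h : seq X -> R) : F s -> 0 < p -> (forall x, 0 <= h (x :: s)) ->
  (\sum_(x | F (x :: s)) h (x :: s)) `^ p = \sum_(x | F (x :: s)) h (x :: s) `^ p.
Proof.
move=> Fs _ h0; have [x Fx|noF] := pickP (fun x => F (x :: s)); last first.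
  by rewrite !big_pred0// powR0.
have uniqx : (fun x' => F (x' :: s)) =1 pred1 x.
  move=> x' /=; apply/idP/eqP => [Fx'|->//]; exact: F_child_uniq Fs Fx' Fx.
by rewrite !(eq_bigl _ _ uniqx) !big_pred1_eq.
Qed.

Let ring_avg s := (\sum_(x | ~~ F (x :: s)) gn (x :: s)) / V s.
Let ring_gam s := \sum_(x | ~~ F (x :: s)) gam (x :: s).

Let y_ge0 s : 0 <= y s. Proof. by rewrite /y divr_ge0// ltW. Qed.

Let ring_avg_ge0 s : 0 <= ring_avg s.
Proof. by rewrite /ring_avg divr_ge0 ?sumr_ge0// ltW. Qed.

Let y_rec s : F s -> y s `^ p <=
  2 `^ (p - 1) * ring_avg s `^ p + 2^-1 * \sum_(x | F (x :: s)) y (x :: s) `^ p.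
Proof.
move=> Fs; rewrite -F_child_sum//.
have Y0 : 0 <= \sum_(x | F (x :: s)) y (x :: s) by exact: sumr_ge0.
apply: le_trans (powR_midpoint p1 (ring_avg_ge0 s) Y0).
apply: powR_le_base; [exact: ltW|exact: y_ge0|].
have -> : y s = ring_avg s + (\sum_(x | F (x :: s)) y (x :: s)) / D.
  rewrite /y gn_add (bigID (fun x => F (x :: s)))/= addrC mulrDl; congr (_ + _).
  rewrite !mulr_suml; apply: eq_bigr => x _; rewrite V_child.
  have D0 : D != 0 by rewrite gt_eqF// (lt_le_trans _ D2).
  by field; rewrite D0 (gt_eqF (V_gt0 s)).
by rewrite lerD2l; apply: ler_wpM2l => //; rewrite lef_pV2 ?posrE// (lt_le_trans _ D2).
Qed.

Let out_of_class n s (h : seq X -> R) : w s <= om / 2 -> \sum_(u <- nodes n s | F u) h u = 0.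
Proof.
elim: n s => [|n IH] s ws; first by rewrite sum_nodes0.
rewrite sum_nodesS ifF; last by rewrite /F /weight_class [_ < w s]ltNge ws andbF.
by rewrite add0r big1// => x _; apply: IH; exact: le_trans (w_child_le x s) ws.
Qed.

Let size_lt n (s : seq X) : (size s + n.+1)%N = K -> (size s < K)%N.
Proof. by move=> <-; rewrite -addSnnS leq_addr. Qed.

(** On the right of [y_rec] the members of the class occur as children of members. The top node s is
    not a child of any node of its subtree, and the subtracted term records this so that the
    induction closes. *)
Let sum_y n s : (size s + n = K)%N -> \sum_(u <- nodes n s | F u) y u `^ p <=
  2 `^ (p - 1) * (\sum_(u <- nodes n s | F u) ring_avg u `^ p) +
  2^-1 * (\sum_(u <- nodes n s | F u) y u `^ p - (if F s then y s `^ p else 0)).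
Proof.
elim: n s => [|n IH] s sn.
  rewrite addn0 in sn; rewrite !big_nil ifF ?mulr0 ?subrr ?mulr0 ?addr0//.
  by rewrite /F /weight_class sn ltnn.
have IHx x := IH (x :: s) (etrans (addSnnS _ _) sn).
have S := ler_sum (index_enum X) (fun x (_ : true) => IHx x).
rewrite !big_split/= -!mulr_sumr sumrB in S.
have Fsum : \sum_x (if F (x :: s) then y (x :: s) `^ p else 0) =
    \sum_(x | F (x :: s)) y (x :: s) `^ p by rewrite -big_mkcond.
rewrite Fsum in S.
rewrite !sum_nodesS; case: ifP => Fs.
  exact: absorb_half (y_rec Fs) S.
rewrite !add0r subr0; apply: (le_trans S); rewrite lerD2l; apply: ler_wpM2l => //.
by rewrite gerBl sumr_ge0// => x _; exact: powR_ge0.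
Qed.

(** Once a path leaves the class its weight is at most om/2 and it never returns. The children
    collected in the rings are therefore disjoint. *)
Let sum_ring_gam n s : (size s + n = K)%N -> \sum_(u <- nodes n s | F u) ring_gam u <= gam s.
Proof.
elim: n s => [|n IH] s sn; first by rewrite sum_nodes0.
have IHx x := IH (x :: s) (etrans (addSnnS _ _) sn).
rewrite sum_nodesS; case: ifP => Fs; last first.
  by rewrite add0r gam_add; apply: ler_sum => x _; exact: IHx.
rewrite gam_add (bigID (fun x => F (x :: s)))/= [leRHS](bigID (fun x => F (x :: s)))/=.
rewrite [X in _ + (_ + X)]big1 ?addr0; last first.
  move=> x nF; case: n {IH IHx} sn => [|n] sn; first by rewrite sum_nodes0.
  apply: out_of_class; move: nF; rewrite /F /weight_class.
  have -> : (size (x :: s) < K)%N by apply: (@size_lt n); rewrite addSnnS.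
  have /and3P[_ _ h] := Fs; rewrite (le_trans (w_child_le x s) h) andbT /=.
  by rewrite -leNgt.
by rewrite addrC; apply: lerD => //; apply: ler_sum => x _; exact: IHx.
Qed.

(** Half of the sum is absorbed on the left, whence 2^p = 2 * 2^(p-1). The rings are bounded by
    [Ap_ineq], the lower bound w > om/2 and their disjointness. *)
Let class_y_power : \sum_(u <- nodes K [::] | F u) y u `^ p <=
  2 `^ p * (N `^ p * (2 / om) * gam0).
Proof.
have H := @sum_y K [::] erefl.
have Rg : \sum_(u <- nodes K [::] | F u) ring_avg u `^ p <= N `^ p * (2 / om) * gam0.
  have main u : F u -> ring_avg u `^ p <= N `^ p * (2 / om) * ring_gam u.
    move=> /and3P[_ wu _].
    have g0 : 0 <= ring_gam u by exact: sumr_ge0.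
    have a1 : ring_avg u <= N * (w u `^ (- t) * ring_gam u `^ t).
      rewrite /ring_avg ler_pdivrMr// (le_trans (Ap_ineq u (fun x => ~~ F (x :: u))))//.
      by rewrite le_eqVlt; apply/orP; left; apply/eqP; rewrite /ring_gam; ring.
    apply: (le_trans (powR_le_base (ltW p0) (ring_avg_ge0 u) a1)).
    rewrite powRM ?mulr_ge0 ?powR_ge0// -mulrA; apply: ler_wpM2l; first exact: powR_ge0.
    rewrite powRM ?powR_ge0// -!powRrM /t mulNr mulVf// powR_inv1 ?(ltW (w_gt0 u))// powRr1//.
    apply: ler_wpM2r => //; rewrite -[leRHS]invrK invf_div lef_pV2 ?posrE ?divr_gt0//.
    exact: ltW.
  apply: (le_trans (ler_sum _ main)); rewrite -mulr_sumr; apply: ler_wpM2l.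
    by rewrite mulr_ge0 ?powR_ge0// divr_ge0// ltW.
  exact: (@sum_ring_gam K [::] erefl).
have e2 : 2 `^ p = 2 * 2 `^ (p - 1) :> R by rewrite mulr_powRB1.
have f0 : 0 <= (if F [::] then y [::] `^ p else 0) by case: ifP => // _; exact: powR_ge0.
have k0 : 0 <= 2 `^ (p - 1) :> R by exact: powR_ge0.
rewrite e2 -mulrA -ler_pdivrMl//.
apply: le_trans (ler_wpM2l k0 Rg).
exact: absorb_half_end f0 H.
Qed.

(** One factor e^t is replaced by min(om, e0)^t, a bound valid in the class; the other factors y and
    e^(1-t) are summed by Hölder's inequality. The 4 bounds 2 * 2^t. *)
Lemma class_sum (kap : R) : 0 <= kap ->
  \sum_(u <- nodes K [::] | F u) e u <= kap * e0 ->
  \sum_(u <- nodes K [::] | F u) y u * e u <=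
  4 * N * kap `^ (1 - t) * gam0 `^ t * e0 `^ (1 - t) * (Num.min om e0 / om) `^ t.
Proof.
move=> kap0 hkap; pose m := Num.min om e0.
have m0 : 0 <= m by rewrite le_min (ltW om0) (ltW e_root_gt0).
have main u : F u -> y u * e u <= m `^ t * ((y u `^ p) `^ t * e u `^ (1 - t)).
  move=> /and3P[su _ wu]; rewrite /t powRK// mulrCA; apply: ler_wpM2l => //.
  have eum : e u <= m by rewrite le_min (le_trans (e_le_w u) wu) e_le_root// ltnW.
  have [->|eu0] := eqVneq (e u) 0; first by rewrite mulr_ge0// powR_ge0.
  rewrite -[leLHS]powRr1// -[X in e u `^ X](subrKC p^-1 1) addrC.
  rewrite (_ : 1 - p^-1 + p^-1 = p^-1 + (1 - p^-1)); last by rewrite addrC.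
  rewrite powRD; last by rewrite eu0 implybT.
  by apply: ler_wpM2r; [exact: powR_ge0|apply: powR_le_base => //; exact: ltW].
apply: (le_trans (ler_sum _ main)); rewrite -mulr_sumr.
have := hoelder_sum (nodes K [::]) F t01 (fun u => powR_ge0 (y u) p) e_ge0.
move=> /(ler_wpM2l (powR_ge0 m t)) /le_trans; apply.
have om20 : 0 <= 2 / om by rewrite divr_ge0// ltW.
have h1 : (\sum_(u <- nodes K [::] | F u) y u `^ p) `^ t <=
    4 * N * gam0 `^ t * om^-1 `^ t.
  apply: (@le_trans _ _ ((2 `^ p * (N `^ p * (2 / om) * gam0)) `^ t)).
    apply: powR_le_base; [exact: ltW|by apply: sumr_ge0 => u _; exact: powR_ge0|].
    exact: class_y_power.
  have omi : 0 <= om^-1 by rewrite invr_ge0 ltW.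
  have b1 : 0 <= N `^ p by exact: powR_ge0.
  have b2 : 0 <= N `^ p * (2 / om) by exact: mulr_ge0.
  rewrite (powRM t (powR_ge0 2 p) (mulr_ge0 b2 (gam_ge0 _))) (powRM t b2 (gam_ge0 _)).
  rewrite (powRM t b1 om20) (powRM t (ler0n _ 2) omi) /t !powRK//.
  apply: four_bound; last by rewrite !mulr_ge0 ?powR_ge0.
  by rewrite -[leRHS]powRr1//; apply: ler_powR; rewrite ?ler1n// invf_le1.
have h2 : (\sum_(u <- nodes K [::] | F u) e u) `^ (1 - t) <= kap `^ (1 - t) * e0 `^ (1 - t).
  rewrite -powRM ?(ltW e_root_gt0)//; apply: powR_le_base => //; exact: sumr_ge0.
apply: (@le_trans _ _ (m `^ t * ((4 * N * gam0 `^ t * om^-1 `^ t) * (kap `^ (1 - t) * e0 `^ (1 - t))))).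
  by apply: ler_wpM2l; [exact: powR_ge0|apply: ler_pM => //; exact: powR_ge0].
have omi : 0 <= om^-1 by rewrite invr_ge0 ltW.
by rewrite (powRM t m0 omi) le_eqVlt; apply/orP; left; apply/eqP; ring.
Qed.

End weight_class.

(** The first class member on a path weighs at most om, so by hypothesis the weights below it on the
    path add up to at most W om. As each member weighs more than om/2, a leaf has at most 2W members
    above it. *)
Lemma class_e_sum (om W : R) : 0 < om -> (forall v s, path_sum w v s <= W * w s) ->
  \sum_(u <- nodes K [::] | weight_class om u) e u <= 2 * W * e0.
Proof.
move=> om0 HW; pose h s := if weight_class om s then w s else 0.
have h0 s : 0 <= h s by rewrite /h; case: ifP => // _; exact: ltW.
have hw s : h s <= w s by rewrite /h; case: ifP => // _; exact: ltW.
have ps_le v : forall s, path_sum h v s <= path_sum w v s.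
  elim: v => [|x v IH] s /=; first by rewrite !addr0.
  exact: lerD.
have W0 : 0 <= W.
  have := HW [::] [::]; rewrite /= addr0 => H.
  by rewrite -(ler_pM2r (w_gt0 [::])) mul0r (le_trans (ltW (w_gt0 _)) H).
have B0 : 0 <= W * om by rewrite mulr_ge0// ltW.
have ps_bound v : forall s, path_sum h v s <= W * om.
  have inF s v' : weight_class om s -> path_sum h v' s <= W * om.
    move=> /and3P[_ _ ws]; apply: (le_trans (ps_le v' s)); apply: (le_trans (HW v' s)).
    exact: ler_wpM2l.
  elim: v => [|x v IH] s; case: (boolP (weight_class om s)) => Fs; try exact: inF.
    by rewrite /= /h (negbTE Fs) addr0.
  by rewrite /= {1}/h (negbTE Fs) add0r.
(* Here c bounds the sums of h along all paths from s; the children inherit the bound c - h(s), and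
   e(s) splits among them. *)
have main n : forall s c, (size s + n = K)%N -> (forall v, path_sum h v s <= c) ->
    \sum_(u <- nodes n s) h u * e u <= c * e s.
  elim: n => [|n IH] s c sn hc.
    rewrite big_nil mulr_ge0//; apply: le_trans (hc [::]); by rewrite /= addr0.
  have sK : (size s < K)%N by rewrite -sn -addSnnS leq_addr.
  rewrite sum_nodesS; apply: (@le_trans _ _ (h s * e s + \sum_x (c - h s) * e (x :: s))).
    rewrite lerD2l; apply: ler_sum => x _; apply: IH; first by rewrite addSnnS.
    by move=> v; rewrite lerBrDl; exact: (hc (x :: v)).
  by rewrite -mulr_sumr -e_add// -mulrDl addrCA subrr addr0.
have := main K [::] (W * om) erefl (fun v => ps_bound v [::]).
have -> : \sum_(u <- nodes K [::]) h u * e u = \sum_(u <- nodes K [::] | weight_class om u) w u * e u.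
  by rewrite [RHS]big_mkcond; apply: eq_bigr => u _; rewrite /h; case: ifP => // _; rewrite mul0r.
move=> H; have om2 : 0 < om / 2 by rewrite divr_gt0.
rewrite -(ler_pM2l om2); apply: (@le_trans _ _ (W * om * e0)); last first.
  by rewrite le_eqVlt; apply/orP; left; apply/eqP; field.
apply: le_trans H; rewrite mulr_sumr; apply: ler_sum => u /and3P[_ /ltW wu _].
exact: ler_wpM2r.
Qed.

(* The sum over the scales [om] of the weight classes is geometric: the factor
   [w u `^ alpha] gains below [e0], and [e u <= e0] in place of [e u <= om] gains
   above [e0]. *)
Lemma tree_bound (alpha W : R) : 0 < alpha -> alpha < t ->
  (forall v s, path_sum w v s <= W * w s) ->
  \sum_(u <- nodes K [::]) w u `^ alpha * y u * e u <=
  4 * ((1 - 2 `^ (- alpha))^-1 + (1 - 2 `^ (- (t - alpha)))^-1) *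
  N * (2 * W) `^ (1 - t) * gam0 `^ t * e0 `^ (alpha + (1 - t)).
Proof.
move=> al0 alt HW; pose r := t - alpha; have r0 : 0 < r by rewrite subr_gt0.
have W0 : 0 <= W.
  have := HW [::] [::]; rewrite /= addr0 => H.
  by rewrite -(ler_pM2r (w_gt0 [::])) mul0r (le_trans (ltW (w_gt0 _)) H).
pose A := 4 * N * (2 * W) `^ (1 - t) * gam0 `^ t * e0 `^ (1 - t).
have A0 : 0 <= A by rewrite !mulr_ge0 ?powR_ge0.
pose h u := w u `^ alpha * y u * e u.
have h0 u : 0 <= h u by rewrite !mulr_ge0 ?powR_ge0// invr_ge0 ltW.
have p2 n : 0 < 2 ^+ n :> R by rewrite exprn_gt0.
have lt1 (b : R) : 0 < b -> 2 `^ (- b) < 1 :> R.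
  move=> b0; rewrite powRN invf_lt1 ?powR_gt0//.
  by have := @gt0_ltr_powR _ b b0 1 2; rewrite powR1; apply; rewrite ?nnegrE// ltr1n.
have cls om : 0 < om -> \sum_(u <- nodes K [::] | weight_class om u) h u <=
    om `^ alpha * (A * (Num.min om e0 / om) `^ t).
  move=> om0; have W20 : 0 <= 2 * W by rewrite mulr_ge0.
  have := class_sum om0 W20 (class_e_sum om0 HW); rewrite -/A => H.
  apply: le_trans (ler_wpM2l (powR_ge0 om alpha) H); rewrite mulr_sumr.
  apply: ler_sum => u /and3P[_ _ wu]; rewrite /h -mulrA; apply: ler_wpM2r.
    by rewrite mulr_ge0// divr_ge0// ltW.
  by apply: powR_le_base => //; exact: ltW.
have below n : \sum_(u <- nodes K [::] | weight_class (e0 / 2 ^+ n) u) h u <=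
    A * e0 `^ alpha * (2 `^ (- alpha)) ^+ n.
  have om0 : 0 < e0 / 2 ^+ n by rewrite divr_gt0.
  apply: (le_trans (cls _ om0)).
  have -> : Num.min (e0 / 2 ^+ n) e0 = e0 / 2 ^+ n.
    by apply: min_l; rewrite ler_pdivrMr// ler_peMr ?exprn_ege1 ?ler1n// ltW.
  rewrite mulfV ?gt_eqF// powR1 mulr1 (powRM _ (ltW e_root_gt0)) ?invr_ge0 ?(ltW (p2 n))//.
  by rewrite powR_exp2V le_eqVlt; apply/orP; left; apply/eqP; ring.
have above n : \sum_(u <- nodes K [::] | weight_class (2 ^+ n.+1 * e0) u) h u <=
    A * e0 `^ alpha * (2 `^ (- r)) ^+ n.
  have om0 : 0 < 2 ^+ n.+1 * e0 by rewrite mulr_gt0.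
  apply: (le_trans (cls _ om0)).
  have -> : Num.min (2 ^+ n.+1 * e0) e0 = e0.
    by apply: min_r; rewrite ler_peMl ?exprn_ege1 ?ler1n// ltW.
  have q0 : 0 <= 2 ^+ n.+1 :> R by exact: ltW.
  have -> : e0 / (2 ^+ n.+1 * e0) = 2 ^- n.+1.
    by rewrite invfM mulrCA mulfV ?mulr1// gt_eqF.
  rewrite (powRM _ q0 (ltW e_root_gt0)).
  have -> : (2 ^+ n.+1) `^ alpha * e0 `^ alpha * (A * (2 ^+ n.+1)^-1 `^ t) =
      A * e0 `^ alpha * ((2 ^+ n.+1) `^ alpha * (2 ^+ n.+1)^-1 `^ t) by ring.
  apply: ler_wpM2l; first by rewrite mulr_ge0// powR_ge0.
  rewrite powR_exp2V powR_exp2 -exprMn -powRD; last by rewrite pnatr_eq0 implybT.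
  have -> : alpha + - t = - r by rewrite /r opprB addrC.
  by rewrite exprS; apply: ler_piMl; [exact/exprn_ge0/powR_ge0|exact/ltW/lt1].
(* The tree is finite, so finitely many scales are met: e0 / 2^n for weights up to e0, and 2^(n+1)
   e0 above. *)
have [M HM] : exists M : nat, forall u, u \in nodes K [::] -> exists2 n : nat, (n < M)%N &
    weight_class (e0 / 2 ^+ n) u || weight_class (2 ^+ n.+1 * e0) u.
  have H u : u \in nodes K [::] -> exists n : nat,
      weight_class (e0 / 2 ^+ n) u || weight_class (2 ^+ n.+1 * e0) u.
    move=> /size_nodes; rewrite add0n => uK; case: (leP (w u) e0) => we.
      have [n [h1 h2]] := dyadic_scale_below (w_gt0 u) we.
      by exists n; rewrite /weight_class uK h1 h2.
    have [n [h1 h2]] := dyadic_scale_above e_root_gt0 we.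
    exists n; rewrite [X in _ || X]/weight_class uK h2 exprSr mulrAC mulfK ?pnatr_eq0// h1.
    by rewrite orbT.
  elim: (nodes K [::]) H => [|u l IH] H; first by exists 0%N.
  have [|M HM] := IH; first by move=> v vl; apply: H; rewrite inE vl orbT.
  have [n hn] := H u (mem_head _ _); exists (maxn M n.+1) => v; rewrite inE => /orP[/eqP->|/HM[k kM hk]].
    by exists n => //; rewrite leq_max ltnSn orbT.
  by exists k => //; rewrite leq_max kM.
apply: (@le_trans _ _ (\sum_(n < M) ((\sum_(u <- nodes K [::] | weight_class (e0 / 2 ^+ n) u) h u) +
    \sum_(u <- nodes K [::] | weight_class (2 ^+ n.+1 * e0) u) h u))).
  rewrite [leRHS](eq_bigr (fun n : 'I_M => \sum_(u <- nodes K [::])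
      ((if weight_class (e0 / 2 ^+ n) u then h u else 0) +
       (if weight_class (2 ^+ n.+1 * e0) u then h u else 0)))); last first.
    by move=> n _; rewrite big_split/= -!big_mkcond.
  rewrite exchange_big/= big_seq [leRHS]big_seq; apply: ler_sum => u /HM[n nM hn].
  rewrite (bigD1 (Ordinal nM))//=; apply: (@le_trans _ _ (h u + 0)); first by rewrite addr0.
  apply: lerD; last first.
    by apply: sumr_ge0 => k _; rewrite addr_ge0//; case: ifP.
  by case/orP: hn => ->; [rewrite lerDl; case: ifP|rewrite lerDr; case: ifP].
apply: (@le_trans _ _ (\sum_(n < M) (A * e0 `^ alpha * (2 `^ (- alpha)) ^+ n +
    A * e0 `^ alpha * (2 `^ (- r)) ^+ n))).
  by apply: ler_sum => n _; exact: lerD.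
rewrite big_split/= -!mulr_sumr -mulrDr.
have e3 : e0 `^ (alpha + (1 - t)) = e0 `^ alpha * e0 `^ (1 - t).
  by rewrite powRD// (gt_eqF e_root_gt0) implybT.
apply: (@le_trans _ _ (A * e0 `^ alpha * ((1 - 2 `^ (- alpha))^-1 + (1 - 2 `^ (- r))^-1))).
  apply: ler_wpM2l; first by rewrite mulr_ge0// powR_ge0.
  by apply: lerD; apply: geometric_sum_le; rewrite ?powR_ge0// lt1.
by rewrite e3 /A le_eqVlt; apply/orP; left; apply/eqP; ring.
Qed.

Lemma tree_bound_levels (alpha rho : R) : 0 <= alpha -> alpha <= t -> 0 <= rho -> rho < 1 ->
  \sum_(u <- nodes K [::]) rho ^+ size u * (w u `^ alpha * y u * e u) <=
  (1 - rho)^-1 * (N * gam0 `^ t * e0 `^ (alpha + (1 - t))).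
Proof.
move=> al0 alt r0 r1; rewrite sum_nodes_levels.
have B0 : 0 <= N * gam0 `^ t * e0 `^ (alpha + (1 - t)) by rewrite !mulr_ge0 ?powR_ge0.
apply: le_trans (ler_wpM2r B0 (geometric_sum_le K r0 r1)); rewrite mulr_suml.
apply: ler_sum => k _; rewrite big_seq.
rewrite (eq_bigr (fun u => rho ^+ k * (w u `^ alpha * y u * e u))); last first.
  by move=> u /size_leaves ->; rewrite add0n.
rewrite -big_seq -mulr_sumr; apply: ler_wpM2l; first exact: exprn_ge0.
by apply: level_bound => //; rewrite ltnW.
Qed.

End weighted_tree.

(** The hypothesis on e is used for the w-measure of the trace of the exceptional leaves.
    Telescoping gives T e(root) <= B e(root)^(1-r), and the power is divided out when e(root) >
    0. *)
Lemma tree_weak_type (R : realType) (X : finType) (K : nat) (w b phi : seq X -> R) (r B T : R) :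
  (forall s, 0 < w s) -> (forall s, w s = \sum_x w (x :: s)) ->
  (forall s x, (size s < K)%N -> `|phi (x :: s) - phi s| <= b s) ->
  0 < r <= 1 -> 0 <= B ->
  (forall e : seq X -> R, (forall s, 0 <= e s) -> (forall s, e s <= w s) ->
     additive_below K e -> 0 < e [::] ->
     \sum_(u <- nodes K [::]) b u * e u <= B * e [::] `^ (1 - r)) ->
  0 <= T ->
  T * (\sum_(s <- leaves K [::] | T < `|phi s - phi [::]|) w s) `^ r <= B.
Proof.
move=> w_gt0 w_add phib /andP[r0 r1] B0 H T0.
pose h s := if T < `|phi s - phi [::]| then w s else 0.
pose e s := \sum_(u <- leaves (K - size s) s) h u.
have h0 s : 0 <= h s by rewrite /h; case: ifP => // _; exact: ltW.
have e0 s : 0 <= e s by exact: sumr_ge0.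
have eadd : additive_below K e.
  move=> s sK; rewrite /e -(subnSK sK) sum_leavesS.
  by apply: eq_bigr => x _.
have ew s : e s <= w s.
  have ladd n : forall u, \sum_(v <- leaves n u) w v = w u.
    elim: n => [|n IH] u; first by rewrite sum_leaves0.
    by rewrite sum_leavesS w_add; apply: eq_bigr => x _.
  rewrite -(ladd (K - size s)%N s); apply: ler_sum => u _.
  by rewrite /h; case: ifP => // _; exact: ltW.
have -> : \sum_(s <- leaves K [::] | T < `|phi s - phi [::]|) w s = e [::].
  by rewrite /e /= subn0 big_mkcond.
have [->|e00] := eqVneq (e [::]) 0; first by rewrite powR0 ?mulr0// gt_eqF.
have e_gt0 : 0 < e [::] by rewrite lt0r e00 e0.
have tele := @telescoping_sum R X K phi b e (phi [::]) K [::] (fun s x => phib s x) eadd e0 (leqnn _).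
have low : T * e [::] <= \sum_(u <- leaves K [::]) `|phi u - phi [::]| * e u.
  rewrite {1}/e subn0 mulr_sumr big_seq [leRHS]big_seq; apply: ler_sum => u /size_leaves.
  rewrite add0n => uK; rewrite /e uK subnn sum_leaves0 /h; case: ifP => hT; last by rewrite !mulr0.
  by apply: ler_wpM2r; exact: ltW.
have up := H e e0 ew eadd e_gt0.
rewrite subrr normr0 mul0r add0r in tele.
have main := le_trans (le_trans low tele) up.
have E : e [::] = e [::] `^ r * e [::] `^ (1 - r).
  by rewrite -powRD ?(negbTE e00) ?implybT// addrCA subrr addr0 powRr1.
have pE : 0 < e [::] `^ (1 - r) by exact: powR_gt0.
by rewrite -(ler_pM2r pE) -mulrA -E.
Qed.

(** * Hoelder inequality and A_p weights *)

Section hoelder.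
Context {dT : measure_display} {T : measurableType dT} {R : realType}.
Variable mu : {measure set T -> \bar R}.
Local Notation itg D f := (mu.-integrable D (EFin \o f)).

Lemma itg_interpolation (D : set T) (a b : T -> R) (r : R) : measurable D ->
  (forall x, 0 <= a x) -> (forall x, 0 <= b x) -> 0 < r -> r <= 1 -> itg D a -> itg D b ->
  itg D (fun x => a x `^ r * b x `^ (1 - r)).
Proof.
move=> mD a0 b0 r0 r1 ai bi; apply: (@itg_le _ _ _ _ _ _ (fun x => a x + b x)) => //; last exact: itgD.
  by apply: measurable_funM; apply: (measurableT_comp (measurable_powR _)); [exact: itg_mfun ai|exact: itg_mfun bi].
move=> x _; rewrite ger0_norm ?mulr_ge0 ?powR_ge0//.
have a0' := a0 x; have b0' := b0 x.
apply: (@le_trans _ _ ((a x + b x) `^ r * (a x + b x) `^ (1 - r))).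
  by apply: ler_pM; rewrite ?powR_ge0// ge0_ler_powR ?nnegrE ?subr_ge0 ?addr_ge0 ?lerDl ?lerDr// ltW.
have := addr_ge0 a0' b0'; rewrite le_eqVlt => /predU1P[<-|ab]; first by rewrite powR0 ?mul0r// gt_eqF.
by rewrite -powRD ?(gt_eqF ab) ?implybT// subrKC powRr1 ?lexx// ltW.
Qed.

Lemma Rint_hoelder (D : set T) (a b : T -> R) (r : R) : measurable D ->
  (forall x, 0 <= a x) -> (forall x, 0 <= b x) -> 0 < r -> r <= 1 -> itg D a -> itg D b ->
  \int[mu]_(x in D) (a x `^ r * b x `^ (1 - r)) <=
  (\int[mu]_(x in D) a x) `^ r * (\int[mu]_(x in D) b x) `^ (1 - r).
Proof.
move=> mD a0 b0 r0; rewrite le_eqVlt => /predU1P[->|r1] ai bi.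
  rewrite subrr powRr0 mulr1 powRr1 ?Rintegral_ge0//.
  apply: Rint_mono => //; first by have := itg_interpolation mD a0 b0 ltr01 (lexx _) ai bi; rewrite subrr.
  by move=> x _; rewrite powRr0 mulr1 powRr1.
have s0 : 0 < 1 - r by rewrite subr_gt0.
have key (c : T -> R) (s : R) : 0 < s -> (forall x, 0 <= c x) -> itg D c ->
   measurable_fun setT ((fun x => c x `^ s) \_ D) /\
   'N[mu]_(s^-1)%:E[EFin \o (fun x => (c x `^ s)%R) \_ D]%E = ((\int[mu]_(x in D) c x) `^ s)%:E.
  move=> s_gt0 c0 ci; split.
    by apply/(measurable_restrictT _ mD); apply: (measurableT_comp (measurable_powR _)); exact: itg_mfun ci.
  rewrite unlock invrK -poweR_EFin -Rint_EFin//; congr (_ `^ _)%E.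
  rewrite [RHS]integral_mkcond; apply: eq_integral => x _ /=.
  rewrite !patchE; case: ifPn => _ /=.
    by rewrite ger0_norm ?powR_ge0// -powRrM mulfV ?gt_eqF// powRr1.
  by rewrite normr0 powR0// invr_eq0 gt_eqF.
have [ma Na] := key a r r0 a0 ai; have [mb Nb] := key b _ s0 b0 bi.
have := hoelder mu ma mb; move/(_ r^-1 (1 - r)^-1).
rewrite !invr_gt0 !invrK => /(_ r0 s0 (subrKC _ _)); rewrite Na Nb -EFinM.
rewrite -lee_fin -Rint_EFin//; last exact: itg_interpolation (ltW r1) ai bi.
apply: le_trans; rewrite Lnorm1 integral_mkcond; apply: ge0_le_integral => //=.
- by move=> x _; rewrite patchE; case: ifP => //; rewrite lee_fin mulr_ge0 ?powR_ge0.
- apply/(measurable_restrictT _ mD)/measurable_EFinP; apply: itg_mfun.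
  exact: itg_interpolation (ltW r1) ai bi.
- have := measurableT_comp (@normr_measurable R setT) (measurable_funM ma mb).
  by move/measurable_EFinP.
- move=> x _; rewrite !patchE; case: ifP => _; first by rewrite lee_fin ler_norm.
  by rewrite lee_fin.
Qed.

Lemma ae_imp (A B : T -> Prop) : {ae mu, forall x, A x} -> (forall x, A x -> B x) ->
  {ae mu, forall x, B x}.
Proof. by move=> hA AB; apply: filterS hA. Qed.

Lemma Rint_le_ae (D : set T) (f g : T -> R) : measurable D -> measurable_fun D f -> itg D g ->
  (forall x, 0 <= f x) -> (forall x, 0 <= g x) -> {ae mu, forall x, D x -> f x <= g x} ->
  itg D f /\ \int[mu]_(x in D) f x <= \int[mu]_(x in D) g x.
Proof.
move=> mD mf gi f0 g0 fg.
(* Replacing f by min(f, g) changes it on a null set only and makes the bound by g hold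
   everywhere. *)
have mk : measurable_fun D (fun x => Num.min (f x) (g x)).
  exact: measurable_minr mf (itg_mfun gi).
have kg x : D x -> `|Num.min (f x) (g x)| <= g x.
  by move=> _; rewrite ger0_norm ?ge_min ?lexx ?orbT// le_min f0 g0.
have ki := itg_le mD mk kg gi.
have ek : (\int[mu]_(x in D) (f x)%:E = \int[mu]_(x in D) (Num.min (f x) (g x))%:E)%E.
  apply: ae_eq_integral => //; [exact/measurable_EFinP|exact/measurable_EFinP|].
  by apply: filterS fg => x + Dx => /(_ Dx) h; rewrite min_l.
have fi : itg D f.
  apply/integrableP; split; first exact/measurable_EFinP.
  rewrite (_ : (fun x => _) = EFin \o f); last by apply/funext => x /=; rewrite ger0_norm.
  by rewrite ek Rint_EFin// ltry.
split=> //; rewrite [leLHS]/Rintegral ek Rint_EFin//=.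
by apply: Rint_mono => // x Dx; rewrite ge_min lexx orbT.
Qed.

Lemma Rint_gt0 (D : set T) (f : T -> R) : measurable D -> mu D != 0%E ->
  (forall x, D x -> 0 < f x) -> itg D f -> 0 < \int[mu]_(x in D) f x.
Proof.
move=> mD D0 f0 fi; rewrite lt_neqAle Rintegral_ge0 ?andbT; last by move=> x /f0/ltW.
apply/negP => /eqP If; have := ae_eq_integral_abs mu mD (measurable_int _ fi) => -[+ _].
have -> : (\int[mu]_(x in D) `|(EFin \o f) x| = 0)%E.
  rewrite -[RHS]/(0%:E) If -Rint_EFin//; apply: eq_integral => x /set_mem Dx /=.
  by rewrite ger0_norm// ltW ?f0.
move=> /(_ erefl)[N [mN N0 DN]]; case/negP: D0; apply/eqP.
apply: (subset_measure0 mD mN _ N0) => x Dx; apply: DN => /(_ Dx) /= [] fx.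
by have := f0 _ Dx; rewrite fx ltxx.
Qed.
End hoelder.

(** * Consequences of the A_p condition on cubes *)

Section ap_weights.
Context {R : realType} {d : nat}.
Local Notation mu := (leb R d).
Local Notation Rd := (caratheodory_type (borel_lebesgue R d)^*%mu).
Local Notation itg D f := (mu.-integrable D (EFin \o f)).
Implicit Types (w : Rd -> R) (a : 'rV[R]_d) (l p : R).

Lemma cube_neq0 a l : 0 < l -> mu (cube a l) != 0%E.
Proof. by move=> l0; rewrite [X in X != _](leb_cube _ (ltW l0)) eqe expf_neq0 ?gt_eqF. Qed.

Lemma lmeasurable_sub (D : set Rd) w : weight w -> measurable D -> measurable_fun D w.
Proof. by move=> [mw _] mD; apply: (measurable_funS _ _ mw). Qed.

Lemma pavgE (r : R) a l (f : Rd -> R) : 0 < l ->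
  pavg r%:E (cube a l) f = ((((l ^+ d)^-1)%R%:E * \int[mu]_(x in cube a l) (`|f x| `^ r)%:E) `^ r^-1)%E.
Proof. by move=> l0; rewrite /pavg (leb_cube _ (ltW l0)) inver expf_eq0 (gt_eqF l0) andbF. Qed.

Lemma pavg_EFin (r : R) a l (f : Rd -> R) : 0 < l -> itg (cube a l) (fun x => `|f x| `^ r) ->
  pavg r%:E (cube a l) f = (((l ^+ d)^-1 * \int[mu]_(x in cube a l) (`|f x| `^ r)) `^ r^-1)%:E.
Proof. by move=> l0 fi; rewrite (pavgE _ _ _ l0) (Rint_EFin (cube_measurable a l) fi). Qed.

Lemma pavg_itg (r : R) a l (f : Rd -> R) : 0 < l -> 0 < r -> lmeasurable_fun (cube a l) f ->
  (pavg r%:E (cube a l) f < +oo)%E ->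
  itg (cube a l) (fun x => `|f x| `^ r) /\
  pavg r%:E (cube a l) f = (((l ^+ d)^-1 * \int[mu]_(x in cube a l) (`|f x| `^ r)) `^ r^-1)%:E.
Proof.
move=> l0 r0 mf.
have mfr : measurable_fun (cube a l : set Rd) (fun x : Rd => `|f x| `^ r).
  by apply: (measurableT_comp (measurable_powR _)); apply: (measurableT_comp (@normr_measurable R setT)).
have c0 : 0 < (l ^+ d)^-1 by rewrite invr_gt0 exprn_gt0.
have I0 : (0 <= \int[mu]_(x in cube a l) (`|f x| `^ r)%:E)%E.
  by apply: integral_ge0 => x _; rewrite lee_fin powR_ge0.
move=> Ioo; suff fi : itg (cube a l : set Rd) (fun x => `|f x| `^ r).
  by split; last exact: pavg_EFin.
move: Ioo; rewrite (pavgE _ _ _ l0) => Ioo.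
apply/integrableP; split; first exact/measurable_EFinP.
under eq_integral do rewrite /= ger0_norm ?powR_ge0//.
move: I0 Ioo; case: (integral _ _ _) => [s _ _|_|//]; first exact: ltry.
by rewrite gt0_muley ?lte_fin// poweRyr ?invr_neq0 ?gt_eqF.
Qed.

Lemma pavg_gt0 (r : R) a l (f : Rd -> R) : 0 < l -> 0 < r -> lmeasurable_fun (cube a l) f ->
  (forall x, 0 < f x) -> (0 < pavg r%:E (cube a l) f)%E.
Proof.
move=> l0 r0 mf f0; rewrite ltNge; apply/negP => h.
have [|fi ] := pavg_itg l0 r0 mf; first exact: (le_lt_trans h).
move=> E; move: h; rewrite E lee_fin => h.
suff: 0 < ((l ^+ d)^-1 * \int[mu]_(x in cube a l) (`|f x| `^ r)) `^ r^-1 by rewrite ltNge h.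
apply: powR_gt0; rewrite mulr_gt0 ?invr_gt0 ?exprn_gt0//.
apply: Rint_gt0 fi; [exact: cube_measurable|exact: cube_neq0|].
by move=> x _; rewrite powR_gt0 ?normr_gt0 ?gt_eqF.
Qed.

(** The essential supremum norm has a default value on a space of measure zero; the cube shows that
    this case does not occur. *)
Lemma cube_ess_sup a l w : 0 < l ->
  pavg +oo%E (cube a l) w = ess_sup mu (abse \o ((EFin \o w) \_ (cube a l))).
Proof.
move=> l0; rewrite /pavg unlock; case: ifPn => //; rewrite -leNgt => h.
have := le_measure mu; move=> /(_ (cube a l) setT).
have := cube_neq0 a l0; rewrite -measure_gt0 => c0.
move=> /(_ (mem_set (cube_measurable a l)) (mem_set measurableT) (@subsetT _ _)).
by move=> /(lt_le_trans c0); rewrite ltNge h.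
Qed.

Lemma ess_sup_dual a l w : weight w -> 0 < l ->
  (0 < pavg +oo%E (cube a l) (fun x => (w x)^-1)%R)%E /\
  \forall x \ae mu, cube a l x -> ((w x)^-1%:E <= pavg +oo%E (cube a l) (fun x => (w x)^-1)%R)%E.
Proof.
move=> [mw w0] l0; rewrite cube_ess_sup//.
have H := ess_sup_ge mu (abse \o (EFin \o (fun x => (w x)^-1)) \_ (cube a l)).
set X := ess_sup _ _ in H *.
have {}H : \forall x \ae mu, cube a l x -> ((w x)^-1%:E <= X)%E.
  apply: filterS H => x /= + Px; rewrite patchE mem_set//=.
  by rewrite ger0_norm// invr_ge0 ltW.
split=> //; rewrite ltNge; apply/negP => X0.
case: H => N [mN N0 PN]; have /negP := cube_neq0 a l0; apply; apply/eqP.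
apply: (subset_measure0 (cube_measurable a l) mN _ N0) => x Px; apply: PN => /(_ Px) /le_trans /(_ X0).
by rewrite lee_fin leNgt invr_gt0 w0.
Qed.

Lemma dual_pavg_gt0 p a l w : 1 <= p -> weight w -> 0 < l ->
  (0 < pavg ((p - 1)%:E^-1) (cube a l) (fun x => (w x)^-1)%R)%E.
Proof.
move=> p1 ww l0; rewrite inver; case: ifPn => [_|pn]; first by have [] := ess_sup_dual a ww l0.
have p10 : 0 < p - 1 by rewrite lt_neqAle eq_sym pn subr_ge0.
apply: pavg_gt0 => //; first by rewrite invr_gt0.
  rewrite (_ : (fun x => _) = fun x => w x `^ (-1)).
    by apply: (measurableT_comp (measurable_powR _)); apply: lmeasurable_sub => //; exact: cube_measurable.
  by apply/funext => x; rewrite powR_inv1// ltW// ww.2.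
by move=> x; rewrite invr_gt0 ww.2.
Qed.

(** A finite product of two positive extended reals has finite factors. This is why the dual average
    is shown to be positive beforehand. *)
Lemma Ap_cube p a l w : 1 <= p -> weight w -> (Ap_const p w < +oo)%E -> 0 < l ->
  itg (cube a l) w /\ exists X : R, [/\
    pavg ((p - 1)%:E^-1) (cube a l) (fun x => (w x)^-1)%R = X%:E, 0 < X &
    (l ^+ d)^-1 * (\int[mu]_(x in cube a l) w x) * X <= fine (Ap_const p w)].
Proof.
move=> p1 ww Aoo l0; have [mw w0] := ww.
have mwP : lmeasurable_fun (cube a l) w by apply: lmeasurable_sub => //; exact: cube_measurable.
have Y0 := dual_pavg_gt0 a p1 ww l0.
have X0 : (0 < pavg 1 (cube a l) w)%E by exact: pavg_gt0.
have AP : (pavg 1 (cube a l) w * pavg ((p - 1)%:E^-1) (cube a l) (fun x => (w x)^-1)%R <= Ap_const p w)%E.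
  by apply: ereal_sup_ubound; exists (cube a l) => //; exists a, l.
have Poo := le_lt_trans AP Aoo.
have Xoo : (pavg 1 (cube a l) w < +oo)%E.
  by rewrite ltey; apply/eqP => E; move: Poo; rewrite E gt0_mulye.
have [wi E] := pavg_itg l0 ltr01 mwP Xoo.
have E1 : (fun x => `|w x| `^ 1) = w by apply/funext => x; rewrite gtr0_norm// powRr1 ?ltW.
rewrite E1 in wi.
have eI : \int[mu]_(x in cube a l) (`|w x| `^ 1) = \int[mu]_(x in cube a l) w x.
  by congr Rintegral.
rewrite eI invr1 powRr1 in E; last first.
  apply: mulr_ge0; first by rewrite invr_ge0 exprn_ge0 ?ltW.
  by apply: Rintegral_ge0 => x _; exact: ltW.
split=> //; move: Y0 AP Poo; case: (pavg _ _ _) => [X|_|//]; last by rewrite gt0_muley.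
rewrite lte_fin => X0' AP _; exists X; split=> //.
rewrite -lee_fin EFinM -E fineK// ge0_fin_numE//.
by apply: le_trans AP; rewrite mule_ge0 ?ltW.
Qed.

Lemma cube_weight_gt0 a l w : weight w -> 0 < l -> itg (cube a l) w ->
  0 < \int[mu]_(x in cube a l) w x.
Proof.
move=> ww l0 wi; apply: Rint_gt0 wi; [exact: cube_measurable|exact: cube_neq0|].
by move=> x _; exact: ww.2.
Qed.

Lemma doubling_arith (u A M L v y : R) : 1 <= u -> 0 <= A -> 0 < L -> 0 < M -> 0 < v -> 0 <= y ->
  M <= A `^ u^-1 * L * v `^ (- u^-1) * y `^ u^-1 -> (M / L) `^ u * v <= A * y.
Proof.
move=> u1 A0 L0 M0 v0 y0 h; have u0 : 0 < u by apply: lt_le_trans u1.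
have ui : 0 <= u^-1 by rewrite invr_ge0 ltW.
have {}h : M / L <= (A * y / v) `^ u^-1.
  rewrite ler_pdivrMr// powRM ?mulr_ge0 ?invr_ge0 ?(ltW v0)// powRM//.
  apply: le_trans h _; rewrite -(powR_inv1 (ltW v0)) -powRrM mulN1r.
  by rewrite le_eqVlt; apply/orP; left; apply/eqP; ring.
rewrite -ler_pdivlMr// -[leRHS](@powRVK _ u) ?gt_eqF ?mulr_ge0 ?invr_ge0 ?(ltW v0)//.
by apply: ge0_ler_powR; rewrite ?nnegrE ?(ltW u0) ?powR_ge0 ?mulr_ge0 ?invr_ge0 ?(ltW L0) ?(ltW M0).
Qed.

Lemma average_power_mono (u p A B L : R) : 0 < u - 1 -> 0 < p - 1 -> 0 < L -> 0 <= A -> 0 <= B ->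
  B <= A `^ ((u - 1) / (p - 1)) * L `^ (1 - (u - 1) / (p - 1)) ->
  (L^-1 * B) `^ (p - 1) <= (L^-1 * A) `^ (u - 1).
Proof.
move=> u0 p0 L0 A0 B0 h; have Li : 0 <= L^-1 by rewrite invr_ge0 ltW.
rewrite -[X in _ <= _ `^ X](@divfK _ (p - 1)) ?gt_eqF// powRrM.
apply: ge0_ler_powR; rewrite ?nnegrE ?(ltW p0) ?powR_ge0 ?mulr_ge0//.
rewrite mulrC ler_pdivrMr// powRM// mulrAC mulrC; apply: le_trans h _.
rewrite ler_wpM2l ?powR_ge0// -(powR_inv1 (ltW L0)) -powRrM mulN1r.
rewrite -[X in _ <= _ * X](powRr1 (ltW L0)) -powRD; last by rewrite (gt_eqF L0) implybT.
by rewrite addrC.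
Qed.

Lemma dual_constant_bound (p A L v X : R) : 1 <= p -> 0 < L -> 0 < v -> 0 <= X -> L^-1 * v * X <= A ->
  (X * L `^ (p - 1)) `^ p^-1 <= A `^ p^-1 * L * v `^ (- p^-1).
Proof.
move=> p1 L0 v0 X0 XA; have p0 : 0 < p by apply: lt_le_trans p1.
have A0 : 0 <= A.
  by apply: le_trans XA; apply: mulr_ge0 => //; rewrite mulr_ge0 ?invr_ge0 ?ltW.
have Lp0 := powR_ge0 L p.
have -> : A `^ p^-1 * L * v `^ (- p^-1) = (A * L `^ p * v^-1) `^ p^-1.
  rewrite powRM ?mulr_ge0 ?invr_ge0 ?(ltW v0)// powRM// powRK ?gt_eqF ?ltW//.
  by rewrite -(powR_inv1 (ltW v0)) -powRrM mulN1r.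
apply: ge0_ler_powR; rewrite ?nnegrE ?invr_ge0 ?(ltW p0) ?mulr_ge0 ?powR_ge0 ?invr_ge0 ?(ltW v0)//.
rewrite ler_pdivlMr// -(mulr_powRB1 (ltW L0) p0) mulrA mulrAC.
rewrite ler_wpM2r ?powR_ge0// -ler_pdivrMr//; apply: le_trans XA.
by rewrite mulrC mulrAC mulrA.
Qed.

Lemma dual_factorization (p y v : R) : 1 < p -> 0 <= y -> 0 < v ->
  y = (y `^ p * v) `^ p^-1 * (`|v^-1| `^ (p - 1)^-1) `^ (1 - p^-1).
Proof.
move=> p1 y0 v0; have p0 : 0 < p by apply: lt_trans p1.
have pm : p - 1 != 0 by rewrite subr_eq0 gt_eqF.
rewrite powRM ?powR_ge0 ?(ltW v0)// powRK ?gt_eqF// -powRrM.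
have -> : (p - 1)^-1 * (1 - p^-1) = p^-1 by field; rewrite pm gt_eqF.
by rewrite -mulrA gtr0_norm ?invr_gt0// -powRM ?invr_ge0 ?(ltW v0)// mulfV ?gt_eqF// powR1 mulr1.
Qed.

Lemma dual_power (p B L : R) : 1 < p -> 0 <= B -> 0 < L ->
  B `^ (1 - p^-1) = ((L^-1 * B) `^ (p - 1) * L `^ (p - 1)) `^ p^-1.
Proof.
move=> p1 B0 L0; have p0 : 0 < p by apply: lt_trans p1.
rewrite -powRM ?mulr_ge0 ?invr_ge0 ?(ltW L0)// mulrAC mulVf ?gt_eqF// mul1r -powRrM.
by rewrite mulrBl mul1r mulfV ?gt_eqF.
Qed.

(** Hölder's inequality for the splitting in [dual_factorization], the dual factor being controlled
    by the A_p condition. For p = 1 the dual average X is the essential supremum of 1/w, and |h| <=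
    X |h| w almost everywhere takes the place of Hölder. *)
Lemma Ap_key p a l w (h : Rd -> R) : 1 <= p -> weight w -> (Ap_const p w < +oo)%E -> 0 < l ->
  lmeasurable_fun (cube a l) h -> itg (cube a l) (fun x => `|h x| `^ p * w x) ->
  itg (cube a l) h /\
  \int[mu]_(x in cube a l) `|h x| <= fine (Ap_const p w) `^ p^-1 * l ^+ d *
     (\int[mu]_(x in cube a l) w x) `^ (- p^-1) * (\int[mu]_(x in cube a l) (`|h x| `^ p * w x)) `^ p^-1.
Proof.
move=> p1 ww Aoo l0 mh hi; have [wi [X [EX X0 AX]]] := Ap_cube a p1 ww Aoo l0.
have [mw w0] := ww; have wP := cube_weight_gt0 ww l0 wi.
have p0 : 0 < p by apply: lt_le_trans p1.
have mP : measurable (cube a l : set Rd) by exact: cube_measurable.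
have mwP : lmeasurable_fun (cube a l) w by apply: lmeasurable_sub.
have mnh : lmeasurable_fun (cube a l) (fun x => `|h x|).
  exact: (measurableT_comp (@normr_measurable R setT)).
have ld0 : 0 < l ^+ d by rewrite exprn_gt0.
set wPc := \int[mu]_(x in _) w x in wP AX *.
set H := \int[mu]_(x in _) (`|h x| `^ p * w x).
have hw0 x : 0 <= `|h x| `^ p * w x by rewrite mulr_ge0 ?powR_ge0 ?ltW.

suff [hi' Hle] : itg (cube a l) (fun x => `|h x|) /\
    \int[mu]_(x in cube a l) `|h x| <= H `^ p^-1 * (X * (l ^+ d) `^ (p - 1)) `^ p^-1.
  split.
    apply: itg_le hi' => //.
  by apply: (le_trans Hle); rewrite mulrC ler_wpM2r ?powR_ge0// dual_constant_bound// ltW.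
move: EX; rewrite inver subr_eq0; case: ifPn => [/eqP p1e|p1n] EX.
  have [_] := ess_sup_dual a ww l0; rewrite EX => aeX.
  rewrite p1e subrr powRr0 mulr1 !invr1 !powRr1 ?(ltW X0)//; last first.
    by apply: Rintegral_ge0 => x _; apply: hw0.
  rewrite mulrC /H -(RintegralZl _ mP hi).
  have Xhw0 x : 0 <= X * (`|h x| `^ p * w x) by rewrite mulr_ge0 ?(ltW X0).
  apply: (Rint_le_ae mP mnh (itgZ X mP hi) (fun x => normr_ge0 (h x)) Xhw0).
  apply: (ae_imp aeX) => x + Px => /(_ Px); rewrite lee_fin => wX.
  by rewrite p1e powRr1// mulrCA ler_peMr// -ler_pdivrMr ?w0// div1r.
have r0 : 0 < (p - 1)^-1 by rewrite invr_gt0 subr_gt0 lt_neqAle eq_sym p1n.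
have [] := @pavg_itg (p - 1)^-1 a l (fun x => (w x)^-1) l0 r0.
- rewrite (_ : (fun x => _) = fun x => w x `^ (-1)).
    by apply: (measurableT_comp (measurable_powR _)).
  by apply/funext => x; rewrite powR_inv1// ltW.
- by rewrite EX ltry.
set b := fun x : Rd => `|(w x)^-1| `^ (p - 1)^-1.
rewrite EX invrK => bi [EX'].
have b0 x : 0 <= b x by exact: powR_ge0.
have p1' : 1 < p by rewrite lt_neqAle eq_sym p1n.
have t0 : 0 < p^-1 by rewrite invr_gt0.
have t1 : p^-1 <= 1 by rewrite invf_le1.
have eh : (fun x => `|h x|) = fun x => (`|h x| `^ p * w x) `^ p^-1 * b x `^ (1 - p^-1).
  by apply/funext => x; apply: dual_factorization.
have Bp : (\int[mu]_(x in cube a l) b x) `^ (1 - p^-1) = (X * (l ^+ d) `^ (p - 1)) `^ p^-1.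
  rewrite (dual_power p1' _ ld0); last by apply: Rintegral_ge0.
  by rewrite EX'.
rewrite eh; split; first exact: itg_interpolation.
by have := Rint_hoelder mP hw0 b0 t0 t1 hi bi; rewrite Bp.
Qed.

(** Averages of order r increase with r, and 1/(p-1) <= 1/(u-1): Hölder against the constant 1, or
    for u = 1 the bound of 1/w by its essential supremum. *)
Lemma dual_pavg_mono u p a l w : 1 <= u -> u <= p -> weight w -> 0 < l ->
  (pavg ((u - 1)%:E^-1) (cube a l) (fun x => (w x)^-1)%R < +oo)%E ->
  (pavg ((p - 1)%:E^-1) (cube a l) (fun x => (w x)^-1)%R <=
   pavg ((u - 1)%:E^-1) (cube a l) (fun x => (w x)^-1)%R)%E.
Proof.
move=> u1; rewrite le_eqVlt => /predU1P[->//|up] ww l0.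
have [mw w0] := ww.
have mP : measurable (cube a l : set Rd) by exact: cube_measurable.
have mv : lmeasurable_fun (cube a l) (fun x => (w x)^-1).
  rewrite (_ : (fun x => _) = fun x => w x `^ (-1)).
    by apply: (measurableT_comp (measurable_powR _)); apply: lmeasurable_sub.
  by apply/funext => x; rewrite powR_inv1// ltW.
have p10 : 0 < p - 1 by rewrite subr_gt0 (le_lt_trans u1).
have ld0 : 0 < l ^+ d by rewrite exprn_gt0.
have r0 : 0 < (p - 1)^-1 by rewrite invr_gt0.
have b0 x : 0 <= `|(w x)^-1| `^ (p - 1)^-1 by exact: powR_ge0.
have mb : lmeasurable_fun (cube a l) (fun x => `|(w x)^-1| `^ (p - 1)^-1).
  by apply: (measurableT_comp (measurable_powR _)); apply: (measurableT_comp (@normr_measurable R setT)).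
rewrite !inver !subr_eq0 (gt_eqF (le_lt_trans u1 up)); case: eqP => [u1e|/eqP u1n].
  have [+ +] := ess_sup_dual a ww l0; case: (pavg +oo _ _) => [X|//|//].
  rewrite lte_fin => X0 aeX _.
  have [] := @Rint_le_ae _ _ _ mu (cube a l) (fun x => `|(w x)^-1| `^ (p - 1)^-1)
    (fun=> X `^ (p - 1)^-1) mP mb.
  - by apply: itg_cst => //; exact: leb_cubeoo (ltW l0).
  - by [].
  - by move=> x; exact: powR_ge0.
  - apply: (ae_imp aeX) => x + Px => /(_ Px); rewrite lee_fin => wX.
    by rewrite ge0_ler_powR ?nnegrE ?(ltW r0) ?(ltW X0)// ger0_norm ?invr_ge0 ?(ltW (w0 x)).
  move=> bi Ib; have {}Ib : \int[mu]_(x in cube a l) `|(w x)^-1| `^ (p - 1)^-1 <= X `^ (p - 1)^-1 * l ^+ d.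
    by move: Ib; rewrite Rintegral_cst// [X in fine X](leb_cube _ (ltW l0)).
  rewrite (pavg_EFin l0 bi) lee_fin invrK.
  rewrite -[leRHS](@powRVK _ (p - 1)) ?gt_eqF ?(ltW X0)//.
  apply: ge0_ler_powR; rewrite ?nnegrE ?(ltW p10) ?powR_ge0//.
    by rewrite mulr_ge0 ?invr_ge0 ?(ltW ld0)// Rintegral_ge0.
  by rewrite mulrC ler_pdivrMr.
have u10 : 0 < u - 1 by rewrite subr_gt0 lt_neqAle eq_sym u1n.
have s0 : 0 < (u - 1)^-1 by rewrite invr_gt0.
move=> /(pavg_itg l0 s0 mv)[ai ->].
set r := (u - 1) / (p - 1); have r_gt0 : 0 < r by rewrite divr_gt0.
have r_le1 : r <= 1 by rewrite ler_pdivrMr// mul1r lerB// ltW.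
set A := fun x : Rd => `|(w x)^-1| `^ (u - 1)^-1 in ai *.
have A0 x : 0 <= A x by exact: powR_ge0.
have oi : itg (cube a l : set Rd) (fun=> 1 : R).
  by apply: itg_cst => //; exact: leb_cubeoo (ltW l0).
have eb : (fun x => `|(w x)^-1| `^ (p - 1)^-1) = fun x => A x `^ r * 1 `^ (1 - r).
  apply/funext => x; rewrite powR1 mulr1 /A -powRrM /r mulrA mulVf ?mul1r// gt_eqF//.
have bi := itg_interpolation mP A0 (fun=> ler01) r_gt0 r_le1 ai oi.
have := Rint_hoelder mP A0 (fun=> ler01) r_gt0 r_le1 ai oi.
rewrite -eb in bi; rewrite -eb Rintegral_cst// [X in fine X](leb_cube _ (ltW l0)) mul1r => Ib.
rewrite (pavg_EFin l0 bi) lee_fin !invrK.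
have IA0 : 0 <= \int[mu]_(x in cube a l) A x by exact: Rintegral_ge0.
have Ib0 : 0 <= \int[mu]_(x in cube a l) `|(w x)^-1| `^ (p - 1)^-1 by exact: Rintegral_ge0.
exact: (average_power_mono u10 p10 ld0 IA0 Ib0 Ib).
Qed.

Lemma Ap_const_mono u p w : 1 <= u -> u <= p -> weight w -> (Ap_const u w < +oo)%E ->
  (Ap_const p w <= Ap_const u w)%E.
Proof.
move=> u1 up ww uoo; apply: ge_ereal_sup => _ [_ [a [l [l0 ->]]] <-].
have [wi [X [EX X0 _]]] := Ap_cube a u1 ww uoo l0.
apply: (@le_trans _ _ (pavg 1 (cube a l) w * pavg ((u - 1)%:E^-1) (cube a l) (fun x => (w x)^-1)%R)%E).
  apply: lee_wpmul2l; first by apply/ltW/pavg_gt0 => //; [exact: lmeasurable_sub ww (cube_measurable _ _)|exact: ww.2].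
  by apply: dual_pavg_mono => //; rewrite EX ltry.
by apply: ereal_sup_ubound; exists (cube a l) => //; exists a, l.
Qed.

(** This is [Ap_key] for the indicator of the smaller cube, raised to the power u. *)
Lemma Ap_const_doubling u w a l b m : 1 <= u -> weight w -> (Ap_const u w < +oo)%E -> 0 < l -> 0 < m ->
  cube b m `<=` cube a l ->
  ((m / l) ^+ d) `^ u * \int[mu]_(x in cube a l) w x <=
  fine (Ap_const u w) * \int[mu]_(x in cube b m) w x.
Proof.
move=> u1 ww uoo l0 m0 sub.
have mP : measurable (cube a l : set Rd) by exact: cube_measurable.
have mB : measurable (cube b m : set Rd) by exact: cube_measurable.
have [wi [X [EX X0 AX]]] := Ap_cube a u1 ww uoo l0.
have eP (x : Rd) : `|\1_(cube b m) x| `^ u * w x = w x * \1_(cube b m) x.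
  rewrite indicE; case: (_ \in _); first by rewrite normr1 powR1 mul1r mulr1.
  by rewrite normr0 powR0 ?mul0r ?mulr0// gt_eqF// (lt_le_trans _ u1).
have hi : itg (cube a l : set Rd) (fun x => `|\1_(cube b m) x| `^ u * w x).
  by rewrite (_ : (fun x => _) = (fun x => w x * \1_(cube b m) x)); [exact: itg_indic|exact/funext].
have mh : lmeasurable_fun (cube a l) (\1_(cube b m) : Rd -> R).
  by apply: (@measurable_funS _ _ _ _ setT); [|exact: subsetT|exact: measurable_indic].
have [_] := Ap_key u1 ww uoo l0 mh hi.
have -> : \int[mu]_(x in cube a l) (`|\1_(cube b m) x| `^ u * w x) = \int[mu]_(x in cube b m) w x.
  rewrite (_ : (fun x => _) = (fun x : Rd => w x * \1_(cube b m) x)); last exact/funext.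
  by rewrite Rint_indic// setIidr.
have -> : \int[mu]_(x in cube a l) `|\1_(cube b m) x| = m ^+ d.
  rewrite (_ : (fun x => _) = (fun x : Rd => 1 * \1_(cube b m) x)); last first.
    by apply/funext => x; rewrite indicE mul1r; case: (_ \in _); rewrite ?normr1 ?normr0.
  rewrite Rint_indic// setIidr// Rintegral_cst// [X in fine X](leb_cube _ (ltW m0))/= mul1r//.
have Q0 := cube_weight_gt0 ww l0 wi.
have B0 := cube_weight_gt0 ww m0 (itgS mB mP sub wi).
have A0 : 0 <= fine (Ap_const u w).
  by apply: le_trans AX; rewrite !mulr_ge0 ?invr_ge0 ?exprn_ge0 ?ltW.
rewrite expr_div_n.
exact: (doubling_arith u1 A0 (exprn_gt0 d l0) (exprn_gt0 d m0) Q0 (ltW B0)).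
Qed.
End ap_weights.

(** * Dyadic cubes and the A_infty constant *)

(* [F] need not be measurable: it is the maximal function in the definition of
   [Ainfty_const]. *)
Lemma integral_minorant (dT : measure_display) (T : measurableType dT) (R : realType)
    (mu : {measure set T -> \bar R}) (D : set T) (f : T -> R) (F : T -> \bar R) :
  measurable D -> mu.-integrable D (EFin \o f) -> (forall x, 0 <= f x) ->
  (forall x, D x -> ((f x)%:E <= F x)%E) ->
  ((\int[mu]_(x in D) f x)%:E <= \int[mu]_(x in D) F x)%E.
Proof.
move=> mD fi f0 fF; rewrite -Rint_EFin//.
have F0 x : D x -> (0 <= F x)%E by move=> Dx; apply: le_trans (fF _ Dx); rewrite lee_fin.
rewrite !ge0_integralE//; last by move=> x _; rewrite lee_fin.
(* The integral of a nonnegative function is a supremum over simple functions below it, hence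
   monotone without measurability. *)
apply: ereal_sup_le => _ [h hf <-]; exists h => // x; apply: (le_trans (hf x)); rewrite !patchE; case: ifPn => // /set_mem; exact: fF.
Qed.

Lemma itg_glue (dT : measure_display) (T : measurableType dT) (R : realType)
    (mu : {measure set T -> \bar R}) (D A : set T) (m : T -> R) (c : R) :
  measurable D -> measurable A -> (mu D < +oo)%E -> A `<=` D -> mu.-integrable A (EFin \o m) ->
  mu.-integrable D (EFin \o (fun y => c + (m y - c) * \1_A y)) /\
  \int[mu]_(y in D) (c + (m y - c) * \1_A y) = c * (fine (mu D) - fine (mu A)) + \int[mu]_(y in A) m y.
Proof.
move=> mD mA Doo AD mi; have Aoo : (mu A < +oo)%E.
  by apply: le_lt_trans Doo; apply: le_measure; rewrite ?inE.
have ci : mu.-integrable A (EFin \o (fun=> c)) by exact: itg_cst.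
have cD : mu.-integrable D (EFin \o (fun=> c)) by exact: itg_cst.
have mci := itgB mA mi ci.
have ri : mu.-integrable D (EFin \o (fun y => (m y - c) * \1_A y)).
  have := (integrable_restrict mu mA mD (EFin \o (fun y => m y - c))).1.
  rewrite setIidr// => /(_ mci); congr (mu.-integrable D _); apply/funext => y.
  by rewrite patchE /= indicE; case: (_ \in _); rewrite ?mulr1 ?mulr0.
split; first exact: itgD.
rewrite RintegralD// Rint_indic// setIidr// RintegralB// !Rintegral_cst//.
by rewrite mulrBr addrAC addrA addrAC.
Qed.

Lemma half_remainder (R : realType) (a b : R) : b <= a / 2 -> 2^-1 * a <= a - b.
Proof. by move=> h; lra. Qed.

Section dyadic_cubes.
Context {R : realType} {d : nat}.
Local Notation mu := (leb R d).
Local Notation Rd := (caratheodory_type (borel_lebesgue R d)^*%mu).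
Local Notation itg D f := (mu.-integrable D (EFin \o f)).
Local Notation X := {ffun 'I_d -> 'I_2}.
Variables (a : 'rV[R]_d) (l : R).
Hypothesis l0 : 0 < l.
Implicit Types (s : seq X) (f : Rd -> R).

Definition side s : R := l / 2 ^+ size s.

Fixpoint corner s : 'rV[R]_d :=
  if s is x :: s' then \row_k (corner s' ord0 k + side s' / 2 * (x k)%:R) else a.

Definition dcube s : set Rd := cube (corner s) (side s).

Lemma side_gt0 s : 0 < side s.
Proof. by rewrite divr_gt0// exprn_gt0. Qed.

Lemma side_child x s : side (x :: s) = side s / 2.
Proof. by rewrite /side exprSr invfM mulrA. Qed.

Lemma dcube_child (x : X) s : dcube (x :: s) = cell (corner s) (side s / 2) (fun k => x k).
Proof. by rewrite /dcube side_child. Qed.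

Lemma dcube_measurable s : measurable (dcube s).
Proof. exact: cube_measurable. Qed.

Lemma leb_dcube s : mu (dcube s) = (side s ^+ d)%:E.
Proof. by rewrite [LHS](leb_cube _ (ltW (side_gt0 s))). Qed.

Lemma dcubeoo s : (mu (dcube s) < +oo)%E.
Proof. exact: leb_cubeoo (ltW (side_gt0 s)). Qed.

Lemma dcube_split s : dcube s = cube (corner s) (side s / 2 * 2%:R).
Proof. by rewrite mulfVK// pnatr_eq0. Qed.

Lemma dcube_sub x s : dcube (x :: s) `<=` dcube s.
Proof.
rewrite dcube_child dcube_split; apply: cell_sub; first by rewrite divr_gt0 ?side_gt0.
by move=> k; exact: ltn_ord.
Qed.

Lemma dcube_nil : dcube [::] = cube a l.
Proof. by rewrite /dcube /= /side expr0 divr1. Qed.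

Lemma dcube_sub_root s : dcube s `<=` cube a l.
Proof.
by elim: s => [|x s IH]; [rewrite dcube_nil|apply: subset_trans IH; exact: dcube_sub].
Qed.

Lemma dcube_inj (x x' : X) s y : dcube (x :: s) y -> dcube (x' :: s) y -> x = x'.
Proof.
rewrite !dcube_child => xy x'y; apply/ffunP => k; apply: val_inj.
by apply: cell_inj xy x'y _; rewrite divr_gt0 ?side_gt0.
Qed.

Lemma dcube_itg s f : itg (cube a l) f -> itg (dcube s) f.
Proof.
by apply: itgS; [exact: dcube_measurable|exact: cube_measurable|exact: dcube_sub_root].
Qed.

Lemma dcube_integral s f : itg (cube a l) f ->
  \int[mu]_(x in dcube s) f x = \sum_x \int[mu]_(y in dcube (x :: s)) f y.
Proof.
move=> /(dcube_itg s) fi; have h0 : 0 < side s / 2 by rewrite divr_gt0 ?side_gt0.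
rewrite dcube_split in fi *; rewrite (grid_integral h0 fi).
by apply: eq_bigr => x _; rewrite dcube_child.
Qed.

Lemma dcube_diam s (x y : Rd) : dcube s x -> dcube s y -> forall k, `|x ord0 k - y ord0 k| <= side s.
Proof.
move=> sx sy k; have /andP[x1 x2] := sx k; have /andP[y1 y2] := sy k.
rewrite !mxE in x2 y2; rewrite ler_norml; apply/andP; split; lra.
Qed.

(** The leaves are disjoint cubes, so the bounds by 2 hold with room to spare. They are indexed by
    their positions in the list because [fine_cells] asks for a finite type. *)
Lemma leaves_fine_cells (K : nat) (e : R) : l / 2 ^+ K <= e ->
  let C (i : 'I_(size (leaves K ([::] : seq X)))) := dcube (nth [::] (leaves K [::]) i) in
  fine_cells (cube a l) e C C.
Proof.
move=> le C; split.
- by move=> i; split=> //; [exact: dcube_measurable|exact: dcube_measurable|exact: dcube_sub_root].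
- move=> i; rewrite leb_dcube/=; have := exprn_gt0 d (side_gt0 (nth [::] (leaves K [::]) i)).
  by set z := side _ ^+ d => z0; split => //; lra.
- move=> i x y ix iy k; apply: (le_trans (dcube_diam ix iy k)).
  have /size_leaves := mem_nth [::] (ltn_ord i); rewrite add0n => sK.
  by rewrite /side sK.
- move=> h hi h0.
  rewrite -(big_mkord xpredT (fun i => \int[mu]_(x in dcube (nth [::] (leaves K [::]) i)) h x)).
  rewrite -(big_nth [::] xpredT (fun s => \int[mu]_(x in dcube s) h x)).
  rewrite (@sum_leaves_additive _ _ K).
  + by rewrite dcube_nil ler_peMl ?ler1n// Rintegral_ge0.
  + by move=> s _; exact: dcube_integral.
  + by rewrite add0n.
Qed.

(** This is [Ap_key] on the parent cube, applied to G times the indicator of the union of the chosen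
    children. *)
Lemma dcube_Ap (p : R) (w G : Rd -> R) s (A : pred X) : 1 <= p -> weight w -> (Ap_const p w < +oo)%E ->
  lmeasurable_fun (cube a l) G -> (forall x, 0 <= G x) -> itg (cube a l) (fun x => G x `^ p * w x) ->
  itg (cube a l) G /\
  \sum_(x | A x) \int[mu]_(y in dcube (x :: s)) G y <=
  fine (Ap_const p w) `^ p^-1 * side s ^+ d * (\int[mu]_(y in dcube s) w y) `^ (- p^-1) *
    (\sum_(x | A x) \int[mu]_(y in dcube (x :: s)) (G y `^ p * w y)) `^ p^-1.
Proof.
move=> p1 ww Aoo mG G0 Gi; have p0 : 0 < p by apply: lt_le_trans p1.
have nG : (fun x => `|G x| `^ p * w x) = (fun x => G x `^ p * w x).
  by apply/funext => x; rewrite ger0_norm.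
have G1 : itg (cube a l) G.
  by have [] := Ap_key p1 ww Aoo l0 mG; rewrite ?nG.
split=> //.
pose U : set Rd := \bigcup_(x in [set` A]) dcube (x :: s).
have mU : measurable U.
  by apply: fin_bigcup_measurable => [|x _]; [exact: finite_finset|exact: dcube_measurable].
pose H y : R := G y * \1_U y.
have HE (x : X) y : dcube (x :: s) y -> \1_U y = (A x)%:R :> R.
  move=> xy; rewrite indicE; congr (_%:R); congr nat_of_bool; apply/idP/idP.
    by move=> /set_mem[x' Ax' x'y]; rewrite (dcube_inj xy x'y).
  by move=> Ax; apply/mem_set; exists x.
have mH : lmeasurable_fun (dcube s) H.
  by apply: itg_mfun (itg_indic (dcube_measurable s) mU (dcube_itg s G1)).
have Hp y : `|H y| `^ p * w y = G y `^ p * w y * \1_U y.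
  rewrite /H indicE; case: (_ \in _); first by rewrite !mulr1 ger0_norm.
  by rewrite !mulr0 normr0 powR0 ?mul0r// gt_eqF.
have Hi : itg (dcube s) (fun y => `|H y| `^ p * w y).
  by rewrite (funext Hp); apply: itg_indic => //; [exact: dcube_measurable|exact: dcube_itg].
have [_] := Ap_key p1 ww Aoo (side_gt0 s) mH Hi.
have red (F : Rd -> R) : itg (cube a l) F ->
    \int[mu]_(y in dcube s) (F y * \1_U y) = \sum_(x | A x) \int[mu]_(y in dcube (x :: s)) F y.
  move=> Fi; rewrite dcube_integral; last by apply: itg_indic => //; exact: cube_measurable.
  rewrite [RHS]big_mkcond; apply: eq_bigr => x _; case: ifP => Ax.
    by apply: eq_Rintegral => y /set_mem /HE ->; rewrite Ax mulr1.
  rewrite (@eq_Rintegral _ _ _ _ _ (fun=> 0)); last first.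
    by move=> y /set_mem /HE ->; rewrite Ax mulr0.
  by rewrite Rintegral_cst ?mul0r//; exact: dcube_measurable.
rewrite -(red _ G1) -(red _ Gi).
have -> : \int[mu]_(y in cube (corner s) (side s)) `|H y| = \int[mu]_(y in dcube s) (G y * \1_U y).
  by apply: eq_Rintegral => y _; rewrite ger0_norm// mulr_ge0.
by rewrite (funext Hp).
Qed.

Variable w : Rd -> R.
Hypotheses (ww : weight w) (wi : itg (cube a l) w).

Definition wd s := \int[mu]_(y in dcube s) w y.

Lemma wd_gt0 s : 0 < wd s.
Proof. exact: cube_weight_gt0 (side_gt0 s) (dcube_itg s wi). Qed.

Lemma dcube_pavg1 s : pavg 1 (dcube s) w = (wd s / side s ^+ d)%:E.
Proof.
have w1 : (fun x => `|w x| `^ 1) = w.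
  by apply/funext => x; rewrite gtr0_norm ?powRr1 ?ltW//; exact: ww.2.
have wi1 : itg (dcube s) (fun x => `|w x| `^ 1) by rewrite w1; exact: dcube_itg.
rewrite (pavg_EFin (side_gt0 s) wi1); congr EFin; rewrite invr1.
have -> : \int[mu]_(x in cube (corner s) (side s)) (`|w x| `^ 1) = wd s.
  by apply: eq_Rintegral => x _; rewrite [LHS](congr1 (@^~ x) w1).
by rewrite powRr1 1?mulrC// divr_ge0 ?exprn_ge0 ?ltW ?wd_gt0 ?side_gt0.
Qed.

Let M s0 y := ereal_sup [set (pavg 1 S w * (\1_S y : R)%:E)%E
  | S in cubes `&` [set S | S `<=` dcube s0]].

(** On each cube of the path, outside the next one, m is the average of w over that cube, which the
    maximal function dominates there. Removing the next cube takes away the fraction 2^(-d) <= 1/2,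
    so every cube P of the path contributes at least w(P)/2. *)
Lemma maximal_minorant s0 v s : (0 < d)%N -> dcube s `<=` dcube s0 -> exists m : Rd -> R,
  [/\ itg (dcube s) m, forall y, 0 <= m y, forall y, dcube s y -> ((m y)%:E <= M s0 y)%E &
      2^-1 * path_sum wd v s <= \int[mu]_(y in dcube s) m y].
Proof.
move=> d_gt0; elim: v s => [|x v IH] s ss0.
  exists (fun=> wd s / side s ^+ d); split.
  - by apply: itg_cst; [exact: dcube_measurable|exact: dcubeoo].
  - by move=> _; rewrite divr_ge0 ?exprn_ge0 ?ltW ?wd_gt0 ?side_gt0.
  - move=> y sy; rewrite -dcube_pavg1 -[leLHS]mule1; apply: ereal_sup_ubound.
    exists (dcube s); first by split=> //; exists (corner s), (side s); rewrite side_gt0.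
    by rewrite indicE mem_set.
  - rewrite /= Rintegral_cst; last exact: dcube_measurable.
    rewrite [X in fine X]leb_dcube/= addr0 divfK ?gt_eqF ?exprn_gt0 ?side_gt0//.
    by rewrite ler_piMl ?invf_le1 ?ler1n// ltW ?wd_gt0.
have [m [mi m0 mM mv]] := IH (x :: s) (subset_trans (@dcube_sub x s) ss0).
have c0 : 0 <= wd s / side s ^+ d by rewrite divr_ge0 ?exprn_ge0 ?ltW ?wd_gt0 ?side_gt0.
have mx := dcube_measurable (x :: s); have ms := dcube_measurable s.
have [gi gE] := itg_glue (wd s / side s ^+ d) ms mx (dcubeoo s) (@dcube_sub x s) mi.
exists (fun y => wd s / side s ^+ d + (m y - wd s / side s ^+ d) * \1_(dcube (x :: s)) y); split=> //.
- move=> y; rewrite indicE; case: (_ \in _); last by rewrite mulr0 addr0.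
  by rewrite mulr1 addrC subrK.
- move=> y sy; rewrite indicE; have [xy|xy] := boolP (y \in _).
    by rewrite mulr1 addrC subrK; apply: mM; exact: set_mem.
  rewrite mulr0 addr0 -dcube_pavg1 -[leLHS]mule1; apply: ereal_sup_ubound.
  exists (dcube s); first by split=> //; exists (corner s), (side s); rewrite side_gt0.
  by rewrite indicE mem_set.
- rewrite gE [X in fine X]leb_dcube [X in _ - fine X]leb_dcube/= side_child.
  rewrite mulrBr divfK ?gt_eqF ?exprn_gt0 ?side_gt0// [(side s / 2) ^+ d]expr_div_n.
  have sd : side s ^+ d != 0 by rewrite gt_eqF ?exprn_gt0 ?side_gt0.
  have -> : wd s / side s ^+ d * (side s ^+ d / 2 ^+ d) = wd s / 2 ^+ d.
    by rewrite mulrA divfK.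
  rewrite [path_sum _ _ _]/= mulrDr; apply: lerD => //.
  have h : wd s / 2 ^+ d <= wd s / 2.
    rewrite ler_wpM2l ?(ltW (wd_gt0 s))// lef_pV2 ?posrE ?exprn_gt0//.
    by rewrite -[leLHS]expr1; apply: ler_weXn2l => //; rewrite ler1n.
  exact: half_remainder h.
Qed.

Lemma maximal_integral_le s0 (m : Rd -> R) : (Ainfty_const w < +oo)%E ->
  itg (dcube s0) m -> (forall y, 0 <= m y) -> (forall y, dcube s0 y -> ((m y)%:E <= M s0 y)%E) ->
  \int[mu]_(y in dcube s0) m y <= fine (Ainfty_const w) * wd s0.
Proof.
move=> Woo mi m0 mM; have w0 := wd_gt0 s0.
have : ((wmeasure w (dcube s0))^-1 * \int[mu]_(x in dcube s0) M s0 x <= Ainfty_const w)%E.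
  by apply: ereal_sup_ubound; exists (dcube s0) => //; exists (corner s0), (side s0); rewrite side_gt0.
have -> : wmeasure w (dcube s0) = (wd s0)%:E.
  by rewrite /wmeasure Rint_EFin//; [exact: dcube_measurable|exact: dcube_itg].
rewrite inver (gt_eqF w0) => h.
have := integral_minorant (dcube_measurable s0) mi m0 mM.
move/(@lee_wpmul2l R (wd s0)^-1%:E); rewrite lee_fin invr_ge0 (ltW w0) => /(_ isT) h2.
have := le_trans h2 h; rewrite -EFinM => h3.
rewrite -ler_pdivrMr// mulrC -lee_fin fineK// ge0_fin_numE//.
by apply: le_trans h3; rewrite lee_fin mulr_ge0 ?invr_ge0 ?(ltW w0) ?Rintegral_ge0.
Qed.

(** This is the only way in which the A_infty constant enters the tree: it provides the W of
    [tree_bound]. *)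
Lemma path_sum_Ainfty v s : (0 < d)%N -> (Ainfty_const w < +oo)%E ->
  path_sum wd v s <= 2 * fine (Ainfty_const w) * wd s.
Proof.
move=> d_gt0 Woo; have [m [mi m0 mM h]] := maximal_minorant v d_gt0 (@subset_refl _ (dcube s)).
have := le_trans h (maximal_integral_le Woo mi m0 mM).
by rewrite ler_pdivrMl// mulrA.
Qed.

(** The maximal function is at least the average of w over the whole cube. The bound makes the
    factors built from this constant at least 1. *)
Lemma Ainfty_ge1 : (1 <= Ainfty_const w)%E.
Proof.
rewrite leNgt; apply/negP => W1; have Woo : (Ainfty_const w < +oo)%E by exact: lt_trans W1 (ltry _).
have c0 : 0 <= wd [::] / side [::] ^+ d by rewrite divr_ge0 ?exprn_ge0 ?ltW ?wd_gt0 ?side_gt0.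
have ci : itg (dcube [::]) (fun=> wd [::] / side [::] ^+ d).
  by apply: itg_cst; [exact: dcube_measurable|exact: dcubeoo].
have cM y : dcube [::] y -> ((wd [::] / side [::] ^+ d)%:E <= M [::] y)%E.
  move=> sy; rewrite -dcube_pavg1 -[leLHS]mule1; apply: ereal_sup_ubound.
  exists (dcube [::]); first by split=> //; exists (corner [::]), (side [::]); rewrite side_gt0.
  by rewrite indicE mem_set.
have := maximal_integral_le Woo ci (fun=> c0) cM.
rewrite Rintegral_cst; last exact: dcube_measurable.
rewrite [X in fine X]leb_dcube/= divfK ?gt_eqF ?exprn_gt0 ?side_gt0//.
rewrite ler_pMl ?wd_gt0// leNgt => /negP; apply.
by move: W1 Woo; case: (Ainfty_const w) => [r|//|] //=; rewrite lte_fin.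
Qed.

End dyadic_cubes.

(** * Weak type estimate for a truncation *)

(** Here c = du. As c (alpha + eps) = 1, the side ratio 2^(-n) is (2^(-nc))^alpha times 2^(-nc eps),
    and doubling bounds the first factor. *)
Lemma dyadic_scale_weight (R : realType) (c alpha eps A wQ wP : R) (n : nat) :
  0 < c -> 0 <= alpha -> alpha + eps = c^-1 -> 0 <= A -> 0 < wQ -> 0 < wP ->
  2 `^ (- (n%:R * c)) * wQ <= A * wP ->
  (2 ^+ n)^-1 <= (A / wQ) `^ alpha * wP `^ alpha * (2 `^ (- (c * eps))) ^+ n.
Proof.
move=> c0 al0 ale A0 wQ0 wP0 h.
have -> : (2 ^+ n)^-1 = (2 `^ (- (n%:R * c))) `^ alpha * (2 `^ (- (c * eps))) ^+ n :> R.
  rewrite -[X in _ * X]powR_mulrn ?powR_ge0// -!powRrM -powRD ?pnatr_eq0 ?implybT//.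
  have -> : - (n%:R * c) * alpha + - (c * eps) * n%:R = - (n%:R * (c * (alpha + eps))) by ring.
  by rewrite ale divff ?gt_eqF// mulr1 powRN powR_mulrn.
rewrite ler_wpM2r ?exprn_ge0 ?powR_ge0// -powRM ?divr_ge0 ?(ltW wQ0) ?(ltW wP0)//.
apply: powR_le_base => //.
by rewrite mulrAC ler_pdivlMr.
Qed.

(** The chord of the convex function 2^(-x) over [0, 1], obtained from Young's inequality. It bounds
    1 - rho from below by du eps / 2, the origin of the factor 1/eps. *)
Lemma powR2N_le (R : realType) (x : R) : 0 <= x -> x <= 1 -> 2 `^ (- x) <= 1 - x / 2.
Proof.
rewrite le_eqVlt => /predU1P[<- _|x0]; first by rewrite oppr0 powRr0 mul0r subr0.
rewrite le_eqVlt => /predU1P[->|x1]; first by rewrite powR_inv1//; lra.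
have h0 : 0 <= 2 `^ (- x) :> R by exact: powR_ge0.
have := @conjugate_powR R (2 `^ (- x)) 1 x^-1 (1 - x)^-1 h0 ler01.
rewrite !invr_gt0 subr_gt0 !invrK subrKC => /(_ x0 x1 erefl).
rewrite powR1 mulr1 -powRrM mulNr mulfV ?gt_eqF// powR_inv1// => h.
by apply: (le_trans h); lra.
Qed.

Lemma sum_le_cond_add (R : realType) (I : Type) (r : seq I) (P : pred I) (F A B : I -> R) :
  (forall s, F s <= (if P s then A s else 0) + B s) ->
  \sum_(s <- r) F s <= \sum_(s <- r | P s) A s + \sum_(s <- r) B s.
Proof. by move=> FAB; rewrite [X in X + _]big_mkcond -big_split; apply: ler_sum. Qed.

Lemma deviation_split (R : realType) (x y z t : R) :
  ((2 * t < `|x - z|)%R : bool)%:R <=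
  ((t < `|y - z|)%R : bool)%:R + ((t < `|x - y|)%R : bool)%:R :> R.
Proof.
case: ltP => [h|_]; last by rewrite addr_ge0.
case: ltP => [_|h1]; first by rewrite lerDl.
case: ltP => [_|h2]; first by rewrite lerDr.
have := lerD h2 h1; have := ler_normD (x - y) (y - z).
by rewrite addrA subrK; lra.
Qed.

Section weak_type.
Context {R : realType} {d : nat}.
Local Notation mu := (leb R d).
Local Notation Rd := (caratheodory_type (borel_lebesgue R d)^*%mu).
Local Notation itg D f := (mu.-integrable D (EFin \o f)).
Local Notation X := {ffun 'I_d -> 'I_2}.
Variables (a : 'rV[R]_d) (l : R) (w : Rd -> R) (p q u : R).
Hypotheses (d_gt0 : (0 < d)%N) (l0 : 0 < l) (p1 : 1 <= p) (pq : p <= q) (u1 : 1 <= u) (up : u <= p).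
Hypotheses (ww : weight w) (Auoo : (Ap_const u w < +oo)%E).
Let Q : set Rd := cube a l.
Let alpha := p^-1 - q^-1.
Let eps := (d%:R * u)^-1 - alpha.
Hypothesis eps0 : 0 <= eps.
Let W := fine (Ainfty_const w).
Let N := fine (Ap_const p w) `^ p^-1.
Let Au := fine (Ap_const u w).
Let rho : R := 2 `^ (- (d%:R * u * eps)).
Let wQ := \int[mu]_(x in Q) w x.
Let Lam := (Au / wQ) `^ alpha.

Let Apoo : (Ap_const p w < +oo)%E.
Proof. exact: le_lt_trans (Ap_const_mono u1 up ww Auoo) Auoo. Qed.

Let wi : itg Q w. Proof. by have [] := Ap_cube a p1 ww Apoo l0. Qed.

Let p0 : 0 < p. Proof. exact: lt_le_trans p1. Qed.
Let q0 : 0 < q. Proof. exact: lt_le_trans pq. Qed.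
Let du0 : 0 < d%:R * u. Proof. by rewrite mulr_gt0 ?ltr0n// (lt_le_trans ltr01). Qed.
Let al0 : 0 <= alpha. Proof. by rewrite subr_ge0 lef_pV2 ?posrE. Qed.
Let alt : alpha < p^-1. Proof. by rewrite ltrBlDr ltrDl invr_gt0. Qed.
Let wQ0 : 0 < wQ. Proof. exact: cube_weight_gt0. Qed.

(** Doubling for a cube contained in itself. *)
Lemma Au_ge1 : 1 <= Au.
Proof.
have := Ap_const_doubling u1 ww Auoo l0 l0 (@subset_refl _ (cube a l)).
by rewrite divff ?gt_eqF// expr1n powR1 mul1r -/wQ ler_pMl.
Qed.

Let Au0 : 0 <= Au. Proof. exact: le_trans Au_ge1. Qed.

Local Notation wd := (wd a l w).

Let wd0 s : 0 < wd s. Proof. exact: wd_gt0. Qed.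

Lemma side_bound (s : seq X) : (2 ^+ size s)^-1 <= Lam * wd s `^ alpha * rho ^+ size s.
Proof.
have ae : alpha + eps = (d%:R * u)^-1 by rewrite /eps addrC subrK.
apply: (dyadic_scale_weight du0 al0 ae Au0 wQ0 (wd0 s)).
have := Ap_const_doubling u1 ww Auoo l0 (side_gt0 l0 s) (@dcube_sub_root _ _ a l l0 s).
rewrite -/Q -/wQ; congr (_ * _ <= _).
rewrite /side mulrAC divff ?gt_eqF// mul1r exprVn -exprM -powR_mulrn// -powRN -powRrM.
by rewrite natrM mulNr mulrA.
Qed.

Section gradient.
Variable G : Rd -> R.
Hypotheses (mG : lmeasurable_fun Q G) (G0 : forall x, 0 <= G x).
Hypothesis Gi : itg Q (fun x => G x `^ p * w x).

Let gn s := \int[mu]_(x in dcube a l s) G x.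
Let gam s := \int[mu]_(x in dcube a l s) (G x `^ p * w x).
Let V (s : seq X) := side l s ^+ d.

Let iG : itg Q G.
Proof. by have [] := dcube_Ap l0 [::] xpred0 p1 ww Apoo mG G0 Gi. Qed.

(* [Gc] is the factor K of the theorem, up to constants. *)
Definition tree_constant (Gc : R) :=
  forall (K : nat) (e : seq X -> R), (forall s, 0 <= e s) -> (forall s, e s <= wd s) ->
    additive_below K e -> 0 < e [::] ->
    \sum_(s <- nodes K [::]) (2 ^+ size s)^-1 * (gn s / V s) * e s <=
    Lam * (Gc * (N * gam [::] `^ p^-1 * e [::] `^ (1 - q^-1))).

Let gn0 s : 0 <= gn s. Proof. exact: Rintegral_ge0. Qed.
Let gam0 s : 0 <= gam s.
Proof. by apply: Rintegral_ge0 => x _; rewrite mulr_ge0 ?powR_ge0 ?ltW//; exact: ww.2. Qed.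
Let V0 s : 0 < V s. Proof. by rewrite exprn_gt0 ?side_gt0. Qed.
Let N0 : 0 <= N. Proof. exact: powR_ge0. Qed.
Let D2 : 2 <= 2 ^+ d :> R.
Proof. by rewrite -[leLHS]expr1; apply: ler_weXn2l => //; rewrite ler1n. Qed.
Let Vc (x : X) s : V (x :: s) = V s / 2 ^+ d.
Proof. by rewrite /V side_child [LHS]expr_div_n. Qed.
Let wadd s : wd s = \sum_x wd (x :: s). Proof. exact: dcube_integral. Qed.
Let gadd s : gam s = \sum_x gam (x :: s). Proof. exact: dcube_integral. Qed.
Let gnadd s : gn s = \sum_x gn (x :: s). Proof. exact: dcube_integral. Qed.
Let Apx s (A : pred X) : \sum_(x | A x) gn (x :: s) <=
  N * V s * wd s `^ (- p^-1) * (\sum_(x | A x) gam (x :: s)) `^ p^-1.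
Proof. by have [] := dcube_Ap l0 s A p1 ww Apoo mG G0 Gi. Qed.

Let e_exp : alpha + (1 - p^-1) = 1 - q^-1.
Proof. by rewrite /alpha; ring. Qed.

Let rho_le : rho <= 1 - d%:R * u * eps / 2.
Proof.
apply: powR2N_le; first by rewrite mulr_ge0// ltW.
by rewrite /eps mulrBr divff ?gt_eqF// gerBl mulr_ge0// ltW.
Qed.

Let Lam0 : 0 <= Lam. Proof. exact: powR_ge0. Qed.

(** The geometric series over generations has sum 1/(1 - rho) <= 2/(du eps), and du >= 1. *)
Lemma tree_constant_levels : 0 < eps -> tree_constant (2 / eps).
Proof.
move=> eps_gt0 K e e0 ew eadd e00.
have x0 : 0 < d%:R * u * eps by rewrite mulr_gt0.
have r1 : rho < 1 by apply: (le_lt_trans rho_le); rewrite ltrBlDr ltrDl divr_gt0.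
have Grho : (1 - rho)^-1 <= 2 / eps.
  rewrite -[2 / eps]invf_div lef_pV2 ?posrE ?subr_gt0 ?divr_gt0//.
  apply: (@le_trans _ _ (d%:R * u * eps / 2)); last by rewrite lerBrDr -lerBrDl.
  rewrite ler_wpM2r// ler_peMl ?(ltW eps_gt0)//.
  have d1 : 1 <= d%:R :> R by rewrite ler1n.
  by apply: (le_trans d1); rewrite ler_peMr.
have := tree_bound_levels p1 N0 wd0 gam0 gadd gnadd V0 e0 ew eadd e00 Apx al0 (ltW alt) (powR_ge0 _ _) r1.
rewrite -/rho e_exp => h.
have B0 : 0 <= N * gam [::] `^ p^-1 * e [::] `^ (1 - q^-1) by rewrite !mulr_ge0 ?powR_ge0.
apply: le_trans (ler_wpM2l Lam0 (le_trans h (ler_wpM2r B0 Grho))); rewrite mulr_sumr; apply: ler_sum => s _.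
have -> : Lam * (rho ^+ size s * (wd s `^ alpha * (gn s / V s) * e s)) =
  Lam * wd s `^ alpha * rho ^+ size s * (gn s / V s) * e s by ring.
by rewrite !ler_wpM2r ?side_bound// divr_ge0// ltW.
Qed.

(** Only rho <= 1 is kept from the generation factor, so eps = 0 is allowed. The decay above e0 in
    [tree_bound] has exponent 1/p - alpha = 1/q, and 4 W is twice the path bound 2 W. *)
Lemma tree_constant_Ainfty : 0 < alpha -> (Ainfty_const w < +oo)%E ->
  tree_constant (4 * ((1 - 2 `^ (- alpha))^-1 + (1 - 2 `^ (- q^-1))^-1) * (4 * W) `^ (1 - p^-1)).
Proof.
move=> al_gt0 Woo K e e0 ew eadd e00.
have := tree_bound p1 N0 D2 wd0 wadd gam0 gadd gn0 gnadd V0 Vc e0 ew eadd e00 Apx al_gt0 alt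
  (fun v s => path_sum_Ainfty l0 ww wi v s d_gt0 Woo).
rewrite e_exp => h.
have rho1 : rho <= 1.
  by apply: (le_trans rho_le); rewrite gerBl divr_ge0// mulr_ge0// ltW.
have -> : 4 * ((1 - 2 `^ (- alpha))^-1 + (1 - 2 `^ (- q^-1))^-1) * (4 * W) `^ (1 - p^-1) *
    (N * gam [::] `^ p^-1 * e [::] `^ (1 - q^-1)) =
    4 * ((1 - 2 `^ (- alpha))^-1 + (1 - 2 `^ (- (p^-1 - alpha)))^-1) * N *
    (2 * (2 * W)) `^ (1 - p^-1) * gam [::] `^ p^-1 * e [::] `^ (1 - q^-1).
  have -> : p^-1 - alpha = q^-1 by rewrite /alpha; ring.
  have -> : 2 * (2 * W) = 4 * W by ring.
  ring.
apply: le_trans (ler_wpM2l Lam0 h); rewrite mulr_sumr; apply: ler_sum => s _.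
have -> : Lam * (wd s `^ alpha * (gn s / V s) * e s) =
  Lam * wd s `^ alpha * (gn s / V s) * e s by ring.
rewrite ler_wpM2r// ler_wpM2r ?divr_ge0 ?(ltW (V0 s))//.
apply: (le_trans (side_bound s)); rewrite ler_piMr ?mulr_ge0 ?powR_ge0//.
by rewrite exprn_ile1 ?powR_ge0.
Qed.

(** With a vanishing gradient every average is 0. This serves the case of an infinite A_infty
    constant. *)
Lemma tree_constant0 : gam [::] = 0 -> tree_constant 1.
Proof.
move=> g0 K e e0 ew eadd e00.
have gn00 : gn [::] = 0.
  apply/le_anti; rewrite gn0 andbT gnadd.
  have := Apx [::] xpredT; rewrite -gadd g0 powR0 ?mulr0// invr_neq0// gt_eqF//.
have gns s : gn s = 0.
  elim: s => [//|x s IH]; apply/le_anti; rewrite gn0 andbT.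
  by rewrite -IH [leRHS]gnadd (bigD1 x)//= lerDl sumr_ge0.
rewrite big1; last by move=> s _; rewrite gns mul0r mulr0 mul0r.
by rewrite !mulr_ge0 ?powR_ge0.
Qed.

End gradient.

Section truncation.
Variables (f : Rd -> R) (g : 'I_d -> Rd -> R).
Hypotheses (fi : itg Q f) (gi : forall i, itg Q (g i)) (fg : forall i, weak_partial Q i f (g i)).
Variables (T : R -> R) (J : set R) (eta : R).
Hypotheses (T_lip : forall x y, `|T x - T y| <= `|x - y|) (mJ : measurable J) (eta0 : 0 < eta).
Hypothesis T_cst : forall x y z, T y <> T z -> `|x - y| <= eta -> `|x - z| <= eta -> J x.

Let GJ x := \sum_i (`|g i x| * \1_J (f x)).
Let phi (s : seq X) := avg (dcube a l s) (T \o f).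
Let mQ : measurable Q. Proof. exact: cube_measurable. Qed.
Let Qoo : (mu Q < +oo)%E. Proof. exact: leb_cubeoo (ltW l0). Qed.

Lemma dcube_poincare (s : seq X) (x : X) :
  `|phi (x :: s) - phi s| <=
  2 ^+ d * l * ((2 ^+ size s)^-1 * ((\int[mu]_(y in dcube a l s) GJ y) / side l s ^+ d)).
Proof.
have := child_poincare mQ fi gi fg T_lip mJ eta0 T_cst (side_gt0 l0 s)
  (@dcube_sub_root _ _ a l l0 s) x.
rewrite /phi dcube_child; congr (_ <= _).
have -> : \int[mu]_(y in cube (corner a l s) (side l s)) \sum_i (`|g i y| * \1_J (f y)) =
  \int[mu]_(y in dcube a l s) GJ y by [].
by rewrite {1}/side; ring.
Qed.

(** A deviation above 2 T0 forces either the average over the leaf to deviate from the average over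
    Q by more than T0, which [tree_weak_type] controls with r = 1/q, or T o f to deviate from its
    leaf average by more than T0. The w-measure of the second set tends to 0 with the size of the
    leaves. *)
Lemma truncated_weak_type (Gc T0 : R) : 0 < T0 -> 0 <= Gc -> tree_constant GJ Gc ->
  \int[mu]_(x in Q) (w x * ((2 * T0 < `|T (f x) - avg Q (T \o f)|)%R : bool)%:R) <=
  (2 ^+ d * l * (Lam * (Gc * (N * (\int[mu]_(x in Q) (GJ x `^ p * w x)) `^ p^-1))) / T0) `^ q.
Proof.
move=> T00 Gc0 HG; set B := 2 ^+ d * _ * _.
have B0 : 0 <= B.
  apply: mulr_ge0; first by rewrite mulr_ge0 ?exprn_ge0 ?ltW.
  by do !(apply: mulr_ge0 => //; try exact: powR_ge0).
have Tfi : itg Q (T \o f) := itg_truncation T_lip mQ Qoo fi.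
set S := \int[mu]_(x in Q) _; apply/ler_addgt0Pr => tau tau0.
have [e e0 He] := fine_cells_exceptional mQ Qoo Tfi wi T00 tau0.
have [K Kl] : exists K : nat, l / 2 ^+ K <= e.
  have [K hK] := dyadic_scale (l / e); exists K.
  by rewrite ler_pdivrMr ?exprn_gt0// mulrC -ler_pdivrMr.
have hK := He _ _ _ (leaves_fine_cells a l0 Kl).
have bnd : T0 * (\sum_(s <- leaves K [::] | T0 < `|phi s - phi [::]|) wd s) `^ q^-1 <= B.
  apply: tree_weak_type (ltW T00).
  - exact: wd0.
  - by move=> s; exact: dcube_integral.
  - by move=> s x _; exact: dcube_poincare.
  - by rewrite invr_gt0 q0 invf_le1// (le_trans p1).
  - exact: B0.
  - move=> h h0 hw hadd h00; have HK := HG K h h0 hw hadd h00.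
    rewrite (eq_bigr (fun s => 2 ^+ d * l * ((2 ^+ size s)^-1 *
      ((\int[mu]_(y in dcube a l s) GJ y) / side l s ^+ d) * h s))); last first.
      by move=> s _; rewrite !mulrA.
    rewrite -mulr_sumr /B -[leRHS]mulrA; apply: ler_wpM2l.
      by rewrite mulr_ge0 ?exprn_ge0 ?ltW.
    apply: (le_trans HK); rewrite dcube_nil -!mulrA//.
set E := \sum_(s <- _ | _) _ in bnd.
have E0 : 0 <= E by apply: sumr_ge0 => s _; exact: ltW (wd0 s).
have EB : E <= (B / T0) `^ q.
  rewrite -[E](@powRVK _ q) ?gt_eqF//; apply: powR_le_base; rewrite ?powR_ge0 ?(ltW q0)//.
  by rewrite ler_pdivlMr// mulrC.
apply: le_trans (lerD EB hK).
have mTf : measurable_fun Q (T \o f) := itg_mfun Tfi.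
have mdev (D : set Rd) (c t : R) : measurable D -> D `<=` Q ->
    measurable_fun D (fun x => (t < `|T (f x) - c|)%R).
  move=> mD DQ; apply: measurable_fun_ltr; first exact: measurable_cst.
  apply: (measurableT_comp (@normr_measurable R setT)).
  by apply: measurable_funB; [apply: measurable_funS mQ DQ mTf|exact: measurable_cst].
have Si : itg Q (fun x => w x * ((2 * T0 < `|T (f x) - avg Q (T \o f)|)%R : bool)%:R).
  by apply: itg_bool mQ wi _; apply: mdev.
rewrite -(big_mkord xpredT (fun i => \int[mu]_(x in dcube a l (nth [::] (leaves K [::]) i))
   (`|w x| * ((T0 < `|(T \o f) x - phi (nth [::] (leaves K [::]) i)|)%R : bool)%:R))).
rewrite -(big_nth [::] xpredT (fun s => \int[mu]_(x in dcube a l s)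
   (`|w x| * ((T0 < `|(T \o f) x - phi s|)%R : bool)%:R))).
pose h s := \int[mu]_(x in dcube a l s) (w x * ((2 * T0 < `|T (f x) - avg Q (T \o f)|)%R : bool)%:R).
have -> : S = \sum_(s <- leaves K [::]) h s.
  have hadd : additive_below K h by move=> s _; exact: dcube_integral.
  rewrite (@sum_leaves_additive _ _ K h K [::] hadd (leqnn K)) /h.
  by rewrite [dcube a l [::]]dcube_nil.
apply: sum_le_cond_add => s.
have ms := dcube_measurable a l s; have ws : itg (dcube a l s) w by exact: dcube_itg.
have sQ := @dcube_sub_root _ _ a l l0 s.
have i1 : itg (dcube a l s) (fun x => w x * ((2 * T0 < `|T (f x) - avg Q (T \o f)|)%R : bool)%:R).
  exact: itgS ms mQ sQ Si.
have i2 : itg (dcube a l s) (fun x => `|w x| * ((T0 < `|(T \o f) x - phi s|)%R : bool)%:R).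
  exact: itg_bool ms (itg_norm ms ws) (mdev _ _ _ ms sQ).
have i3 : itg (dcube a l s) (fun x => w x * ((T0 < `|phi s - phi [::]|)%R : bool)%:R).
  by apply: itg_bool ms ws _; exact: measurable_cst.
have -> : (if T0 < `|phi s - phi [::]| then wd s else 0) =
    \int[mu]_(x in dcube a l s) (w x * ((T0 < `|phi s - phi [::]|)%R : bool)%:R).
  rewrite (RintegralZr _ ms ws); case: ifP => _; by rewrite ?mulr1 ?mulr0.
rewrite -(RintegralD ms i3 i2); apply: (Rint_mono ms i1 (itgD ms i3 i2)).
move=> x sx; have w0 : 0 < w x by exact: ww.2.
rewrite (gtr0_norm w0) -mulrDr ler_wpM2l ?(ltW w0)//.
have -> : avg Q (T \o f) = phi [::] by rewrite /phi dcube_nil.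
exact: deviation_split.
Qed.

End truncation.
End weak_type.

(** * Layer cake and mean oscillation *)

Section layer_cake.
Context {dT : measure_display} {T : measurableType dT} {R : realType}.
Variable mu : {measure set T -> \bar R}.
Local Notation itg D f := (mu.-integrable D (EFin \o f)).
Variables (D : set T) (h w : T -> R) (s q : R).
Hypotheses (mD : measurable D) (mh : measurable_fun D h) (h0 : forall x, 0 <= h x).
Hypotheses (wi : itg D w) (w0 : forall x, 0 <= w x) (s0 : 0 < s) (q0 : 0 < q).

Let t (n : nat) : R := 16 ^+ n * s.
Let F n x := h x `^ q * w x * ((h x <= t n)%R : bool)%:R.
Let L n x := w x * ((t n < h x)%R : bool)%:R.

Let t_gt0 n : 0 < t n. Proof. by rewrite mulr_gt0 ?exprn_gt0. Qed.
Let tS n : t n.+1 = 16 * t n. Proof. by rewrite /t exprS mulrA. Qed.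
Let hw0 x : 0 <= h x `^ q * w x. Proof. by rewrite mulr_ge0 ?powR_ge0. Qed.

Let mhw : measurable_fun D (fun x => h x `^ q * w x).
Proof.
by apply: measurable_funM (itg_mfun wi); apply: measurableT_comp (measurable_powR _) mh.
Qed.

Let mF n : measurable_fun D (F n).
Proof.
apply: measurable_funM mhw _.
apply: (@measurableT_comp _ _ _ _ _ _ (fun c : bool => c%:R : R)) => //.
by apply: measurable_fun_ler => //; exact: measurable_cst.
Qed.

(** On the shell between two consecutive levels, h^q is at most the q-th power of the upper level 16
    t. *)
Let F_step n x : F n.+1 x <= F n x + (16 `^ q * t n `^ q) * L n x.
Proof.
have h1 : t n <= t n.+1 by rewrite tS ler_peMl ?(ltW (t_gt0 _)) ?ler1n.
have c0 : 0 <= 16 `^ q * t n `^ q by rewrite mulr_ge0 ?powR_ge0.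
rewrite /F /L; case: (ltP (t n) (h x)) => htn; last by rewrite (le_trans htn h1) !mulr0 addr0.
rewrite mulr0 add0r mulr1; case: (leP (h x) (t n.+1)) => htn1; last by rewrite mulr0 mulr_ge0.
rewrite mulr1 ler_wpM2r// -powRM ?(ltW (t_gt0 n))// -tS.
by rewrite ge0_ler_powR ?nnegrE ?(ltW q0) ?(ltW (t_gt0 _)).
Qed.

Let Li n : itg D (L n).
Proof. by apply: itg_bool mD wi _; apply: measurable_fun_ltr => //; exact: measurable_cst. Qed.

Let F_itg n : itg D (F n) /\
  \int[mu]_(x in D) F n x <=
  s `^ q * \int[mu]_(x in D) w x + 16 `^ q * \sum_(k < n) t k `^ q * \int[mu]_(x in D) L k x.
Proof.
have Fn0 m x : 0 <= F m x by rewrite mulr_ge0.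
elim: n => [|n [IHi IH]].
  have si : itg D (fun x => s `^ q * w x) by exact: itgZ.
  have Fw x : D x -> `|F 0 x| <= s `^ q * w x.
    move=> _; rewrite ger0_norm// /F /t expr0 mul1r; case: (leP (h x) s) => hs; last first.
      by rewrite mulr0 mulr_ge0 ?powR_ge0.
    by rewrite mulr1 ler_wpM2r// ge0_ler_powR ?nnegrE ?(ltW q0) ?(ltW s0).
  have Fi := itg_le mD (mF 0%N) Fw si.
  split=> //; rewrite big_ord0 mulr0 addr0 -RintegralZl//.
  by apply: Rint_mono => // x Dx; rewrite (le_trans _ (Fw _ Dx)) ?ler_norm.
have Zi := itgZ (16 `^ q * t n `^ q) mD (Li n).
have Si := itgD mD IHi Zi.
have Fi : itg D (F n.+1).
  by apply: (itg_le mD (mF n.+1) _ Si) => x _; rewrite ger0_norm ?Fn0//; exact: F_step.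
split=> //; apply: (@le_trans _ _ (\int[mu]_(x in D) (F n x + 16 `^ q * t n `^ q * L n x))).
  by apply: Rint_mono => // x _; exact: F_step.
rewrite RintegralD// RintegralZl// big_ord_recr/= mulrDr addrA; apply: lerD => //.
by rewrite mulrA.
Qed.

(** Integrability of h^q w is not known in advance. It is obtained by monotone convergence from the
    parts below the levels, whose integrals are bounded uniformly. *)
Lemma layer_cake (M : R) :
  (forall n, \sum_(k < n) t k `^ q * \int[mu]_(x in D) L k x <= M) ->
  (\int[mu]_(x in D) (h x `^ q * w x)%:E <=
   (s `^ q * \int[mu]_(x in D) w x + 16 `^ q * M)%:E)%E.
Proof.
move=> HM; have tinc x : exists N, h x <= t N.
  have [n hn] := dyadic_scale (h x / s); exists n.
  rewrite ler_pdivrMr// in hn; apply: (le_trans hn); rewrite ler_wpM2r ?(ltW s0)//.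
  by apply: lerXn2r; rewrite ?nnegrE//; lra.
have tm n m : (n <= m)%N -> t n <= t m.
  by move=> nm; rewrite ler_wpM2r ?(ltW s0)// ler_weXn2l// ler1n.
have Fhom x : {homo (fun n => (F n x)%:E) : n m / (n <= m)%N >-> (n <= m)%E}.
  move=> n m /tm nm; rewrite lee_fin ler_wpM2l//.
  by case: (leP (h x) (t n)) => [hn|_]; rewrite ?ler0n// (le_trans hn nm).
have := @cvg_monotone_convergence _ _ _ mu D mD (fun n x => (F n x)%:E).
have -> : (\int[mu]_(x in D) (h x `^ q * w x)%:E =
    \int[mu]_(x in D) (fun x0 => limn (fun n => (F n x0)%:E)) x)%E.
  apply: eq_integral => x _; apply/esym/cvg_lim => //.
  apply: cvg_near_cst; have [N hN] := tinc x; exists N => // n /= Nn.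
  by rewrite /F (le_trans hN (tm _ _ Nn)) mulr1.
move=> H; have {}H : (\int[mu]_(x in D) (F n x)%:E)%E @[n --> \oo] -->
    (\int[mu]_(x in D) (fun x0 => limn (fun n => (F n x0)%:E)) x)%E.
  apply: H.
  - by move=> n; apply/measurable_EFinP.
  - by move=> n x _; rewrite lee_fin mulr_ge0.
  - by move=> x _; exact: Fhom.
rewrite -(cvg_lim _ H)//; apply: lime_le; first by apply/cvg_ex; eexists; exact: H.
apply: nearW => n; have [Fi Fle] := F_itg n.
rewrite Rint_EFin// lee_fin (le_trans Fle)// lerD2l ler_wpM2l ?powR_ge0//.
Qed.
End layer_cake.
Lemma geometric_half (R : realType) (K : nat) : \sum_(k < K) (2^-1) ^+ k <= 2 :> R.
Proof.
have h0 : 0 <= 2^-1 :> R by rewrite invr_ge0.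
have h1 : 2^-1 < 1 :> R by lra.
have e : (1 - 2^-1)^-1 = 2 :> R by field.
by rewrite -[leRHS]e; exact: geometric_sum_le.
Qed.

(** * Unweighted mean oscillation *)

Section oscillation.
Context {R : realType} {d : nat}.
Local Notation mu := (leb R d).
Local Notation Rd := (caratheodory_type (borel_lebesgue R d)^*%mu).
Local Notation itg D f := (mu.-integrable D (EFin \o f)).
Local Notation X := {ffun 'I_d -> 'I_2}.
Variables (a : 'rV[R]_d) (l : R) (f : Rd -> R) (g : 'I_d -> Rd -> R).
Hypothesis l0 : 0 < l.
Let Q : set Rd := cube a l.
Hypotheses (fi : itg Q f) (gi : forall i, itg Q (g i)) (fg : forall i, weak_partial Q i f (g i)).

Let mQ : measurable Q. Proof. exact: cube_measurable. Qed.
Let Qoo : (mu Q < +oo)%E. Proof. exact: leb_cubeoo (ltW l0). Qed.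

(** Telescoping with Lebesgue measure in place of e: the factors 2^(-k) of the generations sum to at
    most 2. The estimate tells from which level on the average of a truncation is negligible. *)
Lemma mean_oscillation : \int[mu]_(x in Q) `|f x - avg Q f| <=
  2 ^+ d * l * (2 * \int[mu]_(x in Q) \sum_i `|g i x|).
Proof.
apply/ler_addgt0Pr => tau tau0.
have [e e0 He] := fine_cells_L1 mQ Qoo fi tau0.
have [K Kl] : exists K : nat, l / 2 ^+ K <= e.
  have [K hK] := dyadic_scale (l / e); exists K.
  by rewrite ler_pdivrMr ?exprn_gt0// mulrC -ler_pdivrMr.
have hK := He _ _ _ (leaves_fine_cells a l0 Kl).
pose phi (s : seq X) := avg (dcube a l s) f.
pose G x := \sum_i `|g i x|; pose gn (s : seq X) := \int[mu]_(x in dcube a l s) G x.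
have Gi : itg Q G by apply: itg_sum => // i; exact: itg_norm.
have G0 x : 0 <= G x by exact: sumr_ge0.
pose V (s : seq X) := side l s ^+ d.
have VE s : V s = \int[mu]_(x in dcube a l s) 1.
  rewrite Rintegral_cst; last exact: dcube_measurable.
  by rewrite [X in fine X](leb_dcube a l0) mul1r.
have V0 s : 0 < V s by rewrite exprn_gt0 ?side_gt0.
have oi : itg Q (fun=> 1 : R) by exact: itg_cst.
have Vadd : additive_below K V.
  move=> s _; rewrite VE (dcube_integral l0 s oi); apply: eq_bigr => x _; exact/esym/VE.
pose b (s : seq X) := 2 ^+ d * l * ((2 ^+ size s)^-1 * (gn s / V s)).
have phib s x : (size s < K)%N -> `|phi (x :: s) - phi s| <= b s.
  move=> _; have -> : b s = 2 ^+ d * l * ((2 ^+ size s)^-1 *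
      ((\int[mu]_(y in dcube a l s) \sum_i (`|g i y| * \1_[set: R] (f y))) / V s)).
    rewrite /b /gn (_ : G = fun y => \sum_i (`|g i y| * \1_[set: R] (f y)))//.
    by apply/funext => y; apply: eq_bigr => i _; rewrite indicE in_setT mulr1.
  (* No truncation here: T is the identity and J the whole line. *)
  exact: (@dcube_poincare R d a l l0 f g fi gi fg id setT 1 (fun _ _ => lexx _)
    measurableT ltr01 (fun _ _ _ _ _ _ => I) s x).
have tele := @telescoping_sum R X K phi b V (phi [::]) K [::] phib Vadd (fun s => ltW (V0 s)) (leqnn _).
rewrite subrr normr0 mul0r add0r in tele.
have gadd : additive_below K gn by move=> s _; exact: dcube_integral.
have gn0 s : 0 <= gn s by exact: Rintegral_ge0.
have nsum : \sum_(s <- nodes K [::]) b s * V s <= 2 ^+ d * l * (2 * gn [::]).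
  rewrite (eq_bigr (fun s => 2 ^+ d * l * ((2 ^+ size s)^-1 * gn s))); last first.
    by move=> s _; rewrite /b -!mulrA mulVf ?mulr1 ?gt_eqF.
  rewrite -mulr_sumr ler_wpM2l ?mulr_ge0 ?(ltW l0)// sum_nodes_levels.
  rewrite (eq_bigr (fun k : 'I_K => (2^-1) ^+ k * gn [::])); last first.
    move=> k _; rewrite -(@sum_leaves_additive _ _ K gn k [::] gadd (ltnW (ltn_ord k))) mulr_sumr.
    rewrite big_seq [RHS]big_seq; apply: eq_bigr => s /size_leaves ->.
    by rewrite add0n exprVn.
  rewrite -mulr_suml ler_wpM2r//.
  exact: geometric_half.
have osc s : \int[mu]_(x in dcube a l s) `|f x - avg Q f| <=
    `|phi s - phi [::]| * V s + \int[mu]_(x in dcube a l s) `|f x - phi s|.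
  have ms := dcube_measurable a l s; have fs := dcube_itg l0 s fi.
  have os c : itg (dcube a l s) (fun=> c : R) by apply: itg_cst ms (dcubeoo a l0 s).
  have di c : itg (dcube a l s) (fun x => `|f x - c|) := itg_norm ms (itgB ms fs (os c)).
  have -> : `|phi s - phi [::]| * V s = \int[mu]_(x in dcube a l s) `|phi s - phi [::]|.
    by rewrite Rintegral_cst// [X in fine X](leb_dcube a l0).
  rewrite -(RintegralD ms (os _) (di _)); apply: (Rint_mono ms (di _) (itgD ms (os _) (di _))).
  move=> x _; have -> : avg Q f = phi [::] by rewrite /phi dcube_nil.
  have -> : f x - phi [::] = (phi s - phi [::]) + (f x - phi s) by rewrite [RHS]addrC addrA subrK.
  exact: ler_normD.
pose h (s : seq X) := \int[mu]_(x in dcube a l s) `|f x - avg Q f|.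
have hadd : additive_below K h.
  move=> s _; apply: (dcube_integral l0 s); apply: itg_norm => //; apply: itgB => //; exact: itg_cst.
have -> : \int[mu]_(x in Q) `|f x - avg Q f| = \sum_(s <- leaves K [::]) h s.
  rewrite (@sum_leaves_additive _ _ K h K [::] hadd (leqnn K)) /h.
  by rewrite [dcube a l [::]]dcube_nil.
apply: (@le_trans _ _ (\sum_(s <- leaves K [::]) `|phi s - phi [::]| * V s +
   \sum_(s <- leaves K [::]) \int[mu]_(x in dcube a l s) `|f x - phi s|)).
  by rewrite -big_split; apply: ler_sum => s _; exact: osc.
apply: lerD; last first.
  by rewrite (big_nth [::]) big_mkord; exact: hK.
have gnE : gn [::] = \int[mu]_(x in Q) G x by rewrite /gn dcube_nil.
by rewrite gnE in nsum; exact: le_trans tele nsum.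
Qed.
End oscillation.

(** * Strong type estimate *)

Section truncation_function.
Context {R : realType}.
Variables (c t : R).
Hypothesis t0 : 0 < t.

(** As a function of |z - c| this is a ramp: 0 up to t/2, slope 1 from t/2 to t, and constant t/2
    from t on. *)
Definition trunc (z : R) := Num.min (t / 2) (Num.max 0 (`|z - c| - t / 2)).
(** The ramp zone from t/2 to t, enlarged so that errors of size t/8 (the eta of the truncated
    estimates) stay inside. *)
Definition trunc_level : set R := [set z | t / 4 <= `|z - c| <= 2 * t].

Lemma trunc_lipschitz x y : `|trunc x - trunc y| <= `|x - y|.
Proof.
apply: (le_trans (min_lipschitz _ _ _)); apply: (le_trans (max_lipschitz _ _ _)).
have -> : `|x - c| - t / 2 - (`|y - c| - t / 2) = `|x - c| - `|y - c| by ring.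
apply: (le_trans (ler_dist_dist _ _)).
by have -> : x - c - (y - c) = x - y by ring.
Qed.

Lemma trunc_ge0 z : 0 <= trunc z.
Proof. by rewrite /trunc le_min le_max lexx divr_ge0 ?(ltW t0). Qed.

Lemma trunc_le z : trunc z <= `|z - c|.
Proof.
rewrite /trunc ge_min ge_max normr_ge0/= gerBl divr_ge0 ?orbT//; exact: ltW.
Qed.

Lemma trunc_top z : t < `|z - c| -> trunc z = t / 2.
Proof.
by move=> h; rewrite /trunc; apply: min_l; rewrite le_max; apply/orP; right; lra.
Qed.

Lemma trunc_bot z : `|z - c| <= t / 2 -> trunc z = 0.
Proof.
move=> h; rewrite /trunc max_l ?subr_le0// min_r// divr_ge0//; exact: ltW.
Qed.

Lemma trunc_level_cst x y z : trunc y <> trunc z -> `|x - y| <= t / 8 -> `|x - z| <= t / 8 ->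
  trunc_level x.
Proof.
move=> yz xy xz; have dy : `| `|x - c| - `|y - c| | <= t / 8.
  apply: le_trans xy; apply: (le_trans (ler_dist_dist _ _)).
  by have -> : x - c - (y - c) = x - y by ring.
have dz : `| `|x - c| - `|z - c| | <= t / 8.
  apply: le_trans xz; apply: (le_trans (ler_dist_dist _ _)).
  by have -> : x - c - (z - c) = x - z by ring.
move: dy dz; rewrite !ler_norml => /andP[y1 y2] /andP[z1 z2].
apply/andP; split; rewrite leNgt; apply/negP => h; apply: yz.
  by rewrite !trunc_bot//; lra.
by rewrite !trunc_top//; lra.
Qed.

Lemma measurable_trunc_level : measurable trunc_level.
Proof.
have -> : trunc_level = (fun z => `|z - c|) @^-1` `[t / 4, 2 * t]%classic.
  by apply/seteqP; split => z; rewrite /trunc_level /= in_itv.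
rewrite -[X in measurable X]setTI.
have m : measurable_fun setT (fun z : R => `|z - c|).
  by apply: (measurableT_comp (@normr_measurable R setT)); apply: measurable_funB.
exact: m.
Qed.
End truncation_function.

Lemma scales_absurd (R : realType) (x y v : R) :
  0 < x -> v <= 2 * x -> y / 4 <= v -> 16 * x <= y -> False.
Proof. by move=> *; lra. Qed.

(** The ratio 16 separates the levels: 2 t is less than 16 t / 4. *)
Lemma trunc_level_disjoint (R : realType) (c s : R) (j k : nat) z : 0 < s ->
  trunc_level c (16 ^+ j * s) z -> trunc_level c (16 ^+ k * s) z -> j = k.
Proof.
move=> s0.
have lt i i' : trunc_level c (16 ^+ i * s) z -> trunc_level c (16 ^+ i' * s) z -> (i < i')%N -> False.
  move=> /andP[_ h1] /andP[h2 _] ii.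
  have : 16 ^+ i.+1 <= 16 ^+ i' :> R by rewrite ler_weXn2l ?ler1n.
  rewrite -(ler_pM2r s0) exprS => h3; have : 0 < 16 ^+ i * s by rewrite mulr_gt0 ?exprn_gt0.
  by move=> x0; rewrite -mulrA in h3; exact: (scales_absurd x0 h1 h2 h3).
by move=> h1 h2; case: (ltngtP j k) => // h; [case: (lt _ _ h1 h2 h)|case: (lt _ _ h2 h1 h)].
Qed.

Lemma sum_trunc_level_le1 (R : realType) (c s z : R) (n : nat) : 0 < s ->
  \sum_(k < n) \1_(trunc_level c (16 ^+ k * s)) z <= 1 :> R.
Proof.
move=> s0; have [[k zk]|H] := pselect (exists k : 'I_n, trunc_level c (16 ^+ k * s) z).
  rewrite (bigD1 k)//= big1 ?addr0; last first.
    move=> j jk; rewrite indicE memNset// => zj; move/eqP: jk; apply; apply: val_inj.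
    exact: trunc_level_disjoint s0 zj zk.
  by rewrite indicE; case: (_ \in _).
rewrite big1// => k _; rewrite indicE memNset// => zk; apply: H; by exists k.
Qed.

Lemma level_gap (R : realType) (t phi : R) : 0 < t -> 0 <= phi -> 8 * phi <= t ->
  2 * (t / 8) < `|t / 2 - phi|.
Proof. by move=> *; rewrite ger0_norm; lra. Qed.

(** Each x_i^(s-1) is at most the same power of the total. Used with s = q/p to add up the weak type
    estimates, which is where p <= q enters. *)
Lemma sum_powR_le (R : realType) (I : Type) (r : seq I) (x : I -> R) (s : R) :
  1 <= s -> (forall i, 0 <= x i) -> \sum_(i <- r) x i `^ s <= (\sum_(i <- r) x i) `^ s.
Proof.
move=> s1 x0; have s0 : 0 < s by exact: lt_le_trans s1.
elim: r => [|i r IH]; first by rewrite !big_nil powR0 ?gt_eqF.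
rewrite !big_cons; apply: (le_trans (lerD (lexx _) IH)).
have S0 : 0 <= \sum_(j <- r) x j by exact: sumr_ge0.
set S := \sum_(j <- r) x j in S0 *; have xS0 := addr_ge0 (x0 i) S0.
rewrite -(mulr_powRB1 (x0 i) s0) -(mulr_powRB1 S0 s0) -(mulr_powRB1 xS0 s0) mulrDl.
by apply: lerD; apply: ler_wpM2l => //; apply: powR_le_base => //; rewrite ?subr_ge0 ?lerDl ?lerDr.
Qed.

Lemma powR_ge1 (R : realType) (x r : R) : 1 <= x -> 0 <= r -> 1 <= x `^ r.
Proof. by move=> x1 r0; rewrite -[leLHS](congr1 (@^~ r) (powR1 R)); apply: powR_le_base. Qed.

Lemma oscillation_arith (R : realType) (D L l v gam N Gc A t O I : R) :
  0 < L -> 0 < l -> 0 < v -> 0 <= gam -> 0 <= N -> 1 <= Gc -> 1 <= A -> 0 <= D ->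
  O <= D * l * (2 * I) -> I <= N * L * v `^ (- t) * gam `^ t ->
  L^-1 * O <= D * 2 * (l * N * A * Gc * (gam / v) `^ t).
Proof.
move=> L0 l0 v0 g0 N0 G1 A1 D0 h1 h2; rewrite mulrC ler_pdivrMr//.
have -> : (gam / v) `^ t = v `^ (- t) * gam `^ t.
  by rewrite powRM ?invr_ge0 ?(ltW v0)// -(powR_inv1 (ltW v0)) -powRrM mulN1r mulrC.
set X := v `^ (- t) * gam `^ t; have X0 : 0 <= X by rewrite mulr_ge0 ?powR_ge0.
rewrite -mulrA -/X in h2.
apply: (le_trans h1); apply: (@le_trans _ _ (D * l * (2 * (N * L * X)))).
  by rewrite !ler_wpM2l// mulr_ge0// ltW.
have -> : D * 2 * (l * N * A * Gc * X) * L = D * l * (2 * (N * L * X)) * (A * Gc) by ring.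
have AG : 1 <= A * Gc by rewrite -[leLHS]mulr1 ler_pM.
rewrite ler_peMr//; apply: mulr_ge0; first by rewrite mulr_ge0// ltW.
by rewrite mulr_ge0// mulr_ge0// mulr_ge0// ltW.
Qed.

Lemma scaling_identity (R : realType) (D l Au v Gc N gam p r : R) : 0 <= Au -> 0 < v -> 0 <= gam ->
  D * l * ((Au / v) `^ (p - r) * (Gc * N)) * gam `^ p =
  D * (l * N * Au `^ (p - r) * Gc * (gam / v) `^ p) * v `^ r.
Proof.
move=> A0 v0 g0; have vi : 0 <= v^-1 by rewrite invr_ge0 ltW.
rewrite !powRM// -!(powR_inv1 (ltW v0)) -!powRrM.
have e : v `^ (-1 * (p - r)) = v `^ (-1 * p) * v `^ r.
  by rewrite -powRD ?(gt_eqF v0) ?implybT//; congr (_ `^ _); ring.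
by rewrite e; ring.
Qed.

Lemma powR_swap (R : realType) (x p q : R) : x `^ (q / p) = (x `^ p^-1) `^ q.
Proof. by rewrite -powRrM mulrC. Qed.

Lemma rescaled_power (R : realType) (t B g q : R) : 0 < t -> 0 <= B -> 0 <= g ->
  t `^ q * (B * g / (t / 8)) `^ q = (8 * B) `^ q * g `^ q.
Proof.
move=> t0 B0 g0; have t8 : 0 <= (t / 8)^-1 by rewrite invr_ge0 divr_ge0// ltW.
have Bg : 0 <= B * g by exact: mulr_ge0.
have BgT : 0 <= B * g / (t / 8) by exact: mulr_ge0.
have B8 : 0 <= 8 * B by rewrite mulr_ge0.
rewrite -(powRM q (ltW t0) BgT) -(powRM q B8 g0); congr (_ `^ _).
by field; rewrite gt_eqF.
Qed.

Lemma normalized_root_le (R : realType) (v y q : R) (I : \bar R) :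
  0 < v -> 0 <= y -> 0 < q -> (0 <= I)%E -> (I <= (v * y `^ q)%:E)%E ->
  (((v^-1)%R%:E * I) `^ q^-1 <= y%:E)%E.
Proof.
move=> v0 y0 q0 I0 Iv; have qi0 : 0 <= q^-1 by rewrite invr_ge0 ltW.
have vi0 : 0 <= v^-1 by rewrite invr_ge0 ltW.
have -> : y%:E = (((v^-1)%R%:E * (v * y `^ q)%R%:E) `^ q^-1)%E.
  by rewrite -EFinM mulrA mulVf ?gt_eqF// mul1r poweR_EFin powRK ?gt_eqF.
apply: (gt0_ler_poweR qi0).
- by rewrite in_itv/= leey andbT mule_ge0.
- by rewrite in_itv/= leey andbT mule_ge0// lee_fin mulr_ge0 ?powR_ge0// ltW.
by apply: lee_wpmul2l; rewrite ?lee_fin.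
Qed.

(** The first level s has to exceed 8 dev and to balance the two terms of the layer cake bound. The
    factor 16 of the levels and the 8 from testing at height t/8 give 128 = 16 * 8; the final 2 in
    256 comes from adding two equal terms. *)
Lemma strong_choice (R : realType) (D Z v B g dev tau q : R) :
  0 < v -> 0 <= Z -> 0 <= B -> 0 <= g -> 0 <= D -> 1 <= q ->
  B * g = D * Z * v `^ q^-1 -> dev <= D * 2 * Z -> 0 < tau ->
  exists s, [/\ 0 < s, 8 * dev <= s &
    s `^ q * v + 16 `^ q * ((8 * B) `^ q * g `^ q) <= v * (256 * D * Z + tau) `^ q].
Proof.
move=> v0 Z0 B0 g0 D0 q1 BgE devle tau0; have q0 : 0 < q by exact: lt_le_trans q1.
have DZ : 0 <= D * Z by exact: mulr_ge0.
set y := D * Z in DZ BgE; have yE : 256 * D * Z = 256 * y by rewrite /y mulrA.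
have dev2 : dev <= 2 * y by rewrite /y mulrA [2 * D]mulrC.
(* The summand tau / 2 keeps s positive when Z = 0. *)
exists (128 * y + tau / 2); have s0 : 0 < 128 * y + tau / 2 by lra.
split=> //; first lra.
have -> : 256 * D * Z + tau = 2 * (128 * y + tau / 2) by rewrite yE; field.
set s := 128 * y + tau / 2 in s0 *; have ys : 128 * y <= s by rewrite /s; lra.
have B8 : 0 <= 8 * B by rewrite mulr_ge0.
have y128 : 0 <= 128 * y by rewrite mulr_ge0.
have h16 : 0 <= 16 :> R by [].
rewrite -(powRM q B8 g0) -(powRM q h16 (mulr_ge0 B8 g0)).
have -> : 16 * (8 * B * g) = 128 * y * v `^ q^-1.
  by rewrite -[RHS]mulrA -BgE; ring.
rewrite (powRM q y128 (powR_ge0 _ _)) powRVK ?gt_eqF ?(ltW v0)// -mulrDl mulrC.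
rewrite ler_wpM2l ?(ltW v0)//; apply: (@le_trans _ _ (s `^ q + s `^ q)).
  by rewrite lerD2l; apply: powR_le_base; rewrite ?(ltW q0).
rewrite (powRM q (ler0n R 2) (ltW s0)).
have -> : s `^ q + s `^ q = 2 `^ 1 * s `^ q by rewrite powRr1//; ring.
by rewrite ler_wpM2r ?powR_ge0// ler_powR ?ler1n.
Qed.

(** * From weak type at all levels to the strong type *)

Section strong_type.
Context {R : realType} {d : nat}.
Local Notation mu := (leb R d).
Local Notation Rd := (caratheodory_type (borel_lebesgue R d)^*%mu).
Local Notation itg D f := (mu.-integrable D (EFin \o f)).
Variables (a : 'rV[R]_d) (l : R) (w : Rd -> R) (p q u : R).
Hypotheses (l0 : 0 < l) (p1 : 1 <= p) (pq : p <= q) (u1 : 1 <= u) (up : u <= p).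
Hypotheses (ww : weight w) (Auoo : (Ap_const u w < +oo)%E).
Let Q : set Rd := cube a l.
Variables (f : Rd -> R) (g : 'I_d -> Rd -> R).
Hypotheses (fi : itg Q f) (mg : forall i, lmeasurable_fun Q (g i)).
Hypothesis fg : forall i, weak_partial Q i f (g i).
Let G x := \sum_i `|g i x|.
Hypothesis Gi : itg Q (fun x => G x `^ p * w x).
Let Gtr (c t : R) x := \sum_i (`|g i x| * \1_(trunc_level c t) (f x)).
Variable Gc : R.
Hypothesis Gc1 : 1 <= Gc.
Let c := avg Q f.
Hypothesis HG : forall t, 0 < t -> tree_constant a l w p q u (Gtr c t) Gc.

Let N := fine (Ap_const p w) `^ p^-1.
Let wQ := \int[mu]_(x in Q) w x.
Let Lam := (fine (Ap_const u w) / wQ) `^ (p^-1 - q^-1).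
Let gam := \int[mu]_(x in Q) (G x `^ p * w x).
Let gamt t := \int[mu]_(x in Q) (Gtr c t x `^ p * w x).
Let p0 : 0 < p. Proof. exact: lt_le_trans p1. Qed.
Let q0 : 0 < q. Proof. exact: lt_le_trans pq. Qed.
Let Apoo : (Ap_const p w < +oo)%E.
Proof. exact: le_lt_trans (Ap_const_mono u1 up ww Auoo) Auoo. Qed.
Let wi : itg Q w. Proof. by have [] := Ap_cube a p1 ww Apoo l0. Qed.
Let mQ : measurable Q. Proof. exact: cube_measurable. Qed.
Let Qoo : (mu Q < +oo)%E. Proof. exact: leb_cubeoo (ltW l0). Qed.
Let wQ0 : 0 < wQ. Proof. exact: cube_weight_gt0. Qed.
Let G0 x : 0 <= G x. Proof. exact: sumr_ge0. Qed.
Let mng i : measurable_fun Q (fun x => `|g i x|).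
Proof. exact: measurableT_comp (@normr_measurable R setT) (mg i). Qed.
Let mG : measurable_fun Q G. Proof. by apply: measurable_sum. Qed.
Let B0 := 2 ^+ d * l * (Lam * (Gc * N)).

Let G1 : itg Q G /\ \int[mu]_(x in Q) G x <= N * l ^+ d * wQ `^ (- p^-1) * gam `^ p^-1.
Proof.
have nG : (fun x => `|G x| `^ p * w x) = (fun x => G x `^ p * w x).
  by apply/funext => x; rewrite ger0_norm.
have := Ap_key p1 ww Apoo l0 mG; rewrite nG => /(_ Gi)[Gi1]; split=> //.
by move: b; have -> : (fun x => `|G x|) = G by apply/funext => x; rewrite ger0_norm.
Qed.

Let gi i : itg Q (g i).
Proof.
apply: (itg_le mQ (mg i) _ G1.1) => x _; rewrite /G (bigD1 i)//= lerDl; exact: sumr_ge0.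
Qed.

Let Gtr_E t x : Gtr c t x = G x * \1_(trunc_level c t) (f x).
Proof. by rewrite /Gtr -mulr_suml. Qed.

Let Gtr_pow t x : Gtr c t x `^ p * w x = G x `^ p * w x * \1_(trunc_level c t) (f x).
Proof.
rewrite Gtr_E indicE; case: (_ \in _); rewrite ?mulr1 ?mulr0// powR0 ?mul0r// gt_eqF//.
Qed.

Let mlevel t : measurable_fun Q (fun x => \1_(trunc_level c t) (f x) : R).
Proof.
apply: (@measurableT_comp _ _ _ _ _ _ (\1_(trunc_level c t) : R -> R)); last exact: itg_mfun fi.
by apply: measurable_indic; exact: measurable_trunc_level.
Qed.

Let Gtr_itg t : itg Q (fun x => Gtr c t x `^ p * w x).
Proof.
rewrite (funext (Gtr_pow t)); apply: (@itg_mul_bounded _ _ _ _ _ _ _ 1 mQ Gi (mlevel t)).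
by move=> x _; rewrite indicE; case: (_ \in _); rewrite ?normr1 ?normr0.
Qed.

Let gamt0 t : 0 <= gamt t.
Proof.
apply: Rintegral_ge0 => x _; rewrite mulr_ge0 ?powR_ge0//; exact: ltW (ww.2 x).
Qed.

Let N0 : 0 <= N. Proof. exact: powR_ge0. Qed.
Let B0_ge0 : 0 <= B0.
Proof.
by rewrite /B0 mulr_ge0// ?mulr_ge0 ?powR_ge0 ?exprn_ge0 ?(ltW l0)// (le_trans ler01 Gc1).
Qed.

Let dev := l ^- d * \int[mu]_(x in Q) `|f x - c|.

Let dev_itg : itg Q (fun x => `|f x - c|).
Proof. by apply: itg_norm => //; apply: itgB => //; exact: itg_cst. Qed.

(** Where |f - c| > t the truncation equals t/2, while its average over Q is at most dev <= t/8. The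
    gap of 3t/8 exceeds 2 (t/8), so the weak type estimate applies with T0 = t/8. *)
Let level_weight t : 0 < t -> 8 * dev <= t ->
  t `^ q * \int[mu]_(x in Q) (w x * ((t < `|f x - c|)%R : bool)%:R) <=
  (8 * B0) `^ q * gamt t `^ (q / p).
Proof.
move=> t0 td; have t80 : 0 < t / 8 by rewrite divr_gt0.
have := truncated_weak_type l0 p1 pq u1 up ww Auoo fi gi fg (trunc_lipschitz c t)
  (measurable_trunc_level c t) t80 (trunc_level_cst t0) t80 (le_trans ler01 Gc1) (HG t0).
rewrite -/Q -/c -/wQ -/N -/Lam -/(gamt t); set phi := avg Q _ => H.
have Ti : itg Q (trunc c t \o f) := itg_truncation (trunc_lipschitz c t) mQ Qoo fi.
have phiE : phi = l ^- d * \int[mu]_(x in Q) trunc c t (f x).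
  by rewrite /phi /avg [X in fine X](leb_cube a (ltW l0)).
have ld0 : 0 <= l ^- d by rewrite invr_ge0 exprn_ge0 ?ltW.
have phi0 : 0 <= phi by rewrite phiE mulr_ge0// Rintegral_ge0// => x _; exact: trunc_ge0.
have phit : 8 * phi <= t.
  apply: le_trans td; rewrite ler_wpM2l// phiE ler_wpM2l//.
  by apply: (Rint_mono mQ Ti dev_itg) => x _; exact: trunc_le.
have mb (h : Rd -> R) (t' : R) : measurable_fun Q h -> measurable_fun Q (fun x => (t' < h x)%R).
  by move=> mh; apply: measurable_fun_ltr mh; exact: measurable_cst.
have i1 : itg Q (fun x => w x * ((t < `|f x - c|)%R : bool)%:R).
  exact: itg_bool mQ wi (mb _ _ (itg_mfun dev_itg)).
have Tpi : itg Q (fun x => `|trunc c t (f x) - phi|).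
  by apply: (itg_norm mQ); apply: (itgB mQ Ti); exact: itg_cst.
have i2 : itg Q (fun x => w x * ((2 * (t / 8) < `|trunc c t (f x) - phi|)%R : bool)%:R).
  exact: itg_bool mQ wi (mb _ _ (itg_mfun Tpi)).
apply: (@le_trans _ _ (t `^ q * (B0 * gamt t `^ p^-1 / (t / 8)) `^ q)).
  rewrite ler_wpM2l ?powR_ge0//; apply: le_trans (le_trans H _); last first.
    by rewrite /B0 -!mulrA.
  apply: (Rint_mono mQ i1 i2) => x _; rewrite ler_wpM2l ?(ltW (ww.2 x))//.
  case: (ltP t `|f x - c|) => [tf|_]; last exact: ler0n.
  by rewrite (trunc_top tf) (level_gap t0 phi0 phit).
by rewrite powR_swap (rescaled_power q t0 B0_ge0 (powR_ge0 _ _)).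
Qed.

Let sum_gamt s n : 0 < s -> \sum_(k < n) gamt (16 ^+ k * s) <= gam.
Proof.
move=> s0; rewrite /gamt -(Rint_sum mQ (fun k : 'I_n => Gtr_itg (16 ^+ k * s))).
apply: (Rint_mono mQ _ Gi); first by apply: itg_sum.
move=> x Qx; rewrite (eq_bigr (fun k : 'I_n => G x `^ p * w x * \1_(trunc_level c (16 ^+ k * s)) (f x))).
  rewrite -mulr_sumr ler_piMr ?mulr_ge0 ?powR_ge0 ?(ltW (ww.2 x))//.
  exact: sum_trunc_level_le1.
by move=> k _; exact: Gtr_pow.
Qed.

Lemma strong_type_levels (s : R) : 0 < s -> 8 * dev <= s ->
  (\int[mu]_(x in Q) (`|f x - c| `^ q * w x)%:E <=
   (s `^ q * wQ + 16 `^ q * ((8 * B0) `^ q * gam `^ (q / p)))%:E)%E.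
Proof.
move=> s0 sd; apply: (layer_cake mQ (itg_mfun dev_itg) (fun x => normr_ge0 _) wi
  (fun x => ltW (ww.2 x)) s0 q0) => n; apply: (@le_trans _ _ (\sum_(k < n) (8 * B0) `^ q * gamt (16 ^+ k * s) `^ (q / p))).
  apply: ler_sum => k _; apply: level_weight; first by rewrite mulr_gt0 ?exprn_gt0.
  by apply: (le_trans sd); rewrite ler_peMl ?(ltW s0)// exprn_ege1// ler1n.
rewrite -mulr_sumr ler_wpM2l ?powR_ge0//.
have qp1 : 1 <= q / p by rewrite ler_pdivlMr// mul1r.
apply: (le_trans (sum_powR_le _ qp1 _)) => //.
apply: powR_le_base; [exact: le_trans ler01 qp1|by apply: sumr_ge0|exact: sum_gamt].
Qed.

Let Z := l * N * fine (Ap_const u w) `^ (p^-1 - q^-1) * Gc * (gam / wQ) `^ p^-1.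

Let Au1 : 1 <= fine (Ap_const u w).
Proof. exact: Au_ge1 l0 p1 u1 up ww Auoo. Qed.

Let gam0 : 0 <= gam.
Proof. apply: Rintegral_ge0 => x _; rewrite mulr_ge0 ?powR_ge0//; exact: ltW (ww.2 x). Qed.

Let Z0 : 0 <= Z.
Proof. by rewrite !mulr_ge0 ?powR_ge0 ?(ltW l0)// (le_trans ler01 Gc1). Qed.

Let dev_le : dev <= 2 ^+ d * 2 * Z.
Proof.
have osc := mean_oscillation l0 fi gi fg; have [_ hG] := G1.
have al0 : 0 <= p^-1 - q^-1 by rewrite subr_ge0 lef_pV2 ?posrE.
have D0 : 0 <= 2 ^+ d :> R by rewrite exprn_ge0.
exact: (oscillation_arith (exprn_gt0 d l0) l0 wQ0 gam0 N0 Gc1 (powR_ge1 Au1 al0) D0 osc hG).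
Qed.

Let B0_E : B0 * gam `^ p^-1 = 2 ^+ d * Z * wQ `^ q^-1.
Proof.
exact: (scaling_identity _ _ _ _ _ _ (le_trans ler01 Au1) wQ0 gam0).
Qed.

Lemma strong_type :
  (wmean q w Q (fun x => f x - c)%R <= (2 ^+ (d + 8) * Z)%:E)%E.
Proof.
apply/lee_addgt0Pr => tau tau0.
have [s [s0 sd bnd]] := strong_choice wQ0 Z0 B0_ge0 (powR_ge0 gam p^-1)
  (exprn_ge0 d (ler0n R 2)) (le_trans p1 pq) B0_E dev_le tau0.
have HI := strong_type_levels s0 sd; set I := integral _ _ _ in HI.
have wmE : wmeasure w Q = wQ%:E by rewrite /wmeasure (Rint_EFin mQ wi).
rewrite /wmean wmE inver (gt_eqF wQ0) -EFinD.
set y := 2 ^+ (d + 8) * Z + tau; have y0 : 0 <= y.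
  apply: addr_ge0 _ (ltW tau0); apply: mulr_ge0 _ Z0; exact: exprn_ge0.
have yE : y = 256 * 2 ^+ d * Z + tau by rewrite /y exprD; congr (_ + _); ring.
rewrite -yE in bnd; rewrite powR_swap in HI.
have I0 : (0 <= I)%E.
  apply: integral_ge0 => x _; rewrite lee_fin.
  exact: mulr_ge0 (powR_ge0 _ _) (ltW (ww.2 x)).
apply: (normalized_root_le wQ0 y0 q0 I0); apply: (le_trans HI).
by rewrite lee_fin; exact: bnd.
Qed.

End strong_type.

(** * Gradient norms *)

Section sobolev.
Context {R : realType} {d : nat}.
Local Notation mu := (leb R d).
Local Notation Rd := (caratheodory_type (borel_lebesgue R d)^*%mu).
Local Notation itg D f := (mu.-integrable D (EFin \o f)).

Lemma wLp_itg (p : R) (w : Rd -> R) (Q : set Rd) (h : Rd -> R) : 0 < p -> weight w ->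
  measurable Q -> wLp p (fun x => w x `^ p^-1) Q h ->
  lmeasurable_fun Q h /\ itg Q (fun x => `|h x| `^ p * w x).
Proof.
move=> p0 ww mQ [mh hoo]; split=> //; apply/integrableP; split.
  apply/measurable_EFinP; apply: measurable_funM; last exact: lmeasurable_sub.
  by apply: (measurableT_comp (measurable_powR _)); apply: (measurableT_comp (@normr_measurable R setT)).
have pn : p^-1 != 0 by rewrite invr_neq0 ?gt_eqF.
have : (\int[mu]_(x in Q) (`|h x| `^ p * (w x `^ p^-1) `^ p)%:E < +oo)%E.
  by rewrite ltey; apply/eqP => E; move: hoo; rewrite /wLnorm E poweRyr.
congr (_ < _)%E; apply: eq_integral => x _ /=; have w0 := ltW (ww.2 x).
by rewrite powRVK ?gt_eqF// [`|_ * w x|]ger0_norm// mulr_ge0 ?powR_ge0.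
Qed.

Lemma normr_le_enorm (g : 'I_d -> Rd -> R) i x : `|g i x| <= enorm g x.
Proof.
rewrite /enorm -sqrtr_sqr ler_sqrt ?sumr_ge0//; last by move=> j _; exact: sqr_ge0.
by rewrite (bigD1 i)//= lerDl sumr_ge0// => j _; exact: sqr_ge0.
Qed.

Lemma enorm_le_sum (g : 'I_d -> Rd -> R) x : enorm g x <= \sum_i `|g i x|.
Proof.
have S0 : 0 <= \sum_i `|g i x| by exact: sumr_ge0.
rewrite /enorm -(ger0_norm S0) -sqrtr_sqr ler_sqrt ?sqr_ge0//.
rewrite expr2 mulr_suml; apply: ler_sum => i _.
by rewrite -real_normK ?num_real// expr2 ler_wpM2l// (bigD1 i)//= lerDl sumr_ge0.
Qed.

Lemma enorm_ge0 (g : 'I_d -> Rd -> R) x : 0 <= enorm g x.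
Proof. exact: sqrtr_ge0. Qed.

Lemma sum_le_enorm (g : 'I_d -> Rd -> R) x : \sum_i `|g i x| <= d%:R * enorm g x.
Proof.
apply: (@le_trans _ _ (\sum_(i < d) enorm g x)); first by apply: ler_sum => i _; exact: normr_le_enorm.
by rewrite sumr_const card_ord mulr_natl.
Qed.

Lemma sum_powR_le_card (p : R) (x : 'I_d -> R) : 1 <= p -> (forall i, 0 <= x i) ->
  (\sum_i x i) `^ p <= d%:R `^ p * \sum_i x i `^ p.
Proof.
move=> p1 x0; have p0 : 0 < p by exact: lt_le_trans p1.
have S0 : 0 <= \sum_i x i `^ p by apply: sumr_ge0 => i _; exact: powR_ge0.
have m i : x i <= (\sum_j x j `^ p) `^ p^-1.
  rewrite -[leLHS](@powRK _ p) ?gt_eqF//; apply: powR_le_base; rewrite ?invr_ge0 ?(ltW p0) ?powR_ge0//.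
  by rewrite (bigD1 i)//= lerDl sumr_ge0// => j _; exact: powR_ge0.
apply: (@le_trans _ _ ((d%:R * (\sum_j x j `^ p) `^ p^-1) `^ p)).
  apply: powR_le_base; rewrite ?(ltW p0) ?sumr_ge0//.
  by rewrite mulr_natl -[X in _ *+ X](card_ord d) -sumr_const ler_sum.
by rewrite powRM ?powR_ge0// powRVK ?gt_eqF.
Qed.

Variables (a : 'rV[R]_d) (l : R) (w : Rd -> R) (p : R) (g : 'I_d -> Rd -> R).
Hypotheses (p1 : 1 <= p) (ww : weight w).
Let Q : set Rd := cube a l.
Hypotheses (mg : forall i, lmeasurable_fun Q (g i)).
Hypothesis gp : forall i, itg Q (fun x => `|g i x| `^ p * w x).
Let G x := \sum_i `|g i x|.
Let mQ : measurable Q. Proof. exact: cube_measurable. Qed.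
Let p0 : 0 < p. Proof. exact: lt_le_trans p1. Qed.
Let w0 x : 0 <= w x. Proof. exact: ltW (ww.2 x). Qed.
Let mw : measurable_fun Q w. Proof. exact: lmeasurable_sub. Qed.
Let mng i : measurable_fun Q (fun x => `|g i x|).
Proof. exact: measurableT_comp (@normr_measurable R setT) (mg i). Qed.
Let mG : measurable_fun Q G. Proof. by apply: measurable_sum. Qed.
Let G0 x : 0 <= G x. Proof. exact: sumr_ge0. Qed.

Lemma gradient_sum_itg : itg Q (fun x => G x `^ p * w x).
Proof.
have si : itg Q (fun x => d%:R `^ p * \sum_i `|g i x| `^ p * w x).
  apply: itgZ => //; exact: itg_sum.
apply: (itg_le mQ _ _ si) => [|x _].
  by apply: measurable_funM mw; apply: (measurableT_comp (measurable_powR _)).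
rewrite ger0_norm ?mulr_ge0 ?powR_ge0// -mulr_suml mulrA ler_wpM2r//.
exact: sum_powR_le_card.
Qed.

Lemma enorm_itg : itg Q (fun x => `|enorm g x| `^ p * w x).
Proof.
apply: (itg_le mQ _ _ gradient_sum_itg) => [|x _].
  apply: measurable_funM mw; apply: (measurableT_comp (measurable_powR _)).
  apply: (measurableT_comp (@normr_measurable R setT)).
  rewrite /enorm (_ : (fun x => _) = fun x => (\sum_i g i x ^+ 2) `^ 2^-1); last first.
    by apply/funext => x; rewrite powR12_sqrt// sumr_ge0// => i _; exact: sqr_ge0.
  apply: (measurableT_comp (measurable_powR _)); apply: measurable_sum => i.
  exact: measurable_funM (mg i) (mg i).
have e0 := enorm_ge0 g x.
rewrite (ger0_norm e0) ger0_norm ?mulr_ge0 ?powR_ge0// ler_wpM2r//.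
by apply: powR_le_base (enorm_le_sum g x) => //; exact: ltW.
Qed.

(** The tree estimates use the sum of the |g i|, in which the directions simply add up; the
    Euclidean norm of the theorem costs a factor d after p-th roots. *)
Lemma gradient_sum_le : \int[mu]_(x in Q) (G x `^ p * w x) <=
  d%:R `^ p * \int[mu]_(x in Q) (`|enorm g x| `^ p * w x).
Proof.
rewrite -(RintegralZl _ mQ enorm_itg).
apply: (Rint_mono mQ gradient_sum_itg (itgZ _ mQ enorm_itg)) => x _.
rewrite mulrA ler_wpM2r// -powRM//; apply: powR_le_base (ltW p0) (G0 x) _.
by rewrite (ger0_norm (enorm_ge0 g x)); exact: sum_le_enorm.
Qed.

Lemma truncated_gradient (f : Rd -> R) (J : set R) : itg Q f -> measurable J ->
  [/\ lmeasurable_fun Q (fun x => \sum_i (`|g i x| * \1_J (f x))),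
      forall x, 0 <= \sum_i (`|g i x| * \1_J (f x)),
      itg Q (fun x => (\sum_i (`|g i x| * \1_J (f x))) `^ p * w x) &
      \int[mu]_(x in Q) ((\sum_i (`|g i x| * \1_J (f x))) `^ p * w x) <=
      \int[mu]_(x in Q) (G x `^ p * w x)].
Proof.
move=> fi mJ; have mJf : measurable_fun Q (fun x => \1_J (f x) : R).
  apply: (@measurableT_comp _ _ _ _ _ _ (\1_J : R -> R)); last exact: itg_mfun fi.
  exact: measurable_indic.
have mH : measurable_fun Q (fun x => \sum_i (`|g i x| * \1_J (f x))).
  by apply: measurable_sum => i; apply: measurable_funM.
have H0 x : 0 <= \sum_i (`|g i x| * \1_J (f x)).
  by apply: sumr_ge0 => i _; rewrite mulr_ge0// indicE.
have HG x : (\sum_i (`|g i x| * \1_J (f x))) `^ p * w x <= G x `^ p * w x.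
  rewrite ler_wpM2r//; apply: powR_le_base (ltW p0) (H0 x) _; apply: ler_sum => i _.
  by rewrite ler_piMr// indicE; case: (_ \in _).
have Hi : itg Q (fun x => (\sum_i (`|g i x| * \1_J (f x))) `^ p * w x).
  apply: (itg_le mQ _ _ gradient_sum_itg) => [|x _].
    by apply: measurable_funM mw; apply: (measurableT_comp (measurable_powR _)).
  by rewrite ger0_norm// mulr_ge0 ?powR_ge0.
split; [exact: mH|exact: H0|exact: Hi|].
by apply: (Rint_mono mQ Hi gradient_sum_itg) => x _; exact: HG.
Qed.

End sobolev.

(** * The three constants *)

(** A tree constant of at least 1 is needed because the bound on the mean oscillation, free of this
    constant, is absorbed into the same right-hand side. *)
Lemma exponent_constant_ge1 (R : realType) (alpha r W k : R) : 0 < alpha -> 0 < r -> 1 <= W -> 0 <= k ->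
  1 <= 4 * ((1 - 2 `^ (- alpha))^-1 + (1 - 2 `^ (- r))^-1) * (4 * W) `^ k.
Proof.
move=> al0 r0 W1 k0.
have inv1 (s : R) : 0 < s -> 1 <= (1 - 2 `^ (- s))^-1.
  move=> s0; have h : 2 `^ (- s) < 1 :> R.
    rewrite powRN invf_lt1 ?powR_gt0//.
    by have := @gt0_ltr_powR _ s s0 1 2; rewrite powR1; apply; rewrite ?nnegrE// ltr1n.
  by rewrite invf_ge1 ?subr_gt0// gerBl powR_ge0.
have := inv1 _ al0; have := inv1 _ r0; set x := _^-1; set y := _^-1 => x1 y1.
have : 1 <= (4 * W) `^ k by apply: powR_ge1 => //; lra.
set z := _ `^ k => z1; have h4 : 1 <= 4 * (y + x) by lra.
by rewrite -[leLHS]mulr1; apply: ler_pM.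
Qed.

Lemma constant_arrangement (R : realType) (E l N A G D g : R) :
  E * (l * N * A * G) * (D * g) = E * D * G * (l * g * N * A).
Proof. by ring. Qed.

(** * The inequality for a fixed function, with explicit constants *)

Section inequality.
Context {R : realType} {d : nat}.
Local Notation mu := (leb R d).
Local Notation Rd := (caratheodory_type (borel_lebesgue R d)^*%mu).
Local Notation itg D f := (mu.-integrable D (EFin \o f)).
Variables (a : 'rV[R]_d) (l : R) (w : Rd -> R) (p q u : R).
Hypotheses (d_gt0 : (0 < d)%N) (l0 : 0 < l) (p1 : 1 <= p) (pq : p <= q) (u1 : 1 <= u) (up : u <= p).
Hypotheses (ww : weight w) (Auoo : (Ap_const u w < +oo)%E).
Let Q : set Rd := cube a l.
Let alpha := p^-1 - q^-1.
Let eps := (d%:R * u)^-1 - alpha.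
Hypothesis eps0 : 0 <= eps.
Variables (f : Rd -> R) (g : 'I_d -> Rd -> R).
Hypothesis fg : W1p p (fun x => w x `^ p^-1) Q f g.

Let p0 : 0 < p. Proof. exact: lt_le_trans p1. Qed.
Let mQ : measurable Q. Proof. exact: cube_measurable. Qed.
Let Apoo : (Ap_const p w < +oo)%E.
Proof. exact: le_lt_trans (Ap_const_mono u1 up ww Auoo) Auoo. Qed.
Let fi : itg Q f.
Proof.
by have [mf fp] := wLp_itg p0 ww mQ fg.1; have [] := Ap_key p1 ww Apoo l0 mf fp.
Qed.
Let mg i : lmeasurable_fun Q (g i).
Proof. by have [] := wLp_itg p0 ww mQ (fg.2 i).1. Qed.
Let gp i : itg Q (fun x => `|g i x| `^ p * w x).
Proof. by have [] := wLp_itg p0 ww mQ (fg.2 i).1. Qed.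
Let wi : itg Q w. Proof. by have [] := Ap_cube a p1 ww Apoo l0. Qed.

Let wQ := \int[mu]_(x in Q) w x.
Let gam := \int[mu]_(x in Q) ((\sum_i `|g i x|) `^ p * w x).
Let gr := (wQ^-1 * \int[mu]_(x in Q) (`|enorm g x| `^ p * w x)) `^ p^-1.
Let rhs := l * gr * fine (Ap_const p w) `^ p^-1 * fine (Ap_const u w) `^ alpha.

Let wQ0 : 0 < wQ. Proof. exact: cube_weight_gt0. Qed.

Let gr0 : 0 <= gr. Proof. exact: powR_ge0. Qed.

Let rhs0 : 0 <= rhs.
Proof. by rewrite /rhs !mulr_ge0 ?powR_ge0// ltW. Qed.

Lemma wmean_enorm : wmean p w Q (enorm g) = gr%:E.
Proof.
rewrite /wmean /wmeasure (Rint_EFin mQ wi) inver (gt_eqF wQ0).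
by rewrite (Rint_EFin mQ (enorm_itg p1 ww mg gp)) -EFinM poweR_EFin.
Qed.

Let gam_le : (gam / wQ) `^ p^-1 <= d%:R * gr.
Proof.
have h := gradient_sum_le p1 ww mg gp.
have d0 : 0 <= d%:R :> R by [].
rewrite -[d%:R](@powRK _ p) ?gt_eqF// /gr -powRM ?powR_ge0//; last first.
  rewrite mulr_ge0 ?invr_ge0 ?(ltW wQ0)// Rintegral_ge0// => x _.
  by rewrite mulr_ge0 ?powR_ge0// ltW// ww.2.
have gam0 : 0 <= gam.
  by apply: Rintegral_ge0 => x _; rewrite mulr_ge0 ?powR_ge0// ltW// ww.2.
apply: powR_le_base; rewrite ?invr_ge0 ?(ltW p0) ?divr_ge0 ?(ltW wQ0)//.
by rewrite mulrCA mulrC ler_wpM2l// invr_ge0 ltW.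
Qed.

Lemma poincare_tree_constant (Gc : R) : 1 <= Gc ->
  (forall t, 0 < t -> tree_constant a l w p q u
    (fun x => \sum_i (`|g i x| * \1_(trunc_level (avg Q f) t) (f x))) Gc) ->
  (wmean q w Q (fun x => f x - avg Q f)%R <= (2 ^+ (d + 8) * d%:R * Gc * rhs)%:E)%E.
Proof.
move=> Gc1 HG; have Gi := gradient_sum_itg p1 ww mg gp.
have := strong_type l0 p1 pq u1 up ww Auoo fi mg (fun i => (fg.2 i).2) Gi Gc1 HG.
move=> H; apply: (le_trans H); rewrite lee_fin.
have X0 : 0 <= 2 ^+ (d + 8) * (l * fine (Ap_const p w) `^ p^-1 * fine (Ap_const u w) `^ alpha * Gc).
  apply: mulr_ge0; first exact: exprn_ge0.
  by rewrite !mulr_ge0 ?powR_ge0 ?(ltW l0)// (le_trans ler01 Gc1).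
rewrite mulrA; apply: le_trans (ler_wpM2l X0 gam_le) _.
by rewrite constant_arrangement.
Qed.

Lemma poincare_eps : 0 < eps ->
  (wmean q w Q (fun x => f x - avg Q f)%R <= (2 ^+ (d + 8) * d%:R * (2 / eps) * rhs)%:E)%E.
Proof.
move=> eps_gt0; apply: poincare_tree_constant => [|t t0].
  rewrite ler_pdivlMr// mul1r; apply: (@le_trans _ _ 1); last by rewrite ler1n.
  have du1 : 1 <= d%:R * u.
    by have d1 : 1 <= d%:R :> R; rewrite ?ler1n//; apply: (le_trans d1); rewrite ler_peMr.
  apply: (@le_trans _ _ (d%:R * u)^-1); last by rewrite invf_le1 ?(lt_le_trans ltr01 du1).
  by rewrite gerBl subr_ge0 lef_pV2 ?posrE// (lt_le_trans p0).
have [mH H0 Hi _] := truncated_gradient p1 ww mg gp fi (measurable_trunc_level (avg Q f) t).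
exact: (tree_constant_levels d_gt0 l0 p1 pq u1 up ww Auoo eps0 mH H0 Hi).
Qed.

Let Calpha := 4 * ((1 - 2 `^ (- alpha))^-1 + (1 - 2 `^ (- q^-1))^-1).

Lemma poincare_Ainfty : 0 < alpha -> (Ainfty_const w < +oo)%E ->
  (wmean q w Q (fun x => f x - avg Q f)%R <=
   (2 ^+ (d + 8) * d%:R * (Calpha * (4 * fine (Ainfty_const w)) `^ (1 - p^-1)) * rhs)%:E)%E.
Proof.
move=> al0 Woo; apply: poincare_tree_constant => [|t t0].
  have q0 : 0 < q^-1 by rewrite invr_gt0 (lt_le_trans p0).
  have W1 : 1 <= fine (Ainfty_const w).
    have := Ainfty_ge1 l0 ww wi; move: Woo; case: (Ainfty_const w) => [r _|//|//].
    by rewrite lee_fin.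
  by apply: (exponent_constant_ge1 al0 q0 W1); rewrite subr_ge0 invf_le1.
have [mH H0 Hi _] := truncated_gradient p1 ww mg gp fi (measurable_trunc_level (avg Q f) t).
exact: (tree_constant_Ainfty d_gt0 l0 p1 pq u1 up ww Auoo eps0 mH H0 Hi).
Qed.

(** All truncated gradients vanish, so the tree constant 1 is available and the right-hand side is
    0. *)
Lemma poincare_constant : gr = 0 ->
  (wmean q w Q (fun x => f x - avg Q f)%R <= 0)%E.
Proof.
move=> gr_eq0; have := @poincare_tree_constant 1 (lexx _).
rewrite /rhs gr_eq0 mulr0 !mul0r mulr0; apply => t t0.
have [mH H0 Hi Hle] := truncated_gradient p1 ww mg gp fi (measurable_trunc_level (avg Q f) t).
apply: (tree_constant0 q l0 p1 u1 up ww Auoo mH H0 Hi).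
have I0 : 0 <= \int[mu]_(x in Q) (`|enorm g x| `^ p * w x).
  by apply: Rintegral_ge0 => x _; rewrite mulr_ge0 ?powR_ge0// ltW// ww.2.
have Iz : \int[mu]_(x in Q) (`|enorm g x| `^ p * w x) = 0.
  move/eqP: gr_eq0; rewrite /gr powR_eq0 => /andP[+ _].
  by rewrite mulf_eq0 invr_eq0 (gt_eqF wQ0) => /eqP.
have := gradient_sum_le p1 ww mg gp; rewrite Iz mulr0 => /(le_trans Hle) H1.
apply/le_anti; rewrite [dcube a l [::]]dcube_nil H1/=.
by apply: Rintegral_ge0 => x _; rewrite mulr_ge0 ?powR_ge0// ltW// ww.2.
Qed.
End inequality.

(** * Choice of the constant depending on p, q and d *)

Lemma hoelder_conjugate_inv (R : realType) (p : R) : 1 < p ->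
  (fine (hoelder_conjugate p%:E))^-1 = 1 - p^-1.
Proof.
move=> p1; have p0 : 0 < p by exact: lt_trans p1.
have pm : p - 1 != 0 by rewrite subr_eq0 gt_eqF.
have -> : hoelder_conjugate p%:E = (p / (p - 1))%:E.
  by rewrite /hoelder_conjugate /= eqe (gt_eqF p0) -EFinB inver (negbTE pm) -EFinM.
by rewrite /= invf_div mulrBl mul1r divff ?gt_eqF.
Qed.

Lemma Ainfty_arith (R : realType) (S W k c C x : R) : 0 <= S -> 1 <= W -> 0 <= k -> k <= 1 ->
  16 * S <= c -> 0 <= C -> 0 <= x ->
  C * (4 * S * (4 * W) `^ k) * x <= C * c * x * W `^ k.
Proof.
move=> S0 W1 k0 k1 Sc C0 x0; have W0 : 0 <= W by exact: le_trans W1.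
have h4 : 4 `^ k <= 4 :> R by rewrite -[leRHS]powRr1// ler_powR// ler1n.
rewrite powRM//.
have -> : C * c * x * W `^ k = C * (c * W `^ k) * x by ring.
rewrite ler_wpM2r// ler_wpM2l// mulrA ler_wpM2r ?powR_ge0//.
apply: le_trans Sc; apply: (@le_trans _ _ (4 * S * 4)); last by rewrite le_eqVlt; apply/orP; left; apply/eqP; ring.
by rewrite ler_wpM2l// mulr_ge0.
Qed.

Lemma eps_arith (R : realType) (C x eps c : R) : 0 <= C -> 0 <= x -> 0 <= eps -> 2 <= c ->
  C * (2 / eps) * x <= C * c * x * eps^-1.
Proof.
move=> C0 x0 e0 c2; have -> : C * c * x * eps^-1 = C * (c / eps) * x by ring.
by rewrite ler_wpM2r// ler_wpM2l// ler_wpM2r// invr_ge0.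
Qed.

Lemma rhs_constant (R : realType) (C l g r s : R) (x a b : \bar R) :
  x = g%:E -> a = (fine a)%:E -> b = (fine b)%:E ->
  (C%:E * l%:E * x * a `^ r * b `^ s = (C * (l * g * fine a `^ r * fine b `^ s)%R)%:E)%E.
Proof. by move=> -> -> ->; rewrite !poweR_EFin -!EFinM !mulrA. Qed.

Theorem corollary4p4 (R : realType) (d : nat) (p q : R)
    (d_gt0 : (0 < d)%N) (p_ge1 : 1 <= p) (le_pq : p <= q) :
  exists2 C : R, 0 < C &
    forall (a : 'rV[R]_d) (l : R) (u : R) (w : 'rV[R]_d -> R),
      let Q := cube a l in
      let eps := (d%:R * u)^-1 - (p^-1 - q^-1) in
      0 < l -> 1 <= u -> u <= p -> Ap u w -> 0 <= eps ->
      forall (f : 'rV[R]_d -> R) (Df : 'I_d -> 'rV[R]_d -> R),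
        W1p p (fun x => w x `^ p^-1) Q f Df ->
        let bound_with (K : \bar R) :=
          (wmean q w Q (fun x => f x - avg Q f)%R
           <= C%:E * l%:E * wmean p w Q (enorm Df)
              * Ap_const p w `^ p^-1 * Ap_const u w `^ (p^-1 - q^-1) * K)%E in
        [/\ 0 < eps -> bound_with (eps^-1)%:E,
            1 < p -> bound_with
              (Ainfty_const w `^ (fine (hoelder_conjugate p%:E))^-1)%E
          & p = 1 -> bound_with (Ainfty_const w)].
Proof.
have p0 : 0 < p by exact: lt_le_trans p_ge1.
have q0 : 0 < q by exact: lt_le_trans le_pq.
(* For p = q the first inverse is 0^-1 = 0; that case is handled by the estimate with 1/eps. *)
pose S : R := (1 - 2 `^ (- (p^-1 - q^-1)))^-1 + (1 - 2 `^ (- q^-1))^-1.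
have S0 : 0 <= S.
  have h (s : R) : 0 <= s -> 0 <= (1 - 2 `^ (- s))^-1 :> R.
    by move=> s0; rewrite invr_ge0 subr_ge0 powRN invf_le1 ?powR_gt0// powR_ge1// ler1n.
  by rewrite addr_ge0// h// ?invr_ge0 ?(ltW q0)// subr_ge0 lef_pV2 ?posrE.
pose C0 : R := 2 ^+ (d + 8) * d%:R.
have C00 : 0 < C0 by rewrite mulr_gt0 ?exprn_gt0 ?ltr0n.
(* The summands serve, in this order, K = 1/eps, the case p = q, and the powers of the A_infty
   constant. *)
pose c1 : R := 2 + 2 * (d%:R * p) + 16 * S.
have dp0 : 0 <= d%:R * p by rewrite mulr_ge0// ltW.
have c1_2 : 2 <= c1 by rewrite /c1; lra.
have c1_dp : 2 * (d%:R * p) <= c1 by rewrite /c1; lra.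
have c1_S : 16 * S <= c1 by rewrite /c1; lra.
have c10 : 0 < c1 by lra.
have C_gt0 : 0 < C0 * c1 by exact: mulr_gt0.
exists (C0 * c1) => // a l u w Q eps l0 u1 up [ww Auoo] eps0 f Df Wf bound_with.
have Apoo := le_lt_trans (Ap_const_mono u1 up ww Auoo) Auoo.
have [wi _] := Ap_cube a p_ge1 ww Apoo l0.
have fin_ge1 (x : \bar R) : 1 <= fine x -> x = (fine x)%:E.
  by case: x => [r//|/=|/=]; rewrite ler10.
have EAu : Ap_const u w = (fine (Ap_const u w))%:E by apply: fin_ge1; exact: Au_ge1 l0 p_ge1 u1 up ww Auoo.
have Ap1 := Au_ge1 a l0 p_ge1 p_ge1 (lexx p) ww Apoo.
have EAp : Ap_const p w = (fine (Ap_const p w))%:E by apply: fin_ge1.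
have EE := wmean_enorm l0 p_ge1 u1 up ww Auoo Wf.
move: EE; set gr := _ `^ p^-1 => EE.
have gr0 : 0 <= gr by exact: powR_ge0.
pose rhs := l * gr * fine (Ap_const p w) `^ p^-1 * fine (Ap_const u w) `^ (p^-1 - q^-1).
have rhs0 : 0 <= rhs by rewrite /rhs !mulr_ge0 ?powR_ge0// ltW.
have boundE K : bound_with K = (wmean q w Q (fun x => f x - avg Q f)%R <= (C0 * c1 * rhs)%:E * K)%E.
  by rewrite /bound_with (rhs_constant _ _ _ _ EE EAp EAu).
have beps : 0 < eps -> (wmean q w Q (fun x => f x - avg Q f)%R <= (C0 * (2 / eps) * rhs)%:E)%E.
  exact: poincare_eps.
have K1 (c : R) (K : \bar R) : 0 <= c -> c <= c1 -> (1 <= K)%E ->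
    ((C0 * c * rhs)%:E <= (C0 * c1 * rhs)%:E * K)%E.
  move=> c0 cc1 hK; apply: (@le_trans _ _ ((C0 * c1 * rhs)%:E * 1)%E).
    by rewrite mule1 lee_fin ler_wpM2r// ler_wpM2l// ltW.
  by apply: lee_wpmul2l => //; rewrite lee_fin mulr_ge0// ltW.
have W1 := Ainfty_ge1 l0 ww wi.
(* The cases p > 1 and p = 1 together: K is at least 1, dominates the power 1 - 1/p of a finite
   A_infty constant, and is infinite along with it. *)
have gen (K : \bar R) : (1 <= K)%E ->
    ((Ainfty_const w < +oo)%E -> ((fine (Ainfty_const w) `^ (1 - p^-1))%:E <= K)%E) ->
    (Ainfty_const w = +oo%E -> K = +oo%E) -> bound_with K.
  move=> hK WK Wy; rewrite boundE.
  have : 0 <= p^-1 - q^-1 by rewrite subr_ge0 lef_pV2 ?posrE.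
  rewrite le_eqVlt => /predU1P[al_eq0|al0].
    (* For p = q, 1/eps = du <= dp depends on d and p only, and K >= 1. *)
    have epsE : eps = (d%:R * u)^-1 by rewrite /eps -al_eq0 subr0.
    have du0 : 0 < d%:R * u by rewrite mulr_gt0 ?ltr0n// (lt_le_trans ltr01).
    apply: le_trans (beps _) _; first by rewrite epsE invr_gt0.
    apply: K1 => //; rewrite epsE invrK; first by rewrite mulr_ge0// ltW.
    by apply: le_trans c1_dp; rewrite !ler_wpM2l.
  (* With an infinite constant the bound is +oo if the gradient term is positive; if that term is 0
     the product 0 * +oo is 0, and the left-hand side must be shown to vanish. *)
  have [Wy'|Wn] := eqVneq (Ainfty_const w) +oo%E.
    have [gr_eq0|grn0] := eqVneq gr 0.
      apply: (@le_trans _ _ 0%E); last first.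
        by apply: mule_ge0; [rewrite lee_fin mulr_ge0// ltW|exact: le_trans hK].
      exact: (poincare_constant l0 p_ge1 le_pq u1 up ww Auoo Wf gr_eq0).
    rewrite (Wy Wy') gt0_muley ?leey// lte_fin mulr_gt0//.
    have gr_gt0 : 0 < gr by rewrite lt0r grn0.
    have Au0 : 0 < fine (Ap_const u w).
      by apply: (lt_le_trans ltr01); exact: (Au_ge1 a l0 p_ge1 u1 up ww Auoo).
    have Ap0 : 0 < fine (Ap_const p w) by exact: lt_le_trans Ap1.
    exact: mulr_gt0 (mulr_gt0 (mulr_gt0 l0 gr_gt0) (powR_gt0 _ Ap0)) (powR_gt0 _ Au0).
  have Woo : (Ainfty_const w < +oo)%E by rewrite ltey.
  have PA := poincare_Ainfty d_gt0 l0 p_ge1 le_pq u1 up ww Auoo eps0 Wf al0 Woo.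
  apply: (le_trans PA); apply: (@le_trans _ _ ((C0 * c1 * rhs)%:E * (fine (Ainfty_const w) `^ (1 - p^-1))%:E)%E).
    rewrite -EFinM lee_fin; apply: (Ainfty_arith S0 _ _ _ c1_S (ltW C00) rhs0).
    - by move: W1 Woo; case: (Ainfty_const w) => [r|//|//]; rewrite lee_fin.
    - by rewrite subr_ge0 invf_le1.
    - by rewrite gerBl invr_ge0 ltW.
  by apply: lee_wpmul2l (WK Woo); rewrite lee_fin mulr_ge0// ltW.
split.
- move=> eps_gt0; rewrite boundE; apply: (le_trans (beps eps_gt0)).
  rewrite -EFinM lee_fin; exact: (eps_arith (ltW C00) rhs0 (ltW eps_gt0) c1_2).
- move=> p_gt1.
  have -> : (fine (hoelder_conjugate p%:E))^-1 = 1 - p^-1.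
    exact: hoelder_conjugate_inv.
  have k0 : 0 < 1 - p^-1 by rewrite subr_gt0 invf_lt1.
  have WK : (Ainfty_const w < +oo)%E -> ((fine (Ainfty_const w) `^ (1 - p^-1))%:E <= Ainfty_const w `^ (1 - p^-1))%E.
    by move: W1; case: (Ainfty_const w) => [r _ _|//|//]; rewrite poweR_EFin.
  have Wy : Ainfty_const w = +oo%E -> (Ainfty_const w `^ (1 - p^-1) = +oo)%E.
    by move=> ->; rewrite poweRyr ?gt_eqF.
  apply: gen => //; move: W1 Wy; case: (Ainfty_const w) => [r r1 _|_ ->//|//].
    by rewrite poweR_EFin lee_fin powR_ge1// ltW.
(* The exponent 1 - 1/p is 0, so the required lower bound on K is 1. *)
- move=> p_eq1; apply: gen => //; rewrite p_eq1 invr1 subrr powRr0.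
  by move=> _; exact: W1.
Qed.
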